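(* A random variable $X\in\mathcal{H}^*$ is characterized from its expected record sequence if and only if the random variable $T=\varphi(X)\in\mathcal{T}$ is characterized from its moments.
   Context: Identically distributed random variables are regarded as equal. Inverse distribution functions are left-continuous: $F^{-1}(u)=\inf\{x:F(x)\ge u\}$, $0<u<1$. Put $L(u)=-\log(1-u)$, $0<u<1$. Records: let $U_1<U_2<\cdots$ be the sequence of (upper) record values of an i.i.d. sequence $V_1,V_2,\ldots$ from the uniform distribution on $(0,1)$: $\tau_1=1$, $U_1=V_1$, $\tau_{n+1}=\inf\{m>\tau_n:V_m>U_n\}$, $U_{n+1}=V_{\tau_{n+1}}$ (so $U_n$ has density $L(u)^{n-1}/(n-1)!$ on $(0,1)$). For $X$ with distribution function $F$, put $R_n=F^{-1}(U_n)$; the expected record sequence of $X$ is $\rho_n=\mathbb{E}R_n$, $n\ge1$. A function $H:(0,\infty)\to\mathbb{R}$ belongs to $\mathcal{H}^*$ if it is non-constant, non-decreasing, left-continuous and $\int_0^\infty y^m e^{-y}|H(y)|\,dy<\infty$ for $m=0,1,2,\ldots$. A random variable $X$ is said to belong to $\mathcal{H}^*$ if its inverse distribution function $G$ can be written as $G(u)=H(-\log(1-u))$, $0<u<1$, with $H\in\mathcal{H}^*$ (equivalently, $X$ is non-degenerate and $\mathbb{E}|R_n|<\infty$ for all $n$). $\mathcal{T}$ is the set of all random variables $T$ with $\Pr(T>0)=1$ and finite moments of every order. Map $\varphi$: for $X\in\mathcal{H}^*$ with distribution function $F$, $\varphi(X):=L(F(V))$, where $V$ is a random variable with Lebesgue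 density $f_V(x)=(1-F(x))L(F(x))\big/\int_{\mathbb{R}}(1-F(y))L(F(y))\,dy$, $x\in\mathbb{R}$, with the convention $(1-F(x))L(F(x))=0$ if $F(x)\in\{0,1\}$. $X\in\mathcal{H}^*$ is characterized from its expected record sequence if every $X'\in\mathcal{H}^*$ with the same expected record sequence as $X$ has the same distribution as $X$. $T\in\mathcal{T}$ is characterized from its moments if every $T'\in\mathcal{T}$ with $\mathbb{E}(T')^n=\mathbb{E}T^n$ for all $n=0,1,2,\ldots$ has the same distribution as $T$. *)

(* Defs.v *)
From HB Require Import structures.
From mathcomp Require Import all_boot all_order all_algebra finmap.
From mathcomp Require Import all_classical all_reals all_analysis.
Set Implicit Arguments.
Unset Strict Implicit.
Unset Printing Implicit Defensive.
Import Order.TTheory GRing.Theory Num.Theory.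
Import numFieldNormedType.Exports.
Local Open Scope classical_set_scope.
Local Open Scope ring_scope.

Definition Lfun (R : realType) (u : R) : R := - ln (1 - u).

Definition df d (Om : measurableType d) (R : realType) (P : probability Om R)
  (X : {RV P >-> R}) (x : R) : R := fine (cdf X x).

(* Only meaningful for 0 < u < 1. *)
Definition quantile (R : realType) (F : R -> R) (u : R) : R :=
  inf [set x | u <= F x].

(* Distributions are compared on measurable sets only: on other sets the values
   of [distribution] are artefacts of the extension of the measure. *)
Definition same_distribution (R : realType)
  d (Om : measurableType d) (P : probability Om R) (X : {RV P >-> R})
  d' (Om' : measurableType d') (P' : probability Om' R) (X' : {RV P' >-> R}) :
  Prop :=
  forall A : set R, measurable A -> distribution P X A = distribution P' X' A.

Definition has_density d (Om : measurableType d) (R : realType)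
  (P : probability Om R) (X : {RV P >-> R}) (f : R -> R) : Prop :=
  forall A : set R, measurable A ->
    distribution P X A = (\int[lebesgue_measure]_(x in A) (f x)%:E)%E.

Definition mutually_independent d (Om : measurableType d) (R : realType)
  (P : probability Om R) (V : nat -> {RV P >-> R}) : Prop :=
  forall (J : {fset nat}) (B : nat -> set R),
    (forall i, i \in J -> measurable (B i)) ->
    P (\bigcap_(i in [set` J]) (V i @^-1` B i)) =
    (\prod_(i <- J) P (V i @^-1` B i))%E.

Definition iid_uniform d (Om : measurableType d) (R : realType)
  (P : probability Om R) (V : nat -> {RV P >-> R}) : Prop :=
  mutually_independent V /\
  forall i (A : set R), measurable A ->
    distribution P (V i) A = uniform_prob (@ltr01 R) A.

(* Least m > k with v k < v m; the default value 0 is taken when there is no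
   such m, which for i.i.d. uniform sequences happens with probability 0. *)
Definition next_record_time (R : realType) (v : nat -> R) (k : nat) : nat :=
  xget 0%N [set m | [/\ (k < m)%N, v k < v m &
    forall j, (k < j)%N -> v k < v j -> (m <= j)%N]].

(* All sequences are indexed from 0: [v 0] is the first observation,
   [record_time v 0 = 0] its index, and [record_value v n] is the (n+1)-st
   record. *)
Definition record_time (R : realType) (v : nat -> R) (n : nat) : nat :=
  iter n (next_record_time v) 0%N.

Definition record_value (R : realType) (v : nat -> R) (n : nat) : R :=
  v (record_time v n).

(* [V] is the i.i.d. uniform sequence from which the records are built, on a
   probability space unrelated to that of [X]. *)
Definition expected_record d0 (Om0 : measurableType d0) (R : realType)
  (P0 : probability Om0 R) (V : nat -> {RV P0 >-> R})
  d (Om : measurableType d) (P : probability Om R) (X : {RV P >-> R})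
  (n : nat) : \bar R :=
  'E_P0[fun w => quantile (df X) (record_value (fun i => V i w) n)]%E.

(* Values of [H] outside (0, +oo) are irrelevant. *)
Definition in_Hstar_fun (R : realType) (H : R -> R) : Prop :=
  [/\ exists y z, [/\ 0 < y, 0 < z & H y <> H z],
      forall y z, 0 < y -> y <= z -> H y <= H z,
      forall y, 0 < y -> H z @[z --> y^'-] --> H y &
      forall m : nat,
        (\int[lebesgue_measure]_(y in `]0%R, +oo[)
           (y ^+ m * expR (- y) * `|H y|)%:E < +oo)%E].

Definition in_Hstar d (Om : measurableType d) (R : realType)
  (P : probability Om R) (X : {RV P >-> R}) : Prop :=
  exists2 H : R -> R, in_Hstar_fun H &
    forall u, 0 < u < 1 -> quantile (df X) u = H (Lfun u).

Definition in_T d (Om : measurableType d) (R : realType)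
  (P : probability Om R) (T : {RV P >-> R}) : Prop :=
  P [set w | 0 < T w] = 1%E /\
  forall n : nat, ('E_P[fun w => (`|T w| ^+ n)%R] < +oo)%E.

Definition phi_weight (R : realType) (F : R -> R) (x : R) : R :=
  if (F x == 0) || (F x == 1) then 0 else (1 - F x) * Lfun (F x).

Definition phi_density (R : realType) (F : R -> R) (x : R) : R :=
  phi_weight F x / (\int[lebesgue_measure]_y phi_weight F y)%R.

(* [T = phi(X)], as an equality in distribution: [T] is distributed as
   [Lfun (F V)] where [V] has density [phi_density F]. *)
Definition is_phi (R : realType)
  d (Om : measurableType d) (P : probability Om R) (X : {RV P >-> R})
  d' (Om' : measurableType d') (P' : probability Om' R) (T : {RV P' >-> R}) :
  Prop :=
  exists d1 (Om1 : measurableType d1) (P1 : probability Om1 R)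
    (V : {RV P1 >-> R}),
    has_density V (phi_density (df X)) /\
    forall A : set R, measurable A ->
      distribution P' T A = P1 [set w | A (Lfun (df X (V w)))].

Definition characterized_by_expected_records (R : realType)
  d0 (Om0 : measurableType d0) (P0 : probability Om0 R)
  (V : nat -> {RV P0 >-> R})
  d (Om : measurableType d) (P : probability Om R) (X : {RV P >-> R}) : Prop :=
  forall d' (Om' : measurableType d') (P' : probability Om' R)
    (X' : {RV P' >-> R}),
    in_Hstar X' ->
    (forall n, expected_record V X' n = expected_record V X n) ->
    same_distribution X' X.

Definition characterized_by_moments (R : realType)
  d (Om : measurableType d) (P : probability Om R) (T : {RV P >-> R}) : Prop :=
  forall d' (Om' : measurableType d') (P' : probability Om' R)
    (T' : {RV P' >-> R}),
    in_T T' ->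
    (forall n : nat,
       'E_P'[fun w => (T' w ^+ n)%R] = 'E_P[fun w => (T w ^+ n)%R])%E ->
    same_distribution T' T.

(* Main.v *)
Require Import Defs.
From HB Require Import structures.
From mathcomp Require Import all_boot all_order all_algebra finmap.
From mathcomp Require Import all_classical all_reals all_analysis.
From mathcomp Require Import measurable_realfun.
From mathcomp Require Import lra ring.
Import Defs.
Set Implicit Arguments.
Unset Strict Implicit.
Unset Printing Implicit Defensive.
Import Order.TTheory GRing.Theory Num.Theory.
Import numFieldNormedType.Exports.
Local Open Scope classical_set_scope.
Local Open Scope ring_scope.

(** Write L u = - log (1 - u), e_n(y) = y^n exp (- y) / n! and let X have the
    quantile function H o L. Numbering from 0, the logarithm L(U_n) of the n-th
    uniform record has the Erlang density e_n ([log_record_law]), so that the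
    expected records are

      rho_n = \int H(y) e_n(y) dy                       ([expected_recordE]).

    The derivative of e_{n+1} is e_n - e_{n+1}. Integration by parts therefore
    yields rho_{n+1} - rho_n = \int e_{n+1} dH ([record_increment]). On the other
    hand, x |-> L (F x) maps Lebesgue measure on the set where 0 < F < 1 to dH
    ([spread_increments]), and it maps the weight (1 - F) L(F) to y exp (- y).
    So phi(X) has the law y exp (- y) dH(y) / c, where c = rho_1 - rho_0
    ([phi_represents], [integral_phi_weight]). The two facts together give

      rho_{n+1} - rho_n = c E T^n / (n+1)!      ([record_increment_moment]):

    the expected record sequence carries the same information as rho_0, c and
    the moments of T = phi(X).

    The law of T and c determine dH, hence H up to an additive constant, which
    rho_0 fixes; so moments that characterize T yield expected records that
    characterize X ([moments_imply_records]). Conversely, let T' have the moments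
    of T. Prescribing dH' = c (exp y / y) dP_{T'}(y) and the value of rho_0
    defines a function H' of the class ([prescribed], [prescribed_Hstar]), and
    H'(L(V_0)) has the expected records of X ([quantile_sample]). If these
    characterize X, then dH' = dH and T' has the law of T
    ([same_law_of_increments], [records_imply_moments]).

    The integration by parts is an instance of Tonelli's theorem: on the
    half-line e_{n+1} - e_n changes sign only at n + 1, as does the
    non-decreasing function H - H(n+1), so their product is nonnegative.

    For the law of the records, let c_{j,n} x^j dx be the probability that the
    first j + 1 observations contain n records besides the first and have their
    maximum in dx. The observation after them being uniform and independent, the
    c_{j,n} satisfy the recursion of [rec_coef] ([record_joint_law]). Summing over
    j produces the density L^n / n! ([record_series]). This sum counts only paths
    on which the record in question occurs; as the density has mass 1, the
    inequality obtained is an equality ([record_value_law]). *)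

(** * Densities, and uniqueness of measures on the line *)

Section density.
Local Open Scope ereal_scope.
Context d (T : measurableType d) (R : realType).
Variable mu : {measure set T -> \bar R}.

Definition density_measure (f : T -> R)
  (mf : measurable_fun setT f) (f0 : forall x, (0 <= f x)%R) (A : set T) :
  \bar R := \int[mu]_(x in A) (f x)%:E.

Section instance.
Variables (f : T -> R) (mf : measurable_fun setT f).
Hypothesis f0 : forall x, (0 <= f x)%R.

Local Notation m := (density_measure mf f0).

Let m0 : m set0 = 0. Proof. exact: integral_set0. Qed.

Let m_ge0 A : 0 <= m A.
Proof. by apply: integral_ge0 => x _; rewrite lee_fin. Qed.

Let m_sigma : semi_sigma_additive m.
Proof.
move=> F mF tF mUF; rewrite /density_measure ge0_integral_bigcup//.
- by apply: is_cvg_ereal_nneg_natsum_cond => n _ _; exact: m_ge0.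
- exact/measurable_EFinP/measurable_funTS.
- by move=> x _; rewrite lee_fin.
Qed.

HB.instance Definition _ := isMeasure.Build _ _ _ m m0 m_ge0 m_sigma.
End instance.

Import HBNNSimple.

(** The hypothesis on alpha is the conclusion for indicators; simple functions
    follow by linearity, and monotone convergence along simple functions
    increasing to g gives the rest. *)
Lemma ge0_integral_density (alpha : {measure set T -> \bar R}) (f : T -> R)
    (D : set T) (g : T -> \bar R) :
  measurable_fun setT f -> (forall x, (0 <= f x)%R) ->
  (forall A, measurable A -> alpha A = \int[mu]_(x in A) (f x)%:E) ->
  measurable D -> measurable_fun D g -> (forall x, D x -> 0 <= g x) ->
  \int[alpha]_(x in D) g x = \int[mu]_(x in D) (g x * (f x)%:E).
Proof.
move=> mf f0 af mE mg g0.
pose h := nnsfun_approx mE mg.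
have -> : \int[alpha]_(x in D) g x =
    lim (\int[alpha]_(x in D) (EFin \o h n) x @[n --> \oo]).
  have fE x : D x -> g x = lim ((EFin \o h n) x @[n --> \oo]).
    by move=> Ex; apply/esym/cvg_lim => //; exact: cvg_nnsfun_approx.
  under eq_integral => x /[!inE] /fE -> //.
  apply: monotone_convergence => //.
  - move=> n; apply/measurable_EFinP.
    by apply: (measurable_funS measurableT) => //; exact/measurable_funP.
  - by move=> n x Ex //=; rewrite lee_fin.
  - by move=> x Ex a b ab; rewrite lee_fin; exact/lefP/nd_nnsfun_approx.
have -> : \int[mu]_(x in D) (g x * (f x)%:E) =
    lim (\int[mu]_(x in D) ((EFin \o h n) x * (f x)%:E) @[n --> \oo]).
  have fg x : D x -> g x * (f x)%:E =
      lim (((EFin \o h n) x * (f x)%:E) @[n --> \oo]).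
    by move=> Ex; apply/esym/cvg_lim => //; apply: cvgeZr => //;
      exact: cvg_nnsfun_approx.
  under eq_integral => x /[!inE] /fg -> //.
  apply: monotone_convergence => [//| | |].
  - move=> n; apply/emeasurable_funM; apply/measurable_funTS;
      exact/measurable_EFinP.
  - by move=> n x Ex /=; rewrite mule_ge0 ?lee_fin.
  - by move=> x Ex a b ab/=; rewrite lee_wpmul2r ?lee_fin//;
      exact/lefP/nd_nnsfun_approx.
suff suf n : \int[mu]_(x in D) ((EFin \o h n) x * (f x)%:E) =
    \int[alpha]_(x in D) (EFin \o h n) x.
  by under [in RHS]eq_fun do rewrite suf.
transitivity (\int[alpha]_(x in D)
   (\sum_(y \in range (h n)) (y * \1_(h n @^-1` [set y]) x)%:E)); last first.
  by apply: eq_integral => t tE; rewrite /= fimfunE -fsumEFin.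
have indich m r : measurable_fun D (fun x => (r * \1_(h m @^-1` [set r]) x)%:E).
  by apply: (measurable_comp measurableT) => //; exact: measurable_funM.
have mfE : measurable_fun D (EFin \o f).
  exact/measurable_EFinP/measurable_funTS.
rewrite ge0_integral_fsum//; last by move=> m y Ey; exact: nnfun_muleindic_ge0.
transitivity (\int[mu]_(x in D) (\sum_(y \in range (h n))
    (y * \1_(h n @^-1` [set y]) x)%:E * (f x)%:E)).
  under [RHS]eq_integral => x xE.
    rewrite -ge0_mule_fsuml => [|y]; last exact: nnfun_muleindic_ge0.
    rewrite fsumEFin // -(fimfunE _ x); over.
  by [].
rewrite ge0_integral_fsum//; last 2 first.
  - by move=> y; apply: emeasurable_funM.
  - move=> m y Ey; apply: mule_ge0; last by rewrite lee_fin.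
    exact: nnfun_muleindic_ge0.
apply: eq_fsbigr => r rhn.
under [RHS]eq_integral do rewrite EFinM.
rewrite integralZl_indic_nnsfun => //.
under eq_integral do rewrite EFinM -muleA.
rewrite ge0_integralZl//.
- under eq_integral do rewrite muleC.
  rewrite (eq_integral ((EFin \o f) \_ (h n @^-1` [set r]))); last first.
    by move=> x xE; rewrite epatch_indic.
  rewrite -integral_mkcondr -af//.
  by rewrite integral_indic// setIC.
- by apply: emeasurable_funM; first exact/measurable_EFinP.
- by move=> t Et; rewrite mule_ge0 ?lee_fin ?f0.
- by move: rhn; rewrite inE => -[t _ <-]; rewrite lee_fin.
Qed.

End density.

(** Lebesgue measure and the laws of random variables live on two copies of the
    Borel line; the identity carries the first copy to the second. *)
Lemma ge0_integral_lebesgue_density (R : realType)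
    (alpha : {measure set R -> \bar R}) (f : R -> R) (D : set R)
    (g : R -> \bar R) :
  measurable_fun setT f -> (forall x, 0 <= f x) ->
  (forall A, measurable A ->
    alpha A = (\int[lebesgue_measure]_(x in A) (f x)%:E)%E) ->
  measurable D -> measurable_fun D g -> (forall x, D x -> (0 <= g x)%E) ->
  (\int[alpha]_(x in D) g x =
   \int[lebesgue_measure]_(x in D) (g x * (f x)%:E))%E.
Proof.
move=> mf f0 af mD mg g0.
pose idR : measurableTypeR R -> R := idfun.
have midR : measurable_fun setT idR by move=> _ B mB; rewrite setTI.
have pushE h A : measurable A -> measurable_fun A h ->
    (forall x, A x -> (0 <= h x)%E) ->
    (\int[pushforward (@lebesgue_measure R) idR]_(x in A) h x =
    \int[lebesgue_measure]_(x in A) h x)%E.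
  move=> mA mh h0; rewrite ge0_integral_pushforward// => x.
  by rewrite inE => /h0.
have mfE A : measurable_fun A (EFin \o f).
  exact/measurable_EFinP/measurable_funTS.
rewrite (@ge0_integral_density _ _ _ (pushforward (@lebesgue_measure R) idR)
  alpha f)//; last first.
  by move=> A mA; rewrite pushE ?af// => x _; rewrite lee_fin.
rewrite pushE//; first by apply: emeasurable_funM.
by move=> x Dx; rewrite mule_ge0 ?g0 ?lee_fin.
Qed.

Lemma integral_mul_indic d (T : measurableType d) (R : realType)
    (mu : {measure set T -> \bar R}) (A D : set T) (f : T -> R) :
  (\int[mu]_(x in A) (f x * \1_D x)%:E = \int[mu]_(x in A `&` D) (f x)%:E)%E.
Proof.
rewrite integral_mkcondr; apply: eq_integral => x _.
by rewrite patchE indicE; case: (x \in D); rewrite ?mulr1// mulr0.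
Qed.

Section uniqueness.
Local Open Scope ereal_scope.
Context (R : realType).
Implicit Types m : {measure set R -> \bar R}.

(** The rays form a pi-system that generates the Borel sets, and the line is
    an increasing union of rays. *)
Lemma measure_unique_rays m1 m2 : m1 setT < +oo ->
  (forall x, m1 `[x, +oo[%classic = m2 `[x, +oo[%classic) ->
  forall A, measurable A -> m1 A = m2 A.
Proof.
move=> m1oo m12 A mA.
apply: (measure_unique (@RGenCInfty.G R) (fun n => `[(- n%:R)%R, +oo[%classic)) => //.
- exact: RGenCInfty.measurableE.
- move=> _ _ [x ->] [y ->]; exists (Num.max x y).
  by apply/seteqP; split => z /=; rewrite !in_itv/= !andbT ge_max => /andP.
- by move=> i; exists (- i%:R)%R.
- apply/seteqP; split => // x _; exists (Num.bound x) => //=.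
  by rewrite in_itv/= andbT lerNl ltW// unstable.ltrNbound.
- by move=> _ [x ->]; exact: m12.
- by move=> k; apply: le_lt_trans m1oo; apply: le_measure; rewrite ?inE.
Qed.

(** The reflection x |-> - x exchanges left and right rays. *)
Lemma measure_unique_lrays m1 m2 : m1 setT < +oo ->
  (forall x, m1 `]-oo, x]%classic = m2 `]-oo, x]%classic) ->
  forall A, measurable A -> m1 A = m2 A.
Proof.
move=> m1oo m12 A mA.
have mN : measurable_fun setT (-%R : R -> R) by exact: oppr_measurable.
have -> : A = (-%R : R -> R) @^-1` ((-%R : R -> R) @^-1` A).
  by apply/seteqP; split => x /=; rewrite opprK.
apply: (@measure_unique_rays (pushforward m1 -%R) (pushforward m2 -%R)) => //.
  move=> x; rewrite /= /pushforward/=.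
  suff -> : -%R @^-1` `[x, +oo[%classic = `]-oo, (- x)%R]%classic :> set R.
    exact: m12.
  by apply/seteqP; split => y /=; rewrite !in_itv/= andbT lerNr.
by rewrite -[X in measurable X]setTI; exact: mN.
Qed.

End uniqueness.
(** * Erlang densities and the integrals that link them *)

Section calculus.
Context (R : realType).
Implicit Types (x y t v : R) (f F : R -> R).
Notation mu := (@lebesgue_measure R).

Lemma FTC_is_derive f F a b : a <= b ->
  (forall x, a <= x <= b -> is_derive x (1 : R) F (f x)) ->
  (forall x, a <= x <= b -> {for x, continuous f}) ->
  (\int[mu]_(x in `[a, b]) (f x)%:E = (F b - F a)%:E)%E.
Proof.
move=> ab dF cf.
have cF x : a <= x <= b -> {for x, continuous F}.
  move=> /dF [dFx _]; apply: differentiable_continuous.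
  exact/derivable1_diffP.
have [<-|ab'] := eqVneq a b; first by rewrite set_itv1 integral_set1 subrr.
have {ab'} ltab : a < b by rewrite lt_neqAle ab'.
rewrite (@continuous_FTC2 _ f F)//.
- by apply: continuous_in_subspaceT => x; rewrite inE/= in_itv/= => /cf.
- split.
  + by move=> x; rewrite in_itv/= => /andP[/ltW ax /ltW xb];
      have [] := dF x; rewrite ?ax.
  + apply: cvg_at_right_filter; apply: cF; rewrite lexx ab//.
  + apply: cvg_at_left_filter; apply: cF; rewrite lexx ab//.
- move=> x; rewrite in_itv/= => /andP[/ltW ax /ltW xb].
  by rewrite derive1E; have [|_ ->] := dF x; rewrite ?ax.
Qed.

(** For y > 0, both the density of a sum of n + 1 independent standard
    exponential variables and the probability that a Poisson variable of mean y
    equals n. *)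
Definition erlang n y : R := y ^+ n / n`!%:R * expR (- y).

(** The probability that a Poisson variable of mean y is at most n, hence the
    mass beyond y of the density erlang n. *)
Definition erlang_tail n y : R := \sum_(k < n.+1) erlang k y.

Lemma erlang_ge0 n y : 0 <= y -> 0 <= erlang n y.
Proof. by move=> y0; rewrite !mulr_ge0 ?exprn_ge0 ?expR_ge0 ?invr_ge0. Qed.

Lemma is_deriveMR f F x (a b : R) :
  is_derive x (1 : R) f a -> is_derive x (1 : R) F b ->
  is_derive x (1 : R) (fun z => f z * F z) (a * F x + f x * b).
Proof.
move=> h1 h2.
have -> : a * F x + f x * b = f x *: b + F x *: a.
  by rewrite addrC /GRing.scale/= mulrC (mulrC a).
exact: (is_deriveM h1 h2).
Qed.

Lemma is_deriveMcst f x (a k : R) : is_derive x (1 : R) f a ->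
  is_derive x (1 : R) (fun z => f z * k) (a * k).
Proof.
move=> h1; have := is_deriveMR h1 (is_derive_cst (k : R) x 1).
by rewrite mulr0 addr0.
Qed.

Lemma is_derive_exprn n y :
  is_derive y (1 : R) (fun z : R => z ^+ n.+1) (n.+1%:R * y ^+ n).
Proof.
have -> : (fun z : R => z ^+ n.+1) = (id : R -> R) ^+ n.+1.
  by apply/funext => z; rewrite exprfctE.
by apply: is_derive_eq; rewrite /= /GRing.scale/= mulr1.
Qed.

Lemma is_derive_expRN y : is_derive y (1 : R) (fun z => expR (- z)) (- expR (- y)).
Proof.
have := @is_derive1_comp _ expR -%R y _ _ (is_derive_expR (- y))
  (is_deriveNid y 1).
by rewrite mulrN1.
Qed.

Lemma is_derive_erlang0 y : is_derive y (1 : R) (erlang 0) (- erlang 0 y).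
Proof.
have -> : erlang 0 = fun z => expR (- z).
  by apply/funext => z; rewrite /erlang expr0 fact0 divr1 mul1r.
exact: is_derive_expRN.
Qed.

(** The source of the link between records and moments: a difference of two
    consecutive densities is a derivative, so that integrating a function
    against it is integrating the density against the increments of the
    function. *)
Lemma is_derive_erlangS n y :
  is_derive y (1 : R) (erlang n.+1) (erlang n y - erlang n.+1 y).
Proof.
have h1 := is_derive_exprn n y.
have h2 := is_deriveMR (is_deriveMcst (n.+1`!%:R^-1) h1) (is_derive_expRN y).
have -> : erlang n.+1 =
    (fun z => z ^+ n.+1 * (n.+1`!%:R)^-1 * expR (- z)) by [].
apply: (is_derive_eq h2).
rewrite /erlang factS natrM invfM.
have n1 : n.+1%:R != 0 :> R by rewrite pnatr_eq0.
have n2 : n`!%:R != 0 :> R by rewrite pnatr_eq0 -lt0n fact_gt0.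
move: n1 n2; move: (n.+1%:R) (n`!%:R) => a b a0 b0.
by field; rewrite a0 b0.
Qed.

(** The derivatives of consecutive summands telescope. *)
Lemma is_derive_erlang_tail n y :
  is_derive y (1 : R) (erlang_tail n) (- erlang n y).
Proof.
have E m : erlang_tail m.+1 = erlang_tail m + erlang m.+1.
  by apply/funext => z; rewrite /erlang_tail big_ord_recr.
elim: n => [|n IH].
  have -> : erlang_tail 0 = erlang 0.
    by apply/funext => z; rewrite /erlang_tail big_ord1.
  exact: is_derive_erlang0.
rewrite E; apply: (is_derive_eq (is_deriveD IH (is_derive_erlangS n y))).
by rewrite addrA addNr add0r.
Qed.

Lemma continuous_erlang n : continuous (erlang n).
Proof.
move=> y; apply: differentiable_continuous; apply/derivable1_diffP.
by case: n => [|n]; [have [] := is_derive_erlang0 y|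
  have [] := is_derive_erlangS n y].
Qed.

Lemma measurable_erlang n D : measurable D -> measurable_fun D (erlang n).
Proof.
move=> mD; apply: measurable_funTS; apply: continuous_measurable_fun.
exact: continuous_erlang.
Qed.

Lemma erlang_at0 n : erlang n 0 = (n == 0)%:R.
Proof.
by case: n => [|n]; rewrite /erlang ?expr0 ?fact0 ?divr1 ?exprS ?mul0r//
  oppr0 expR0 mulr1.
Qed.

Lemma erlang_tail0 n : erlang_tail n 0 = 1.
Proof.
rewrite /erlang_tail big_ord_recl erlang_at0 eqxx big1 ?addr0// => i _.
by rewrite erlang_at0.
Qed.

Lemma expR_ge_term n y : 0 <= y -> y ^+ n / n`!%:R <= expR y.
Proof.
case: n => [|n] y0.
  by rewrite expr0 fact0 divr1 -(expR0 R) ler_expR.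
by apply: le_trans (expR_ge1Dxn n y0); rewrite lerDr ler01.
Qed.

Lemma erlang_le1 n y : 0 <= y -> erlang n y <= 1.
Proof.
by move=> y0; rewrite /erlang expRN ler_pdivrMr ?expR_gt0// mul1r expR_ge_term.
Qed.

(** Since erlang (n + 1) is y / (n + 1) times erlang n and at most 1, erlang n
    is at most (n + 1) / y. *)
Lemma cvg_erlang n : erlang n y @[y --> +oo] --> (0 : R).
Proof.
apply: (@squeeze_cvgr _ _ _ _ (fun=> 0) (fun y => n.+1%:R * y^-1)).
- near=> y.
  have y0 : 0 < y by near: y; exact: nbhs_pinfty_gt.
  rewrite (erlang_ge0 _ (ltW y0))/= ler_pdivlMr//.
  have := erlang_le1 n.+1 (ltW y0).
  rewrite -(ler_pM2l (ltr0Sn R n)) mulr1; apply: le_trans.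
  rewrite /erlang exprS factS natrM invfM.
  have n1 : n.+1%:R != 0 :> R by rewrite pnatr_eq0.
  have n2 : n`!%:R != 0 :> R by rewrite pnatr_eq0 -lt0n fact_gt0.
  move: n1 n2; move: (n.+1%:R) (n`!%:R) => a b a0 b0.
  by rewrite le_eqVlt; apply/orP; left; apply/eqP; field; rewrite a0 b0.
- exact: cvg_cst.
- rewrite -(mulr0 n.+1%:R); apply: cvgM; first exact: cvg_cst.
  by apply/gtr0_cvgV0; [exact: nbhs_pinfty_gt|exact: cvg_id].
Unshelve. all: by end_near. Qed.

Lemma cvg_erlang_tail n : erlang_tail n y @[y --> +oo] --> (0 : R).
Proof.
have E m : erlang_tail m.+1 = erlang_tail m + erlang m.+1.
  by apply/funext => z; rewrite /erlang_tail big_ord_recr.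
elim: n => [|n IH].
  have -> : erlang_tail 0 = erlang 0.
    by apply/funext => z; rewrite /erlang_tail big_ord1.
  exact: cvg_erlang.
by rewrite E -(addr0 0); apply: cvgD IH (cvg_erlang _).
Qed.

Lemma integral_erlang_itv n t : 0 <= t ->
  (\int[mu]_(y in `[0%R, t]) (erlang n y)%:E = (1 - erlang_tail n t)%:E)%E.
Proof.
move=> t0;
apply: (etrans (@FTC_is_derive _ (fun y => - erlang_tail n y) _ _ _ _ _)) => //.
- move=> y _; apply: (is_derive_eq (is_deriveN (is_derive_erlang_tail n y))).
  by rewrite opprK.
- by move=> y _; exact: continuous_erlang.
- by rewrite erlang_tail0 opprK addrC.
Qed.

Lemma FTC_is_derivey f F a : (forall x, a <= x -> 0 <= f x) ->
  (forall x, a <= x -> is_derive x (1 : R) F (f x)) -> continuous f ->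
  F x @[x --> +oo] --> (0 : R) ->
  (\int[mu]_(x in `[a, +oo[) (f x)%:E = (- F a)%:E)%E.
Proof.
move=> f0 dF cf F0.
rewrite (@ge0_continuous_FTC2y _ f F a 0)//.
- by rewrite sub0e.
- by apply: continuous_subspaceT.
- by move=> x /ltW /dF [].
- apply: cvg_at_right_filter.
  have [dFa _] := dF a (lexx a).
  by apply: differentiable_continuous; exact/derivable1_diffP.
- by move=> x; rewrite in_itv/= andbT => /ltW ax; rewrite derive1E;
    have [_ ->] := dF x ax.
Qed.

Lemma integral_erlang_itvy n t : 0 <= t ->
  (\int[mu]_(y in `[t, +oo[) (erlang n y)%:E = (erlang_tail n t)%:E)%E.
Proof.
move=> t0;
apply: (etrans (@FTC_is_derivey _ (fun y => - erlang_tail n y) _ _ _ _ _)).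
- by move=> y ty; rewrite erlang_ge0// (le_trans t0).
- move=> y _; apply: (is_derive_eq (is_deriveN (is_derive_erlang_tail n y))).
  by rewrite opprK.
- exact: continuous_erlang.
- by rewrite -oppr0; apply: cvgN; exact: cvg_erlang_tail.
- by rewrite opprK.
Qed.

Lemma erlangS n y : erlang n.+1 y = y / n.+1%:R * erlang n y.
Proof.
rewrite /erlang exprS factS natrM invfM.
have n1 : n.+1%:R != 0 :> R by rewrite pnatr_eq0.
have n2 : n`!%:R != 0 :> R by rewrite pnatr_eq0 -lt0n fact_gt0.
move: n1 n2; move: (n.+1%:R) (n`!%:R) => a b a0 b0.
by field; rewrite a0 b0.
Qed.

Lemma erlangS_ge n y : 0 <= y -> n.+1%:R <= y -> erlang n y <= erlang n.+1 y.
Proof.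
move=> y0 ny; rewrite erlangS ler_peMl ?erlang_ge0//.
by rewrite ler_pdivlMr// mul1r.
Qed.

Lemma erlangS_le n y : 0 <= y -> y <= n.+1%:R -> erlang n.+1 y <= erlang n y.
Proof.
move=> y0 ny; rewrite erlangS ler_piMl ?erlang_ge0//.
by rewrite ler_pdivrMr// mul1r.
Qed.

(** As erlang (n + 1) is y / (n + 1) times erlang n, the difference of the two
    has one sign on each side of n + 1. On either side its absolute value is
    therefore the derivative of erlang (n + 1) up to sign. *)
Lemma integral_erlangB_itvy n t : n.+1%:R <= t ->
  (\int[mu]_(y in `[t, +oo[) (`|erlang n.+1 y - erlang n y|)%:E =
   (erlang n.+1 t)%:E)%E.
Proof.
move=> nt.
have t0 : 0 <= t by rewrite (le_trans _ nt).
under eq_integral => y.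
  rewrite inE/= in_itv/= andbT => ty.
  rewrite ger0_norm; last first.
    by rewrite subr_ge0 erlangS_ge ?(le_trans t0)// (le_trans nt).
  over.
apply: (etrans (@FTC_is_derivey _ (fun y => - erlang n.+1 y) _ _ _ _ _)).
- by move=> y ty; rewrite subr_ge0 erlangS_ge ?(le_trans t0)// (le_trans nt).
- move=> y _; apply: (is_derive_eq (is_deriveN (is_derive_erlangS n y))).
  by rewrite opprB.
- by move=> y; apply: cvgB; exact: continuous_erlang.
- by rewrite -oppr0; apply: cvgN; exact: cvg_erlang.
- by rewrite opprK.
Qed.

Lemma integral_erlangB_itv n t : 0 <= t <= n.+1%:R ->
  (\int[mu]_(y in `[0%R, t]) (`|erlang n.+1 y - erlang n y|)%:E =
   (erlang n.+1 t)%:E)%E.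
Proof.
move=> /andP[t0 tn].
under eq_integral => y.
  rewrite inE/= in_itv/= => /andP[y0 yt].
  rewrite distrC ger0_norm; last by rewrite subr_ge0 erlangS_le// (le_trans yt).
  over.
apply: (etrans (@FTC_is_derive _ (erlang n.+1) _ _ _ _ _)) => //.
- by move=> y _; exact: is_derive_erlangS.
- by move=> y _; apply: cvgB; exact: continuous_erlang.
- by rewrite erlang_at0 subr0.
Qed.

(** ** The logarithmic scale *)

Lemma is_derive_Lfun v : v < 1 -> is_derive v (1 : R) (@Lfun R : R -> R) (1 - v)^-1.
Proof.
move=> v1; have v0 : 0 < 1 - v by rewrite subr_gt0.
have h : is_derive v (1 : R) (fun x : R => 1 - x) (-1).
  apply: (is_derive_eq (is_deriveB (is_derive_cst (1 : R) v 1)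
    (is_derive_id v 1))).
  by rewrite sub0r.
have := @is_derive1_comp R (@ln R) (fun x => 1 - x) v _ _ (is_derive1_ln v0) h.
rewrite mulrN1 => h2.
by apply: (is_derive_eq (is_deriveN h2)); rewrite opprK.
Qed.

Lemma Lfun0 : Lfun (0 : R) = 0.
Proof. by rewrite /Lfun subr0 ln1 oppr0. Qed.

Lemma LfunK v : v < 1 -> 1 - expR (- Lfun v) = v.
Proof. by move=> v1; rewrite /Lfun opprK lnK ?subKr// posrE subr_gt0. Qed.

Lemma expRNLfun v : v < 1 -> expR (- Lfun v) = 1 - v.
Proof. by move=> v1; rewrite /Lfun opprK lnK// posrE subr_gt0. Qed.

Lemma Lfun_onem_expRN y : Lfun (1 - expR (- y)) = y.
Proof. by rewrite /Lfun subKr expRK opprK. Qed.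

Lemma Lfun_le (u v : R) : u < 1 -> v < 1 -> (Lfun u <= Lfun v) = (u <= v).
Proof.
by move=> u1 v1; rewrite /Lfun lerN2 ler_ln ?posrE ?subr_gt0// lerD2l lerN2.
Qed.

Lemma Lfun_lt (u v : R) : u < 1 -> v < 1 -> (Lfun u < Lfun v) = (u < v).
Proof. by move=> u1 v1; rewrite !ltNge Lfun_le. Qed.

Lemma Lfun_gt0 (u : R) : 0 < u < 1 -> 0 < Lfun u.
Proof. by move=> /andP[u0 u1]; rewrite -Lfun0 Lfun_lt. Qed.

Lemma onem_expRN_gt0 y : 0 < y -> 0 < 1 - expR (- y) < 1.
Proof.
by move=> y0; rewrite subr_gt0 expR_lt1 oppr_lt0 y0/= ltrBlDr ltrDl expR_gt0.
Qed.

Lemma measurable_Lfun : measurable_fun setT (@Lfun R).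
Proof.
rewrite /Lfun; apply: measurable_funN.
apply: (measurableT_comp (@measurable_ln R)); exact: measurable_funB.
Qed.

(** The density on ]0, 1[ of the uniform record number n, records being numbered
    from 0. *)
Definition record_pdf n v : R := Lfun v ^+ n / n`!%:R.

Lemma record_pdfE n v : v < 1 -> record_pdf n v = erlang n (Lfun v) / (1 - v).
Proof.
by move=> v1; rewrite /erlang expRNLfun// mulfK// subr_eq0 gt_eqF.
Qed.

Lemma measurable_record_pdf n : measurable_fun setT (record_pdf n).
Proof.
apply: measurable_funM => //.
apply: (measurableT_comp (@exprn_measurable R setT n)).
exact: measurable_Lfun.
Qed.

Lemma integral_monomial j v : 0 <= v ->
  (\int[mu]_(x in `[0%R, v]) (x ^+ j)%:E = (v ^+ j.+1 / j.+1%:R)%:E)%E.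
Proof.
move=> v0;
apply: (etrans (@FTC_is_derive _ (fun x => x ^+ j.+1 / j.+1%:R) _ _ _ _ _)) => //.
- move=> x _.
  have h1 := is_derive_exprn j x.
  apply: (is_derive_eq (is_deriveMcst (j.+1%:R^-1) h1)).
  by rewrite mulrC mulrA mulVf ?mul1r// pnatr_eq0.
- by move=> x _; exact: exprn_continuous.
- by rewrite expr0n/= mul0r subr0.
Qed.

(** After a record at x, the next record is uniform on ]x, 1[: the density of
    record n + 1 at v accumulates that of record n, divided by 1 - x, over
    x < v. *)
Lemma is_derive_record_pdf n v : v < 1 ->
  is_derive v (1 : R) (record_pdf n.+1) (record_pdf n v / (1 - v)).
Proof.
move=> v1.
have h := is_derive1_comp (is_derive_exprn n (Lfun v)) (is_derive_Lfun v1).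
apply: (is_derive_eq (is_deriveMcst (n.+1`!%:R^-1) h)).
rewrite /record_pdf factS natrM invfM /GRing.scale/=.
have n1 : n.+1%:R != 0 :> R by rewrite pnatr_eq0.
have n2 : n`!%:R != 0 :> R by rewrite pnatr_eq0 -lt0n fact_gt0.
have n3 : 1 - v != 0 by rewrite subr_eq0 gt_eqF.
move: n1 n2; move: (n.+1%:R) (n`!%:R) => a b a0 b0.
by field; rewrite a0 b0 n3.
Qed.

Lemma continuous_record_pdf n v : v < 1 -> {for v, continuous (record_pdf n)}.
Proof.
move=> v1; case: n => [|n].
  have -> : record_pdf 0 = cst 1.
    by apply/funext => x; rewrite /record_pdf expr0 fact0 divr1.
  by apply: cvg_cst.
have [d _] := is_derive_record_pdf n v1.
by apply: differentiable_continuous; exact/derivable1_diffP.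
Qed.

Lemma integral_record_pdfS n v : 0 <= v < 1 ->
  (\int[mu]_(x in `[0%R, v]) (record_pdf n x / (1 - x))%:E =
   (record_pdf n.+1 v)%:E)%E.
Proof.
move=> /andP[v0 v1];
apply: (etrans (@FTC_is_derive _ (record_pdf n.+1) _ _ _ _ _)) => //.
- by move=> x /andP[_ xv]; apply: is_derive_record_pdf; exact: le_lt_trans xv v1.
- move=> x /andP[_ xv]; have x1 := le_lt_trans xv v1.
  apply: cvgM; first exact: continuous_record_pdf.
  apply: cvgV; first by rewrite subr_eq0 gt_eqF.
  by apply: cvgB; [exact: cvg_cst|exact: cvg_id].
- by rewrite {2}/record_pdf Lfun0 expr0n/= mul0r subr0.
Qed.

Lemma integral_record_pdf n v : 0 <= v < 1 ->
  (\int[mu]_(x in `[0%R, v]) (record_pdf n x)%:E =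
   (1 - erlang_tail n (Lfun v))%:E)%E.
Proof.
move=> /andP[v0 v1].
apply: (etrans (@FTC_is_derive _ (fun x => - erlang_tail n (Lfun x)) _ _ _ _ _)) => //.
- move=> x /andP[_ xv]; have x1 := le_lt_trans xv v1.
  have h := @is_derive1_comp _ _ _ _ _ _ (is_derive_erlang_tail n (Lfun x))
    (is_derive_Lfun x1).
  apply: (is_derive_eq (is_deriveN h)).
  by rewrite mulNr opprK record_pdfE.
- by move=> x /andP[_ xv]; apply: continuous_record_pdf; exact: le_lt_trans xv v1.
- by rewrite Lfun0 erlang_tail0 opprK addrC.
Qed.

End calculus.
(** * Pairs with independent coordinates *)

Section image_measure.
Local Open Scope ereal_scope.
Context d1 d2 (T1 : measurableType d1) (T2 : measurableType d2) (R : realType).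

(** The push-forward takes a bundled measurable function here, so that
    finiteness of the measure can be inferred from the term. *)
Definition image_measure (m : {finite_measure set T1 -> \bar R})
  (f : {mfun T1 >-> T2}) : set T2 -> \bar R := pushforward m f.

Variables (m : {finite_measure set T1 -> \bar R}) (f : {mfun T1 >-> T2}).

Let image0 : image_measure m f set0 = 0.
Proof. exact: measure0. Qed.

Let image_ge0 A : 0 <= image_measure m f A.
Proof. exact: measure_ge0. Qed.

Let image_sigma_additive : semi_sigma_additive (image_measure m f).
Proof. exact: measure_semi_sigma_additive. Qed.

HB.instance Definition _ := isMeasure.Build _ _ _ (image_measure m f)
  image0 image_ge0 image_sigma_additive.

Let image_fin : fin_num_fun (image_measure m f).
Proof.
by move=> A mA; apply: fin_num_measure; exact: measurable_funPTI.
Qed.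

HB.instance Definition _ :=
  @Measure_isFinite.Build _ _ _ (image_measure m f) image_fin.

End image_measure.

Section product_law.
Local Open Scope ereal_scope.
Context d (T : measurableType d) (R : realType).
Variables (m : {finite_measure set T -> \bar R}) (M V : {mfun T >-> R}).
Variable beta : probability R R.
Hypothesis indep : forall A C, measurable A -> measurable C ->
  m (M @^-1` A `&` V @^-1` C) = m (M @^-1` A) * beta C.

Let pair_fun (w : T) : R * R := (M w, V w).
Let mpair : measurable_fun setT pair_fun.
Proof. exact: measurable_fun_pair. Qed.
Let pair_mfun : {mfun T >-> (R * R)%type} := mfun_Sub (mem_set mpair).

Let pairE X : measurable X ->
  m [set w | X (M w, V w)] = (image_measure m M \x beta) X.
Proof.
by move=> mX; rewrite (@product_measure_unique _ _ _ _ _ (image_measure m M) beta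
  (image_measure m pair_mfun)).
Qed.

(** Independence makes the joint law a product measure, which can be sliced along
    either coordinate; the event decides which slicing has explicit sections. *)
Lemma product_law1 X : measurable X ->
  m [set w | X (M w, V w)] = \int[image_measure m M]_x beta (xsection X x).
Proof. exact: pairE. Qed.

Lemma product_law2 X : measurable X ->
  m [set w | X (M w, V w)] = \int[beta]_y m (M @^-1` ysection X y).
Proof.
move=> mX; rewrite pairE//.
rewrite (@product_measure_unique _ _ _ _ _ (image_measure m M) beta
  (image_measure m M \x^ beta))// => A B mA mB.
exact: product_measure2E.
Qed.

End product_law.
(** * Records of a sequence of numbers *)

Section record_sequences.
Context (R : realType).
Implicit Types v : nat -> R.

Fixpoint run_max v (j : nat) : R :=
  if j is i.+1 then Num.max (run_max v i) (v j) else v 0%N.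

(** The first observation is a record by convention and is not counted. *)
Fixpoint rec_count v (j : nat) : nat :=
  if j is i.+1 then (rec_count v i + (run_max v i < v j)%R)%N else 0%N.

Fixpoint rec_index v (j : nat) : nat :=
  if j is i.+1 then if run_max v i < v j then j else rec_index v i else 0%N.

Lemma run_max_ge v i j : (i <= j)%N -> v i <= run_max v j.
Proof.
elim: j => [|j IH]; first by rewrite leqn0 => /eqP ->.
rewrite leq_eqVlt => /predU1P[->|]; rewrite /= le_max ?lexx ?orbT//.
by rewrite ltnS => /IH ->.
Qed.

Lemma rec_index_le v j : (rec_index v j <= j)%N.
Proof. by elim: j => //= j IH; case: ifP => // _; rewrite ltnW. Qed.

Lemma rec_indexE v j : v (rec_index v j) = run_max v j.
Proof.
elim: j => //= j IH; case: ifPn => [lt|]; first by rewrite max_r// ltW.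
by rewrite -leNgt => /max_l ->.
Qed.

Lemma next_record_rec_index v j : run_max v j < v j.+1 ->
  next_record_time v (rec_index v j) = j.+1.
Proof.
move=> lt; apply: xget_unique => [|m].
  split; rewrite ?ltnS ?rec_index_le ?rec_indexE// => i _ lti.
  by rewrite ltnNge; apply/negP => /(run_max_ge v); rewrite leNgt lti.
move=> [lt1 lt2 min]; apply/eqP; rewrite eqn_leq; apply/andP; split.
  by apply: min; rewrite ?ltnS ?rec_index_le ?rec_indexE.
move: lt2; rewrite rec_indexE => lt2.
by rewrite ltnNge; apply/negP => /(run_max_ge v); rewrite leNgt lt2.
Qed.

(** Waiting for the next exceedance and counting the records one observation at
    a time describe the same indices; the law of the records is computed in the
    second description. *)
Lemma record_time_rec_count v j : record_time v (rec_count v j) = rec_index v j.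
Proof.
elim: j => //= j IH; case: ifPn => [lt|_]; last by rewrite addn0.
by rewrite addn1 /record_time iterS -/(record_time _ _) IH next_record_rec_index.
Qed.

Lemma record_time_new_record v j : run_max v j < v j.+1 ->
  record_time v (rec_count v j).+1 = j.+1.
Proof.
move=> lt.
have := record_time_rec_count v j.+1.
by rewrite /= lt addn1.
Qed.

End record_sequences.

(** * One more uniform observation *)

Lemma measurable_nondecreasing_fin (R : realType) (D : set R)
    (F : R -> \bar R) : measurable D ->
  (forall x, F x \is a fin_num) -> (forall x y, x <= y -> (F x <= F y)%E) ->
  measurable_fun D F.
Proof.
move=> mD Ffin Fnd.
have -> : F = EFin \o (fine \o F) by apply/funext => x; rewrite /= fineK.
apply/measurable_EFinP.
apply: nondecreasing_measurable => // x y xy.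
by rewrite fine_le//; exact: Fnd.
Qed.

Section uniform_steps.
Local Open Scope ereal_scope.
Context (R : realType).
Notation mu := (@lebesgue_measure R).
Notation U01 := (uniform_prob (@ltr01 R)).
Implicit Types (k x y : R).

(** Up to the constant, the density of the maximum of j + 1 uniform
    observations. *)
Definition monomial01 (k : R) (j : nat) (x : R) : R :=
  (k * (x ^+ j * \1_`]0%R, 1%R[ x))%R.

Lemma monomial01_ge0 k j x : (0 <= k)%R -> (0 <= monomial01 k j x)%R.
Proof.
move=> k0; rewrite /monomial01 indicE mem_setE in_itv/=.
have [/andP[x0 _]|_] := boolP (0 < x < 1)%R; last by rewrite !mulr0.
by rewrite mulr1 mulr_ge0// exprn_ge0// ltW.
Qed.

Lemma measurable_monomial01 k j : measurable_fun setT (monomial01 k j).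
Proof.
apply: measurable_funM => //; apply: measurable_funM; last exact: measurable_indic.
exact: exprn_measurable.
Qed.

Lemma uniform_probE (A : set R) : measurable A ->
  U01 A = \int[mu]_(x in A) (monomial01 1 0 x)%:E.
Proof.
move=> mA.
have -> : monomial01 1 0 = \1_`]0%R, 1%R[.
  by apply/funext => x; rewrite /monomial01 expr0 !mul1r.
transitivity (\int[mu]_(x in `]0%R, 1%R[) (\1_A x)%:E); last first.
  by rewrite !integral_indic// setIC.
rewrite -(@integral_itv_bndoo _ _ _ _ true false); last first.
  by apply/measurable_EFinP; exact: measurable_indic.
rewrite integral_indic//.
rewrite /uniform_prob integral_uniform_pdf.
under eq_integral => x.
  rewrite inE => -[_ /=]; rewrite in_itv/= => x01.
  rewrite /uniform_pdf x01 subr0 invr1.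
  over.
by rewrite integral_cst ?mul1e//; exact: measurableI.
Qed.

Lemma uniform_prob_ray (x : R) (b : bool) : (0 < x < 1)%R ->
  U01 [set` Interval -oo%O (BSide b x)] = x%:E.
Proof.
move=> /andP[x0 x1]; rewrite uniform_probE//.
have -> : monomial01 1 0 = \1_`]0%R, 1%R[.
  by apply/funext => y; rewrite /monomial01 expr0 !mul1r.
rewrite integral_indic//.
have -> : `]0%R, 1%R[ `&` [set` Interval -oo%O (BSide b x)] =
    [set` Interval (BRight 0%R) (BSide b x)] :> set R.
  apply/seteqP; split => y; rewrite /= !in_itv/=; case: b => /=.
  - by move=> [/andP[-> _] ->].
  - by move=> [/andP[-> _] ->].
  - by move=> /andP[-> yx]; rewrite yx (lt_trans yx).
  - by move=> /andP[-> yx]; rewrite yx (le_lt_trans yx).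
by rewrite /= lebesgue_measure_itv/= lte_fin x0 sube0.
Qed.

Lemma integral_monomial01_ray k j (y : R) (b : bool) : (0 <= k)%R ->
  (0 < y < 1)%R ->
  \int[mu]_(x in [set` Interval -oo%O (BSide b y)]) (monomial01 k j x)%:E =
  (k / j.+1%:R * y ^+ j.+1)%:E.
Proof.
move=> k0 /andP[y0 y1].
rewrite /monomial01; under eq_integral do rewrite EFinM.
rewrite ge0_integralZl//; last 2 first.
- apply/measurable_EFinP/measurable_funTS; apply: measurable_funM.
    exact: exprn_measurable.
  exact: measurable_indic.
- move=> x _; have := @monomial01_ge0 1%R j x ler01.
  by rewrite /monomial01 mul1r lee_fin.
rewrite integral_mul_indic.
have -> : [set` Interval -oo%O (BSide b y)] `&` `]0%R, 1%R[ =
    [set` Interval (BRight 0%R) (BSide b y)] :> set R.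
  apply/seteqP; split => x; rewrite /= !in_itv/=; case: b => /=.
  - by move=> [-> /andP[-> _]].
  - by move=> [-> /andP[-> _]].
  - by move=> /andP[-> yx]; rewrite yx (lt_trans yx).
  - by move=> /andP[-> yx]; rewrite yx (le_lt_trans yx).
have mX D : measurable_fun D (fun x : R => (x ^+ j)%:E).
  by apply/measurable_EFinP/measurable_funTS; exact: exprn_measurable.
rewrite integral_itv_bndoo//.
rewrite -(@integral_itv_bndoo _ _ _ _ true false)//.
rewrite integral_monomial ?ltW// -EFinM; congr EFin.
by rewrite mulrA mulrAC.
Qed.

Context d (T : measurableType d).
Variables (m : {finite_measure set T -> \bar R}) (M V : {mfun T >-> R}).
Variables (k : R) (j : nat).
Hypothesis k0 : (0 <= k)%R.
Hypothesis lawM : forall A, measurable A ->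
  m (M @^-1` A) = \int[mu]_(x in A) (monomial01 k j x)%:E.
Variable beta : probability R R.
Hypothesis betaE : forall A, measurable A -> beta A = U01 A.
Hypothesis indep : forall A C, measurable A -> measurable C ->
  m (M @^-1` A `&` V @^-1` C) = m (M @^-1` A) * beta C.

(** When the maximum is x, the new observation leaves it in place with
    probability x, which multiplies the density by x. *)
Lemma law_stay B : measurable B ->
  m [set w | B (M w) /\ (V w <= M w)%R] =
  \int[mu]_(x in B) (monomial01 k j.+1 x)%:E.
Proof.
move=> mB.
pose X := [set p : R * R | B p.1 /\ (p.2 <= p.1)%R].
have mX : measurable X.
  rewrite (_ : X = (B `*` setT) `&` [set p : R * R | (p.2 <= p.1)%R]); last first.
    by apply/seteqP; split => -[x y] /=; [move=> []|move=> [[]]].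
  apply: measurableI; first exact: measurableX.
  rewrite -[X in measurable X]setTI.
  exact: measurable_fun_ler (measurable_snd) (measurable_fst) measurableT [set true] _.
rewrite (product_law1 indep mX).
rewrite (eq_integral ((fun x => beta `]-oo, x]%classic) \_ B)); last first.
  move=> x _; rewrite patchE; case: ifPn => [|].
    rewrite inE => Bx; congr (beta _); apply/seteqP; split => y;
      rewrite /xsection/= inE/X/= in_itv/=; [by case|by []].
  rewrite notin_setE => Bx; rewrite -[RHS](measure0 beta); congr (beta _).
  by apply/seteqP; split => y //; rewrite /xsection/= inE/X/= => -[].
rewrite -integral_mkcond.
rewrite (@ge0_integral_lebesgue_density _ _ (monomial01 k j))//.
- apply: eq_integral => x _.
  have [x01|x01] := boolP (x \in `]0%R, 1%R[).
    rewrite betaE// uniform_prob_ray; last by move: x01; rewrite in_itv.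
    by rewrite -EFinM /monomial01 exprS; congr EFin; ring.
  by rewrite /monomial01 indicE mem_setE (negbTE x01) !mulr0 mule0.
- exact: measurable_monomial01.
- by move=> x; exact: monomial01_ge0.
apply: measurable_nondecreasing_fin => // [x|x y xy].
  exact: fin_num_measure.
by apply: le_measure; rewrite ?inE//; apply: subset_itvl; rewrite bnd_simp.
Qed.

(** When the new observation is y, it becomes the maximum if the old one lies
    below y, which has mass k y^(j + 1) / (j + 1). *)
Lemma law_jump B : measurable B ->
  m [set w | B (V w) /\ (M w < V w)%R] =
  \int[mu]_(x in B) (monomial01 (k / j.+1%:R) j.+1 x)%:E.
Proof.
move=> mB.
pose X := [set p : R * R | B p.2 /\ (p.1 < p.2)%R].
have mX : measurable X.
  rewrite (_ : X = (setT `*` B) `&` [set p : R * R | (p.1 < p.2)%R]); last first.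
    by apply/seteqP; split => -[x y] /=; [move=> []|move=> [[]]].
  apply: measurableI; first exact: measurableX.
  rewrite -[X in measurable X]setTI.
  exact: measurable_fun_ltr (measurable_fst) (measurable_snd) measurableT [set true] _.
rewrite (product_law2 indep mX).
rewrite (eq_integral ((fun y => m (M @^-1` `]-oo, y[%classic)) \_ B)); last first.
  move=> y _; rewrite patchE; case: ifPn => [|].
    rewrite inE => By; congr (m (_ @^-1` _)); apply/seteqP; split => x;
      rewrite /ysection/= inE/X/= in_itv/=; [by case|by []].
  rewrite notin_setE => By; rewrite -[RHS](measure0 m); congr (m _).
  by apply/seteqP; split => x //; rewrite /ysection/= inE/X/= => -[].
rewrite -integral_mkcond.
rewrite (@ge0_integral_lebesgue_density _ _ (monomial01 1 0))//.
- apply: eq_integral => x _.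
  have [x01|x01] := boolP (x \in `]0%R, 1%R[).
    have x01' : (0 < x < 1)%R by move: x01; rewrite in_itv.
    rewrite lawM// integral_monomial01_ray// -EFinM.
    rewrite /monomial01 indicE mem_setE x01; congr EFin; rewrite expr0; ring.
  by rewrite /monomial01 indicE mem_setE (negbTE x01) !mulr0 mule0.
- exact: measurable_monomial01.
- by move=> x; exact: monomial01_ge0.
- by move=> A mA; exact: etrans (betaE mA) (uniform_probE mA).
- apply: measurable_nondecreasing_fin => // [x|x y xy].
    by apply: fin_num_measure; exact: measurable_funPTI.
  apply: le_measure; rewrite ?inE//; [exact: measurable_funPTI..|].
  by apply: preimage_subset; apply: subset_itvl; rewrite bnd_simp.
Qed.

End uniform_steps.
(** * Joint law of the running maximum and the number of records *)

Section record_law.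
Local Open Scope ereal_scope.
Context (R : realType) d0 (Om0 : measurableType d0) (P0 : probability Om0 R).
Variables (V : nat -> {RV P0 >-> R}).
Notation mu := (@lebesgue_measure R).
Notation obs w := (fun i => V i w).

(** The first j + 1 observations contain n records besides the first one, and
    have their maximum in dx, with probability rec_coef j n x^j dx. The two
    summands are the cases without and with a record at step j. The number
    j! rec_coef j n is the unsigned Stirling number of the first kind with
    parameters j + 1 and n + 1. *)
Fixpoint rec_coef (j n : nat) : R :=
  if j is i.+1 then
    (rec_coef i n + if n is m.+1 then rec_coef i m / j%:R else 0)%R
  else (n == 0)%:R%R.

Lemma rec_coef_ge0 j n : (0 <= rec_coef j n)%R.
Proof.
elim: j n => [|j IH] n /=; first by rewrite ler0n.
by rewrite addr_ge0//; case: n => // n; rewrite mulr_ge0// invr_ge0.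
Qed.

Lemma integral_monomial01Z (k : R) j B : (0 <= k)%R -> measurable B ->
  \int[mu]_(x in B) (monomial01 k j x)%:E =
  k%:E * \int[mu]_(x in B) (monomial01 1 j x)%:E.
Proof.
move=> k0 mB; rewrite -ge0_integralZl//.
- by apply: eq_integral => x _; rewrite /monomial01 mul1r.
- by apply/measurable_EFinP/measurable_funTS; exact: measurable_monomial01.
- by move=> x _; rewrite lee_fin; exact: monomial01_ge0.
Qed.

Definition max_obs j w := run_max (obs w) j.

Lemma measurable_max_obs j : measurable_fun setT (max_obs j).
Proof.
elim: j => [|j IH]; first exact: measurable_funPT.
by apply: (measurable_maxr IH); exact: measurable_funPT.
Qed.

HB.instance Definition _ j :=
  isMeasurableFun.Build _ _ _ _ (max_obs j) (measurable_max_obs j).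

Definition count_event j n := [set w | rec_count (obs w) j = n].

Lemma measurable_obs_le j (M : {mfun Om0 >-> R}) :
  measurable [set w | (V j w <= M w)%R].
Proof.
rewrite -[X in measurable X]setTI.
exact: (measurable_fun_ler (measurable_funPT (V j)) (measurable_funPT M))
  measurableT [set true] _.
Qed.

Lemma measurable_obs_lt j (M : {mfun Om0 >-> R}) :
  measurable [set w | (M w < V j w)%R].
Proof.
rewrite -[X in measurable X]setTI.
exact: (measurable_fun_ltr (measurable_funPT M) (measurable_funPT (V j)))
  measurableT [set true] _.
Qed.

Lemma count_eventS j n : count_event j.+1 n =
  (count_event j n `&` [set w | (V j.+1 w <= max_obs j w)%R]) `|`
  (if n is m.+1 then
     count_event j m `&` [set w | (max_obs j w < V j.+1 w)%R] else set0).
Proof.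
apply/seteqP; split => w; rewrite /count_event/=.
  rewrite -/(max_obs j w); case: ltP => lt /=.
    by case: n => [|n]; rewrite addn1// => -[<-]; right.
  by rewrite addn0 => <-; left.
rewrite -/(max_obs j w) => -[[cE le]|].
  by rewrite ltNge le addn0.
by case: n => // n [cE lt]; rewrite lt addn1 cE.
Qed.

Lemma measurable_count_event j n : measurable (count_event j n).
Proof.
elim: j n => [|j IH] n.
  have [->|n0] := eqVneq n 0%N.
    by rewrite (_ : count_event 0 0 = setT)//; apply/seteqP.
  rewrite (_ : count_event 0 n = set0)//; apply/seteqP; split => // w.
  by rewrite /count_event/= => E; move: n0; rewrite -E eqxx.
rewrite count_eventS; apply: measurableU.
  by apply: measurableI => //; exact: measurable_obs_le.
case: n => // n; apply: measurableI => //; exact: measurable_obs_lt.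
Qed.

Definition later_event (J : {fset nat}) (C : nat -> set R) : set Om0 :=
  \bigcap_(i in [set` J]) (V i @^-1` C i).

Lemma measurable_later_event J C : (forall i, i \in J -> measurable (C i)) ->
  measurable (later_event J C).
Proof.
move=> mC; apply: bigcap_measurableType => i /= /mC mCi.
exact: measurable_funPTI.
Qed.

Hypothesis hV : iid_uniform V.

Lemma later_eventU i J B C : i \notin J ->
  later_event (i |` J)%fset (fun l => if l == i then B else C l) =
  V i @^-1` B `&` later_event J C.
Proof.
move=> iJ; apply/seteqP; split => w.
  move=> h; split; first by have /= := h i; rewrite !inE eqxx; apply.
  move=> l /= lJ; have /= := h l; rewrite !inE lJ orbT => /(_ isT).
  by have [li|//] := eqVneq l i; move: iJ; rewrite -li lJ.
move=> [Bw h] l /=; rewrite !inE; have [->//|_ /=] := eqVneq l i; exact: h.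
Qed.

Lemma later_event_indep i J B C : i \notin J -> measurable B ->
  (forall l, l \in J -> measurable (C l)) ->
  P0 (V i @^-1` B `&` later_event J C) =
  P0 (V i @^-1` B) * P0 (later_event J C).
Proof.
move=> iJ mB mC; rewrite -later_eventU//.
have [ind _] := hV.
rewrite /later_event (ind _ (fun l => if l == i then B else C l)); last first.
  by move=> l; rewrite !inE; case: eqVneq => //= _; exact: mC.
rewrite big_fsetU1//= eqxx; congr (_ * _).
rewrite ind//; apply: eq_big_seq => l lJ.
by have [li|//] := eqVneq l i; move: iJ; rewrite -li lJ.
Qed.

Definition stay_event j B :=
  [set w | B (max_obs j w) /\ (V j.+1 w <= max_obs j w)%R].

Definition jump_event j B :=
  [set w | B (V j.+1 w) /\ (max_obs j w < V j.+1 w)%R].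

Lemma measurable_stay_event j B : measurable B -> measurable (stay_event j B).
Proof.
move=> mB; rewrite (_ : stay_event j B = max_obs j @^-1` B `&`
  [set w | (V j.+1 w <= max_obs j w)%R])//.
by apply: measurableI; [exact: measurable_funPTI|exact: measurable_obs_le].
Qed.

Lemma measurable_jump_event j B : measurable B -> measurable (jump_event j B).
Proof.
move=> mB; rewrite (_ : jump_event j B = V j.+1 @^-1` B `&`
  [set w | (max_obs j w < V j.+1 w)%R])//.
by apply: measurableI; [exact: measurable_funPTI|exact: measurable_obs_lt].
Qed.

(** The event on later observations is carried along so that the induction on j
    can feed the next observation in: this is how its independence from the
    past is expressed. *)
Definition joint_law_at j := forall n B J C, measurable B ->
  (forall l, l \in J -> measurable (C l)) ->
  (forall l, l \in J -> (j < l)%N) ->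
  P0 (max_obs j @^-1` B `&` (count_event j n `&` later_event J C)) =
  (rec_coef j n)%:E * \int[mu]_(x in B) (monomial01 1 j x)%:E *
  P0 (later_event J C).

(** The past restricted to a record count and to an event on observations after
    the next one is a finite measure under which the next observation is still
    uniform and independent of the running maximum. *)
Lemma step_laws j : joint_law_at j -> forall n B J C, measurable B ->
  (forall l, l \in J -> measurable (C l)) ->
  (forall l, l \in J -> (j.+1 < l)%N) ->
  P0 (stay_event j B `&` (count_event j n `&` later_event J C)) =
    (rec_coef j n)%:E * \int[mu]_(x in B) (monomial01 1 j.+1 x)%:E *
    P0 (later_event J C) /\
  P0 (jump_event j B `&` (count_event j n `&` later_event J C)) =
    (rec_coef j n / j.+1%:R)%:E *
    \int[mu]_(x in B) (monomial01 1 j.+1 x)%:E * P0 (later_event J C).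
Proof.
move=> IH n B J C mB mC jJ.
set W := later_event J C.
have mW : measurable W by exact: measurable_later_event.
have jNJ : j.+1 \notin J by apply/negP => /jJ; rewrite ltnn.
have mE l : measurable (count_event j l `&` W).
  by apply: measurableI => //; exact: measurable_count_event.
have PW0 : (0 <= fine (P0 W))%R by exact: fine_ge0.
have PWE : (fine (P0 W))%:E = P0 W by rewrite fineK// fin_num_measure.
pose k l := (rec_coef j l * fine (P0 W))%R.
have k0 l : (0 <= k l)%R by rewrite mulr_ge0 ?rec_coef_ge0.
pose m l := mrestr P0 (mE l).
have lawM l A : measurable A ->
    m l (max_obs j @^-1` A) = \int[mu]_(x in A) (monomial01 (k l) j x)%:E.
  move=> mA; rewrite /m /mrestr IH//; last by move=> i /jJ /ltnW.
  by rewrite [RHS]integral_monomial01Z// /k EFinM PWE muleAC.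
have betaE (A : set R) : measurable A ->
    distribution P0 (V j.+1) A = uniform_prob (@ltr01 R) A.
  by move=> mA; have [_] := hV; exact.
have indep l (A A' : set R) : measurable A -> measurable A' ->
    m l (max_obs j @^-1` A `&` V j.+1 @^-1` A') =
    m l (max_obs j @^-1` A) * distribution P0 (V j.+1) A'.
  move=> mA mA'; rewrite lawM// integral_monomial01Z// /k /m /mrestr.
  have -> : max_obs j @^-1` A `&` V j.+1 @^-1` A' `&` (count_event j l `&` W) =
      max_obs j @^-1` A `&` (count_event j l `&`
        later_event (j.+1 |` J)%fset (fun i => if i == j.+1 then A' else C i)).
    by rewrite later_eventU//; apply/seteqP; split => w /=; tauto.
  rewrite IH//; last 2 first.
  - by move=> i; rewrite !inE; case: eqVneq => //= _; exact: mC.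
  - by move=> i; rewrite !inE => /predU1P[->//|/jJ /ltnW].
  rewrite later_eventU// later_event_indep// EFinM PWE -/W.
  by rewrite -!muleA; congr (_ * _); rewrite [RHS]muleC -muleA.
split.
  have := law_stay (k0 n) (lawM n) betaE (indep n) mB.
  by rewrite (integral_monomial01Z _ (k0 n))// /k EFinM PWE muleAC.
have := law_jump (k0 n) (lawM n) betaE (indep n) mB.
rewrite (@integral_monomial01Z (k n / j.+1%:R)%R)//; last by rewrite divr_ge0.
by rewrite /k mulrAC EFinM PWE muleAC.
Qed.

(** A count of n after step j + 1 arises from a count of n without a new record,
    or from a count of n - 1 with one. *)
Lemma record_joint_law j : joint_law_at j.
Proof.
elim: j => [|j IH] n B J C mB mC jJ.
  have [->|n0] := eqVneq n 0%N.
    rewrite (_ : count_event 0 0 = setT); last by apply/seteqP.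
    rewrite setTI mul1e later_event_indep//; last first.
      by apply/negP => /jJ.
    by have [_ /(_ 0%N _ mB)] := hV; rewrite uniform_probE// => <-.
  rewrite (_ : count_event 0 n = set0) ?set0I ?setI0 ?measure0; last first.
    apply/seteqP; split => // w.
    by rewrite /count_event/= => E; move: n0; rewrite -E eqxx.
  by rewrite /= (negbTE n0) !mul0e.
set W := later_event J C.
have mW : measurable W by exact: measurable_later_event.
have mE l : measurable (count_event j l `&` W).
  by apply: measurableI => //; exact: measurable_count_event.
have [stayE _] := step_laws IH n mB mC jJ.
have jumpE l := (step_laws IH l mB mC jJ).2.
have split_event : max_obs j.+1 @^-1` B `&` (count_event j.+1 n `&` W) =
    (stay_event j B `&` (count_event j n `&` W)) `|`
    (if n is l.+1 then jump_event j B `&` (count_event j l `&` W) else set0).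
  rewrite count_eventS; apply/seteqP; split => w /=.
    rewrite /max_obs/= -/(max_obs j w) => -[+ [+ Ww]] => /[swap] -[].
      by move=> [cE le]; rewrite max_l// => Bw; left.
    case: n {stayE} => // n [cE lt]; rewrite max_r ?(ltW lt)//.
    by move=> Bw; right.
  rewrite /max_obs/= -/(max_obs j w) => -[].
    by move=> [[Bw le] [cE Ww]]; rewrite max_l//; split => //; split => //; left.
  case: n {stayE} => // n [[Bw lt] [cE Ww]].
  by rewrite max_r ?(ltW lt)//; split => //; split => //; right.
rewrite split_event measureU//.
- case: n {split_event} stayE => [|n] stayE.
    by rewrite measure0 adde0; apply: etrans stayE _; rewrite /= addr0.
  have D0 : 0 <= \int[mu]_(x in B) (monomial01 1 j.+1 x)%:E.
    by apply: integral_ge0 => x _; rewrite lee_fin monomial01_ge0.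
  apply: etrans (congr2 (fun x y => x + y) stayE (jumpE n)) _.
  rewrite /= EFinD !ge0_muleDl//.
  + by rewrite mule_ge0// lee_fin rec_coef_ge0.
  + by rewrite mule_ge0// lee_fin divr_ge0// rec_coef_ge0.
  + by rewrite lee_fin rec_coef_ge0.
  + by rewrite lee_fin divr_ge0// rec_coef_ge0.
- by apply: measurableI => //; exact: measurable_stay_event.
- case: n {stayE split_event} => // n.
  by apply: measurableI => //; exact: measurable_jump_event.
- case: n {stayE split_event} => [|n]; first by rewrite setI0.
  apply/seteqP; split => // w /= [[[_ le] _] [[_ lt] _]].
  by move: lt; rewrite ltNge le.
Qed.

End record_law.
(** * Generating functions of the record counts *)

Section record_series.
Local Open Scope ereal_scope.
Context (R : realType).
Notation mu := (@lebesgue_measure R).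
Implicit Types v : R.

Lemma nneseries_shift (u : nat -> \bar R) : (forall k, 0 <= u k) ->
  \sum_(k <oo) u k = u 0%N + \sum_(k <oo) u k.+1.
Proof.
move=> u0; rewrite nneseries_recl//; congr (_ + _).
by rewrite -(nneseries_addn 1)//; apply: eq_eseriesr => k _; rewrite addn1.
Qed.

(** The a j are the partial sums of the b j, which divides the generating
    function by 1 - v: the sum A of the series satisfies A = v A + f. *)
Lemma cumulative_series (a b : nat -> R) v (f : R) :
  (forall j, 0 <= a j)%R -> (forall j, 0 <= b j)%R -> (0 <= v < 1)%R ->
  a 0%N = b 0%N -> (forall j, a j.+1 = a j + b j.+1)%R ->
  \sum_(j <oo) (b j * v ^+ j)%:E = f%:E ->
  \sum_(j <oo) (a j * v ^+ j)%:E = (f / (1 - v))%:E.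
Proof.
move=> a0 b0 /andP[v0 v1] ab0 abS bf.
have av0 j : 0 <= (a j * v ^+ j)%:E by rewrite lee_fin mulr_ge0// exprn_ge0.
have bv0 j : 0 <= (b j * v ^+ j)%:E by rewrite lee_fin mulr_ge0// exprn_ge0.
have v1' : (0 < 1 - v)%R by rewrite subr_gt0.
set A := \sum_(j <oo) (a j * v ^+ j)%:E.
have Arec : A = v%:E * A + f%:E.
  rewrite {1}/A nneseries_shift// (eq_eseriesr (g := fun j =>
    v%:E * (a j * v ^+ j)%:E + (b j.+1 * v ^+ j.+1)%:E)); last first.
    by move=> j _; rewrite -EFinM -EFinD abS exprS; congr EFin; ring.
  rewrite nneseriesD//; last by move=> j _ _; rewrite mule_ge0// lee_fin.
  rewrite nneseriesZl//.
  by rewrite addeCA -bf [in RHS]nneseries_shift// ab0.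
(* A = v A + f has the solution +oo as well; the bound on partial sums
   excludes it. *)
have partial N : (\sum_(j < N) a j * v ^+ j <= f / (1 - v))%R.
  elim: N => [|N IH].
    rewrite big_ord0 divr_ge0 ?(ltW v1')//.
    by rewrite -lee_fin -bf; apply: nneseries_ge0.
  have bN : (\sum_(j < N.+1) b j * v ^+ j <= f)%R.
    rewrite -lee_fin -bf -sumEFin -(big_mkord xpredT (fun j => (b j * v ^+ j)%:E)).
    exact: nneseries_lim_ge.
  rewrite big_ord_recl ab0.
  have -> : (\sum_(i < N) a (lift ord0 i) * v ^+ lift ord0 i =
     v * (\sum_(i < N) a i * v ^+ i) + \sum_(i < N) b i.+1 * v ^+ i.+1)%R.
    rewrite mulr_sumr -big_split/=; apply: eq_bigr => i _.
    by rewrite /bump/= add1n abS exprS; ring.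
  rewrite addrCA; apply: (@le_trans _ _ (v * (f / (1 - v)) + f)%R).
    apply: lerD; first by rewrite ler_wpM2l.
    by move: bN; rewrite big_ord_recl/=.
  rewrite le_eqVlt; apply/orP; left; apply/eqP; field.
  by rewrite gt_eqF.
have Afin : A \is a fin_num.
  rewrite ge0_fin_numE; last exact: nneseries_ge0.
  apply: (@le_lt_trans _ _ (f / (1 - v))%:E); last exact: ltry.
  apply: lime_le; first exact: is_cvg_nneseries.
  by apply: nearW => N; rewrite big_mkord sumEFin lee_fin.
move: Arec; rewrite -(fineK Afin) -EFinM -EFinD => -[Arec]; congr EFin.
apply: (@mulIf _ (1 - v)%R); first by rewrite gt_eqF.
rewrite divfK ?gt_eqF//; move: Arec; move: (fine A) => z Arec.
by rewrite mulrBr mulr1 {1}Arec; ring.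
Qed.

Notation c := (@rec_coef R).

(** The recursion for rec_coef makes the coefficients for n + 1 the partial sums
    of the integrated coefficients for n. Hence passing from n to n + 1
    integrates the generating function and divides the result by 1 - v, and
    record_pdf obeys the same rule. *)
Lemma record_series n v : (0 <= v < 1)%R ->
  \sum_(j <oo) (c j n * v ^+ j)%:E = (record_pdf n v / (1 - v))%:E /\
  \sum_(j <oo) (c j n / j.+1%:R * v ^+ j.+1)%:E = (record_pdf n.+1 v)%:E.
Proof.
have step m : (forall x, (0 <= x < 1)%R ->
    \sum_(j <oo) (c j m * x ^+ j)%:E = (record_pdf m x / (1 - x))%:E) ->
  forall x, (0 <= x < 1)%R ->
    \sum_(j <oo) (c j m / j.+1%:R * x ^+ j.+1)%:E = (record_pdf m.+1 x)%:E.
  move=> H x x01; have /andP[x0 x1] := x01.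
  rewrite -integral_record_pdfS//.
  transitivity (\int[mu]_(y in `[0%R, x]) \sum_(j <oo) (c j m * y ^+ j)%:E);
    last first.
    apply: eq_integral => y; rewrite inE/= in_itv/= => /andP[y0 yx].
    by rewrite H// y0 (le_lt_trans yx).
  have mc j : measurable_fun `[0%R, x] (fun y : R => (c j m * y ^+ j)%:E).
    apply/measurable_EFinP; apply: measurable_funTS.
    by apply: measurable_funM => //; exact: exprn_measurable.
  rewrite integral_nneseries//; last first.
    move=> j y; rewrite /= in_itv/= => /andP[y0 _].
    by rewrite lee_fin mulr_ge0 ?rec_coef_ge0// exprn_ge0.
  apply: eq_eseriesr => j _.
  under [RHS]eq_integral do rewrite EFinM.
  rewrite ge0_integralZl//.
  - by rewrite integral_monomial// -EFinM; congr EFin; rewrite mulrA mulrAC.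
  - by apply/measurable_EFinP/measurable_funTS; exact: exprn_measurable.
  - by move=> y; rewrite /= in_itv/= => /andP[y0 _]; rewrite lee_fin exprn_ge0.
  - by rewrite lee_fin rec_coef_ge0.
elim: n v => [|n IH] v v01.
  have H0 x : (0 <= x < 1)%R ->
      \sum_(j <oo) (c j 0 * x ^+ j)%:E = (record_pdf 0 x / (1 - x))%:E.
    move=> x01; apply: (@cumulative_series _ (fun j => (j == 0)%N%:R%R)) => //.
    - by move=> j; exact: rec_coef_ge0.
    - rewrite nneseries_shift; last first.
        move=> k; rewrite lee_fin mulr_ge0// exprn_ge0//.
        by move: x01 => /andP[].
      rewrite eseries0 ?adde0; last by move=> k _ _; rewrite mul0r.
      by rewrite /record_pdf !expr0 fact0 divr1 mulr1.
  by split; [exact: H0|exact: step].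
have H1 x : (0 <= x < 1)%R ->
    \sum_(j <oo) (c j n.+1 * x ^+ j)%:E = (record_pdf n.+1 x / (1 - x))%:E.
  move=> x01; apply: (@cumulative_series _
    (fun j => if j is i.+1 then c i n / j%:R else 0)%R) => //.
  - by move=> j; exact: rec_coef_ge0.
  - by case=> // j; rewrite divr_ge0// rec_coef_ge0.
  - rewrite nneseries_shift; last first.
      move=> k; rewrite lee_fin mulr_ge0//; last first.
        by rewrite exprn_ge0//; move: x01 => /andP[].
      by case: k => // k; rewrite divr_ge0// rec_coef_ge0.
    by rewrite mul0r add0e; have [_ ->] := IH _ x01.
by split; [exact: H1|exact: step].
Qed.

End record_series.
(** * The law of the record values *)

Section next_record.
Context (R : realType).
Implicit Types v : nat -> R.

(** The first alternative is the default value 0, taken when nothing exceeds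
    v k. *)
Lemma next_record_timeP v k m : next_record_time v k = m <->
  (m = 0%N /\ forall j, (k < j)%N -> v j <= v k) \/
  [/\ (k < m)%N, v k < v m & forall j, (k < j)%N -> (j < m)%N -> v j <= v k].
Proof.
have uniq m' : [/\ (k < m')%N, v k < v m' &
    forall j, (k < j)%N -> (j < m')%N -> v j <= v k] ->
    next_record_time v k = m'.
  move=> [km vkm lem]; apply: xget_unique => [|y [ky vky miny]].
    split => // j kj vkj; rewrite leqNgt; apply/negP => jm.
    by have := lem _ kj jm; rewrite leNgt vkj.
  apply/eqP; rewrite eqn_leq miny//= leqNgt; apply/negP => ym.
  by have := lem _ ky ym; rewrite leNgt vky.
split => [<-|[[-> h]|]].
- rewrite /next_record_time; case: xgetP => [y -> [ky vky miny]|nex].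
    right; split => // j kj jy; rewrite leNgt; apply/negP => vkj.
    by have := miny _ kj vkj; rewrite leqNgt jy.
  left; split => // j kj; rewrite leNgt; apply/negP => vkj.
  have ex : exists i, (k < i)%N && (v k < v i) by exists j; rewrite kj vkj.
  case: (ex_minnP ex) => i /andP[ki vki] mini.
  by apply: (nex i); split => // l kl vkl; apply: mini; rewrite kl vkl.
- rewrite /next_record_time; apply: xgetPN => m' [km vkm _].
  by have := h _ km; rewrite leNgt vkm.
- exact: uniq.
Qed.

End next_record.

Section record_value_law.
Local Open Scope ereal_scope.
Context (R : realType) d0 (Om0 : measurableType d0) (P0 : probability Om0 R).
Variables (V : nat -> {RV P0 >-> R}).
Notation mu := (@lebesgue_measure R).
Notation obs w := (fun i => V i w).

Lemma measurable_next_record k m :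
  measurable [set w | next_record_time (obs w) k = m].
Proof.
have mle j (Q : Prop) : measurable [set w | Q -> (V j w <= V k w)%R].
  have [q|nq] := pselect Q.
    have -> : [set w | Q -> (V j w <= V k w)%R] = [set w | (V j w <= V k w)%R].
      by apply/seteqP; split => w //=; exact.
    exact: measurable_obs_le.
  have -> : [set w | Q -> (V j w <= V k w)%R] = setT.
    by apply/seteqP; split => // w _ /= /nq.
  exact: measurableT.
rewrite (_ : [set w | _] =
  ([set w | m = 0%N] `&` \bigcap_j [set w | (k < j)%N -> (V j w <= V k w)%R]) `|`
  ([set w | (k < m)%N] `&` [set w | (V k w < V m w)%R] `&`
   \bigcap_j [set w | (k < j)%N /\ (j < m)%N -> (V j w <= V k w)%R])).
  have mcst (Q : Prop) : measurable [set w : Om0 | Q].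
    have [q|nq] := pselect Q.
      by rewrite (_ : [set w | _] = setT)//; apply/seteqP; split.
    by rewrite (_ : [set w | _] = set0)//; apply/seteqP; split.
  apply: measurableU; apply: measurableI => //.
  - by apply: bigcapT_measurable => j; exact: mle.
  - apply: measurableI; first exact: mcst.
    exact: measurable_obs_lt.
  - by apply: bigcapT_measurable => j; exact: mle.
apply/seteqP; split => w /=.
  move=> /next_record_timeP[[m0 h]|[km vkm h]]; [left|right].
    by split => // j _ /=; exact: h.
  by split => // j _ /= [kj jm]; exact: h.
move=> h; apply/next_record_timeP; case: h => [[m0 h]|[[km vkm] h]]; [left|right].
  by split => // j; exact: (h j).
by split => // j kj jm; exact: (h j).
Qed.

Lemma measurable_record_time n m :
  measurable [set w | record_time (obs w) n = m].
Proof.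
elim: n m => [|n IH] m.
  have [->|m0] := eqVneq m 0%N.
    by rewrite (_ : [set w | _] = setT)//; apply/seteqP; split.
  rewrite (_ : [set w | _] = set0)//; apply/seteqP; split => // w /=.
  by rewrite /record_time/= => E; move: m0; rewrite -E eqxx.
rewrite (_ : [set w | _] = \bigcup_k ([set w | record_time (obs w) n = k] `&`
  [set w | next_record_time (obs w) k = m])).
  apply: bigcupT_measurable => k; apply: measurableI; first exact: IH.
  exact: measurable_next_record.
apply/seteqP; split => w; rewrite /record_time /= => h.
  by exists (record_time (obs w) n).
by case: h => k _ [<-].
Qed.

Definition record_val n w := record_value (obs w) n.

Lemma measurable_record_val n : measurable_fun setT (record_val n).
Proof.
move=> _ B mB; rewrite setTI.
rewrite (_ : _ @^-1` _ = \bigcup_k ([set w | record_time (obs w) n = k] `&`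
  V k @^-1` B)).
  apply: bigcupT_measurable => k; apply: measurableI.
    exact: measurable_record_time.
  exact: measurable_funPTI.
apply/seteqP; split => w /=; rewrite /record_val /record_value.
  by move=> h; exists (record_time (obs w) n).
by case=> k _ [/= ->].
Qed.

HB.instance Definition _ n :=
  isMeasurableFun.Build _ _ _ _ (record_val n) (measurable_record_val n).

Definition record_density n (x : R) : R :=
  (record_pdf n x * \1_`]0%R, 1%R[ x)%R.

Lemma record_density_ge0 n x : (0 <= record_density n x)%R.
Proof.
rewrite /record_density indicE mem_setE in_itv/=.
have [x01|_] := boolP (0 < x < 1)%R; last by rewrite mulr0.
by rewrite mulr1 /record_pdf divr_ge0// exprn_ge0// ltW// Lfun_gt0.
Qed.

Lemma measurable_record_density n : measurable_fun setT (record_density n).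
Proof.
by apply: measurable_funM; [exact: measurable_record_pdf|exact: measurable_indic].
Qed.

Hypothesis hV : iid_uniform V.

Lemma obs_law j B : measurable B ->
  P0 (V j @^-1` B) = \int[mu]_(x in B) (monomial01 1 0 x)%:E.
Proof.
by move=> mB; rewrite -uniform_probE//; have [_ /(_ j _ mB)] := hV.
Qed.

(** Record number n + 1 occurs at step j + 1, with its value in B. *)
Definition new_record_event n j B :=
  jump_event V j B `&` count_event V j n.

Lemma new_record_eventE n j B w : new_record_event n j B w ->
  record_time (obs w) n.+1 = j.+1 /\ B (record_val n.+1 w).
Proof.
move=> [[Bw lt] cE].
have tE : record_time (obs w) n.+1 = j.+1.
  by rewrite -cE; exact: record_time_new_record.
by rewrite /record_val /record_value tE.
Qed.

Lemma new_record_event_law n j B : measurable B ->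
  P0 (new_record_event n j B) =
  (rec_coef R j n / j.+1%:R)%:E * \int[mu]_(x in B) (monomial01 1 j.+1 x)%:E.
Proof.
move=> mB.
have lT : later_event V fset0 (fun=> setT) = setT.
  by apply/seteqP; split => // w _ i /=; rewrite inE.
have [//|l|_ jumpE] := step_laws hV (record_joint_law hV (j := j)) n (J := fset0)
  (C := fun=> setT) mB.
  by rewrite inE.
by move: jumpE; rewrite lT setIT probability_setT mule1.
Qed.

(** The events that record n + 1 occurs at step j + 1 are disjoint, and their
    laws sum to the claimed density. That one of them occurs almost surely is not
    known at this point, hence an inequality only. *)
Lemma record_law_ge n B : measurable B ->
  \int[mu]_(x in B) (record_density n x)%:E <= P0 (record_val n @^-1` B).
Proof.
move=> mB; case: n => [|n].
  rewrite obs_law//.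
  rewrite le_eqVlt; apply/orP; left; apply/eqP; apply: eq_integral => x _.
  by rewrite /record_density /monomial01 /record_pdf !expr0 fact0 divr1 !mul1r.
have -> : \int[mu]_(x in B) (record_density n.+1 x)%:E =
    \sum_(j <oo) P0 (new_record_event n j B).
  transitivity (\int[mu]_(x in B) \sum_(j <oo)
      (monomial01 (rec_coef R j n / j.+1%:R) j.+1 x)%:E).
    apply: eq_integral => x _; rewrite /record_density /monomial01.
    rewrite indicE mem_setE; have [x01|x01] := boolP (x \in `]0%R, 1%R[).
      rewrite mulr1; have x01' : (0 <= x < 1)%R.
        by move: x01; rewrite in_itv/= => /andP[/ltW -> ->].
      have [_ <-] := record_series n x01'.
      by apply: eq_eseriesr => j _; rewrite mulr1.
    rewrite mulr0 eseries0// => j _ _; by rewrite !mulr0.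
  have k0 j : (0 <= rec_coef R j n / j.+1%:R)%R.
    by rewrite divr_ge0// rec_coef_ge0.
  rewrite integral_nneseries//; last 2 first.
  - move=> j; apply/measurable_EFinP; apply: measurable_funTS.
    exact: measurable_monomial01.
  - by move=> j x _; rewrite lee_fin monomial01_ge0.
  by apply: eq_eseriesr => j _; rewrite new_record_event_law//
    (integral_monomial01Z _ (k0 j) mB).
have mE j : measurable (new_record_event n j B).
  apply: measurableI; first exact: measurable_jump_event.
  exact: measurable_count_event.
have tE : trivIset setT (fun j => new_record_event n j B).
  apply/trivIsetP => i j _ _ ij; apply/seteqP; split => // w [].
  move=> /new_record_eventE[ti _] /new_record_eventE[tj _].
  by move: ti; rewrite tj => -[ji]; move: ij; rewrite ji eqxx.
have <- : P0 (\bigcup_j new_record_event n j B) =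
    \sum_(j <oo) P0 (new_record_event n j B).
  by rewrite measure_bigcup//; apply: eq_eseriesl => j; rewrite in_setT.
apply: le_measure; rewrite ?inE//.
- exact: bigcupT_measurable.
- exact: measurable_funPTI.
- by move=> w [j _ /new_record_eventE[_]].
Qed.

(** At most 1 by the inequality just proved; at least 1 because the mass below
    1 - exp (- y) is the complement of an Erlang tail, which tends to 0. *)
Lemma record_density_total n :
  \int[mu]_x (record_density n x)%:E = 1.
Proof.
apply/eqP; rewrite eq_le; apply/andP; split.
  apply: le_trans (record_law_ge n measurableT) _.
  by rewrite preimage_setT probability_setT.
have ge y : (0 < y)%R ->
    (1 - erlang_tail n y)%:E <= \int[mu]_x (record_density n x)%:E.
  move=> y0; have /andP[u0 u1] := onem_expRN_gt0 y0.
  rewrite -{1}(Lfun_onem_expRN y) -integral_record_pdf; last first.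
    by rewrite (ltW u0) u1.
  have mpdf D : measurable_fun D (EFin \o @record_pdf R n).
    by apply/measurable_EFinP; apply: measurable_funTS; exact: measurable_record_pdf.
  rewrite (@integral_itv_bndoo _ _ _ _ true false)//.
  apply: (@le_trans _ _ (\int[mu]_(x in `]0%R, (1 - expR (- y))%R[)
    (record_density n x)%:E)).
    apply: ge0_le_integral => //.
    - move=> x; rewrite /= in_itv/= => /andP[x0 xu].
      by rewrite lee_fin /record_pdf divr_ge0// exprn_ge0// ltW// Lfun_gt0// x0
        (lt_trans xu).
    - exact: mpdf.
    - apply: measurable_funTS; apply/measurable_EFinP.
      exact: measurable_record_density.
    - move=> x; rewrite /= in_itv/= => /andP[x0 xu].
      by rewrite lee_fin /record_density indicE mem_setE in_itv/= x0
        (lt_trans xu)// mulr1.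
  apply: ge0_subset_integral => //.
    by apply/measurable_EFinP; exact: measurable_record_density.
  by move=> x _; rewrite lee_fin record_density_ge0.
have tfin : \int[mu]_x (record_density n x)%:E \is a fin_num.
  rewrite ge0_fin_numE; last first.
    by apply: integral_ge0 => x _; rewrite lee_fin record_density_ge0.
  apply: le_lt_trans (record_law_ge n measurableT) _.
  by rewrite preimage_setT probability_setT ltry.
rewrite -(fineK tfin) lee_fin.
have lim1 : (1 - erlang_tail n y)%R @[y --> +oo%R] --> (1 : R)%R.
  rewrite -[X in _ --> X]subr0.
  by apply: cvgB; [exact: cvg_cst|exact: cvg_erlang_tail].
apply: (cvgr_to_le lim1); near=> y; rewrite -lee_fin fineK//.
by apply: ge; near: y; exact: nbhs_pinfty_gt.
Unshelve. all: by end_near. Qed.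

Lemma complement_le (x y p q : \bar R) : p \is a fin_num ->
  x + y = 1 -> q = 1 - p -> x <= p -> q <= y.
Proof.
by move=> pfin <- -> xp; rewrite leeBlDr// addeC leeD.
Qed.

(** Two probability measures, one of which dominates the other, are equal: apply
    the inequality to the complement as well. *)
Lemma record_value_law n B : measurable B ->
  P0 (record_val n @^-1` B) = \int[mu]_(x in B) (record_density n x)%:E.
Proof.
move=> mB.
have mBC : measurable (~` B) by exact: measurableC.
have mpre C : measurable C -> measurable (record_val n @^-1` C).
  by move=> mC; exact: measurable_funPTI.
have tot := record_density_total n.
rewrite -(setvU B) ge0_integral_setU// in tot; last 3 first.
- apply: measurable_funTS; apply/measurable_EFinP.
  exact: measurable_record_density.
- by move=> x _; rewrite lee_fin record_density_ge0.
- exact/disj_setPCr.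
apply/eqP; rewrite eq_le (record_law_ge n mB) andbT.
have <- : ~` (record_val n @^-1` (~` B)) = record_val n @^-1` B.
  by rewrite preimage_setC setCK.
exact: (complement_le (fin_num_measure P0 _ (mpre _ mBC)) tot
  (probability_setC P0 (mpre _ mBC)) (record_law_ge n mBC)).
Qed.

End record_value_law.
(** * Expected records as integrals against Erlang densities *)

Section integral_law_density.
Local Open Scope ereal_scope.
Context (R : realType) d (T : measurableType d) (P : probability T R).
Notation mu := (@lebesgue_measure R).

Lemma ge0_integral_law_density (Y : {RV P >-> R}) (f : R -> R)
    (h : R -> \bar R) :
  measurable_fun setT f -> (forall x, (0 <= f x)%R) ->
  (forall A, measurable A ->
    distribution P Y A = \int[mu]_(x in A) (f x)%:E) ->
  measurable_fun setT h -> (forall x, 0 <= h x) ->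
  \int[P]_w h (Y w) = \int[mu]_x (h x * (f x)%:E).
Proof.
move=> mf f0 Yf mh h0.
rewrite -(ge0_integral_distribution Y mh h0).
exact: ge0_integral_lebesgue_density.
Qed.

Lemma integral_law_density (Y : {RV P >-> R}) (f h : R -> R) :
  measurable_fun setT f -> (forall x, (0 <= f x)%R) ->
  (forall A, measurable A ->
    distribution P Y A = \int[mu]_(x in A) (f x)%:E) ->
  measurable_fun setT h ->
  \int[P]_w (h (Y w))%:E = \int[mu]_x (h x * f x)%:E.
Proof.
move=> mf f0 Yf mh.
have pos (g : R -> R) x : (EFin \o g)^\+ x * (f x)%:E =
    (EFin \o (fun x => g x * f x)%R)^\+ x.
  rewrite !funeposE /= -!EFin_max -EFinM; congr EFin.
  by rewrite maxr_pMl// mul0r.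
have neg (g : R -> R) x : (EFin \o g)^\- x * (f x)%:E =
    (EFin \o (fun x => g x * f x)%R)^\- x.
  rewrite !funenegE /= -!EFin_max -EFinM; congr EFin.
  by rewrite maxr_pMl// mul0r mulNr.
rewrite integralE [RHS]integralE; congr (_ - _).
- transitivity (\int[P]_w ((EFin \o h)^\+ (Y w))).
    by apply: eq_integral => w _; rewrite !funeposE.
  apply: etrans (ge0_integral_law_density mf f0 Yf (h := (EFin \o h)^\+) _ _) _.
  + by apply: measurable_funepos; exact/measurable_EFinP.
  + by [].
  + by apply: eq_integral => x _; exact: pos.
- transitivity (\int[P]_w ((EFin \o h)^\- (Y w))).
    by apply: eq_integral => w _; rewrite !funenegE.
  apply: etrans (ge0_integral_law_density mf f0 Yf (h := (EFin \o h)^\-) _ _) _.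
  + by apply: measurable_funeneg; exact/measurable_EFinP.
  + by [].
  + by apply: eq_integral => x _; exact: neg.
Qed.

End integral_law_density.

Section log_records.
Local Open Scope ereal_scope.
Context (R : realType) d0 (Om0 : measurableType d0) (P0 : probability Om0 R).
Variables (V : nat -> {RV P0 >-> R}).
Notation mu := (@lebesgue_measure R).

Definition erlang_density n (y : R) : R :=
  (erlang n y * \1_`]0%R, +oo[ y)%R.

Lemma erlang_density_ge0 n y : (0 <= erlang_density n y)%R.
Proof.
rewrite /erlang_density indicE mem_setE in_itv/= andbT.
have [y0|_] := boolP (0 < y)%R; last by rewrite mulr0.
by rewrite mulr1 erlang_ge0// ltW.
Qed.

Lemma measurable_erlang_density n : measurable_fun setT (erlang_density n).
Proof.
by apply: measurable_funM; [exact: measurable_erlang|exact: measurable_indic].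
Qed.

Lemma erlang_density_law n y :
  \int[mu]_(x in `]-oo, y]) (erlang_density n x)%:E =
  (if (0 < y)%R then 1 - erlang_tail n y else 0)%:E.
Proof.
rewrite integral_mul_indic.
have -> : `]-oo, y] `&` `]0%R, +oo[ = `]0%R, y]%classic :> set R.
  by apply/seteqP; split => x; rewrite /= !in_itv/= andbT;
    [move=> [-> ->]|move=> /andP[-> ->]].
case: ltP => [y0|y0]; last by rewrite set_itv_ge ?integral_set0// bnd_simp -leNgt.
have me : measurable_fun `]0%R, y[ (EFin \o erlang n).
  by apply/measurable_EFinP; exact: measurable_erlang.
rewrite integral_itv_bndoo// -(@integral_itv_bndoo _ _ _ _ true false)//.
by rewrite integral_erlang_itv// ltW.
Qed.

Definition log_record n w : R := Lfun (record_val V n w).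

Lemma measurable_log_record n : measurable_fun setT (log_record n).
Proof. exact: (measurableT_comp (@measurable_Lfun R)). Qed.

HB.instance Definition _ n :=
  isMeasurableFun.Build _ _ _ _ (log_record n) (measurable_log_record n).

Hypothesis hV : iid_uniform V.

(** The change of variables y = Lfun v turns record_pdf into erlang; comparing
    the masses of left rays suffices. *)
Lemma log_record_law n A : measurable A ->
  distribution P0 (log_record n : {RV P0 >-> R}) A =
  \int[mu]_(x in A) (erlang_density n x)%:E.
Proof.
move=> mA.
pose idR : measurableTypeR R -> R := idfun.
have midR : measurable_fun setT idR by move=> _ B mB; rewrite setTI.
pose m2 := pushforward (density_measure mu (measurable_erlang_density n)
  (erlang_density_ge0 n)) idR.
suff : distribution P0 (log_record n : {RV P0 >-> R}) A = m2 A by [].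
apply: measure_unique_lrays => //.
  apply: le_lt_trans (ltry 1%R).
  exact: (probability_le1 (distribution P0 (log_record n : {RV P0 >-> R}))).
move=> y; apply: etrans (esym (erlang_density_law n y)).
transitivity (P0 (record_val V n @^-1` (@Lfun R @^-1` `]-oo, y]))) => //.
have mB : measurable (@Lfun R @^-1` `]-oo, y]).
  by rewrite -[X in measurable X]setTI; exact: measurable_Lfun.
apply: etrans (record_value_law hV n mB) _.
rewrite integral_mul_indic.
have -> : @Lfun R @^-1` `]-oo, y] `&` `]0%R, 1%R[ =
    `]0%R, (1 - expR (- y))%R]%classic :> set R.
  apply/seteqP; split => x; rewrite /= !in_itv/=.
    move=> [xy /andP[x0 x1]]; rewrite x0/= -(LfunK x1) lerD2l lerN2.
    by rewrite ler_expR lerN2.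
  move=> /andP[x0 xy].
  have x1 : (x < 1)%R by rewrite (le_lt_trans xy)// gtrBl expR_gt0.
  split; last by rewrite x0.
  by move: xy; rewrite -{1}(LfunK x1) lerD2l lerN2 ler_expR lerN2.
case: ltP => [y0|y0]; last first.
  rewrite set_itv_ge ?integral_set0// bnd_simp -leNgt subr_le0.
  by rewrite -expR0 ler_expR oppr_ge0.
have /andP[u0 u1] := onem_expRN_gt0 y0.
have mpdf D : measurable_fun D (EFin \o @record_pdf R n).
  by apply/measurable_EFinP; apply: measurable_funTS; exact: measurable_record_pdf.
rewrite integral_itv_bndoo// -(@integral_itv_bndoo _ _ _ _ true false)//.
by rewrite integral_record_pdf ?(ltW u0)// Lfun_onem_expRN.
Qed.

Lemma record_val01 n : {ae P0, forall w, (0 < record_val V n w < 1)%R}.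
Proof.
exists (record_val V n @^-1` (~` `]0%R, 1%R[)); split.
- by apply: measurable_funPTI; exact: measurableC.
- apply: etrans (record_value_law hV n (measurableC _)) _ => //.
  rewrite integral0_eq// => x; rewrite /record_density indicE.
  by move=> /= nx; rewrite memNset// mulr0.
- by move=> w /= nw; rewrite in_itv.
Qed.

End log_records.

Section quantile_transform.
Local Open Scope ereal_scope.
Context (R : realType).
Notation mu := (@lebesgue_measure R).
Implicit Types H : R -> R.

(** H is prescribed on the half-line only; a value elsewhere is chosen so that
    measurability and compositions make sense on the line. *)
Definition zero_ext H (y : R) : R := if (0 < y)%R then H y else 0%R.

Lemma measurable_zero_ext H :
  (forall y z, (0 < y)%R -> (y <= z)%R -> (H y <= H z)%R) ->
  measurable_fun setT (zero_ext H).
Proof.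
move=> Hnd.
have -> : zero_ext H = (H \o expR \o @ln R) \_ `]0%R, +oo[.
  apply/funext => y; rewrite /zero_ext patchE mem_setE in_itv/= andbT.
  by case: ifPn => // y0; rewrite lnK.
apply/(measurable_restrictT _ _).1 => //.
apply: measurable_funTS.
apply: measurableT_comp; last exact: measurable_ln.
apply: nondecreasing_measurable => // x y xy /=.
by apply: Hnd; rewrite ?expR_gt0// ler_expR.
Qed.

Lemma Lfun_le0 (u : R) : (u <= 0)%R || (1 <= u)%R -> (Lfun u <= 0)%R.
Proof.
move=> /orP[u0|u1]; rewrite /Lfun oppr_le0.
  by apply: ln_ge0; rewrite lerDl oppr_ge0.
by rewrite ln0// subr_le0.
Qed.

(** The infimum is taken over a set that is unbounded below or empty, and such
    infima have the default value 0. *)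
Lemma quantile_out (F : R -> R) (u : R) : (forall x, (0 <= F x <= 1)%R) ->
  (u <= 0)%R || (1 < u)%R -> quantile F u = 0%R.
Proof.
move=> F01 /orP[u0|u1]; rewrite /quantile.
  apply: inf_out => -[_ [z zlb]].
  have /zlb : [set x | (u <= F x)%R] (z - 1)%R.
    by rewrite /= (le_trans u0)//; have /andP[] := F01 (z - 1)%R.
  by rewrite leNgt gtrBl ltr01.
rewrite (_ : [set x | _] = set0) ?inf0//.
apply/seteqP; split => // x /= ux; have /andP[_] := F01 x.
by rewrite leNgt (lt_le_trans u1 ux).
Qed.

Lemma measurable_quantile (F : R -> R) H : (forall x, (0 <= F x <= 1)%R) ->
  (forall y z, (0 < y)%R -> (y <= z)%R -> (H y <= H z)%R) ->
  (forall u, (0 < u < 1)%R -> quantile F u = H (Lfun u)) ->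
  measurable_fun setT (quantile F).
Proof.
move=> F01 Hnd FH.
have -> : quantile F =
    (fun u => zero_ext H (Lfun u) + quantile F 1 * \1_[set 1%R] u)%R.
  apply/funext => u /=; rewrite indicE /zero_ext.
  have [->|u1] := eqVneq u 1%R.
    by rewrite mem_set// mulr1 ltNge Lfun_le0 ?lexx ?orbT// add0r.
  rewrite memNset; last by apply/eqP.
  rewrite mulr0 addr0.
  have [u01|nu] := boolP (0 < u < 1)%R; first by rewrite Lfun_gt0// FH.
  have nu' : (u <= 0)%R || (1 < u)%R.
    by move: nu u1; rewrite negb_and -!leNgt => /orP[->//|]; 
      rewrite le_eqVlt eq_sym => /orP[->//|->]; rewrite orbT.
  rewrite quantile_out// ltNge Lfun_le0//.
  by move: nu' => /orP[->//|/ltW ->]; rewrite orbT.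
apply: measurable_funD.
  by apply: measurableT_comp; [exact: measurable_zero_ext|exact: measurable_Lfun].
by apply: measurable_funM => //; exact: measurable_indic.
Qed.

Lemma df01 d (Om : measurableType d) (P : probability Om R) (X : {RV P >-> R}) x :
  (0 <= df X x <= 1)%R.
Proof.
rewrite /df fine_ge0 ?cdf_ge0//= -lee_fin fineK ?cdf_le1//.
rewrite ge0_fin_numE ?cdf_ge0//; exact: le_lt_trans (cdf_le1 _ _) (ltry _).
Qed.

(** The quantile at the record value is H at the logarithmic record, whose law
    is Erlang. *)
Lemma expected_recordE d0 (Om0 : measurableType d0) (P0 : probability Om0 R)
    (V : nat -> {RV P0 >-> R}) (hV : iid_uniform V)
    d (Om : measurableType d) (P : probability Om R) (X : {RV P >-> R}) H n :
  (forall y z, (0 < y)%R -> (y <= z)%R -> (H y <= H z)%R) ->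
  (forall u, (0 < u < 1)%R -> quantile (df X) u = H (Lfun u)) ->
  expected_record V X n = \int[mu]_(y in `]0%R, +oo[) (H y * erlang n y)%:E.
Proof.
move=> Hnd XH.
have mH := measurable_zero_ext Hnd.
transitivity (\int[P0]_w (zero_ext H (log_record V n w))%:E).
  rewrite /expected_record unlock; apply: ae_eq_integral => //.
  - apply/measurable_EFinP; apply: (measurableT_comp _ (measurable_record_val V n)).
    by apply: measurable_quantile XH => //; exact: df01.
  - by apply/measurable_EFinP; exact: (measurableT_comp mH).
  - apply: filterS (record_val01 hV n) => w w01 _.
    by rewrite /zero_ext /log_record Lfun_gt0// -XH.
rewrite (integral_law_density (Y := log_record V n) _ _ (log_record_law hV n))//.
- rewrite [RHS]integral_mkcond; apply: eq_integral => y _.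
  rewrite patchE /erlang_density /zero_ext indicE mem_setE in_itv/= andbT.
  by case: ltP; rewrite ?mulr1// mul0r.
- exact: measurable_erlang_density.
- exact: erlang_density_ge0.
Qed.

End quantile_transform.
(** * Integrals of increments *)

Section increments.
Local Open Scope ereal_scope.
Context (R : realType) d (S : measurableType d).
Variable sigma : {sigma_finite_measure set S -> \bar R}.
Variables (l g : S -> R) (H : R -> R).
Notation mu := (@lebesgue_measure R).

(** On the half-line, the Stieltjes measure of H is the image under l of the
    measure with density g with respect to sigma. Half-open intervals closed on
    the left are those that a left-continuous H measures by its increments. Any
    such triple (sigma, l, g) lets integrals against dH be handled without
    constructing dH. *)
Definition represents_increments := forall a b, (0 < a)%R -> (a <= b)%R ->
  (H b - H a)%:E = \int[sigma]_s (g s * \1_`[a, b[ (l s))%:E.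

Hypothesis ml : measurable_fun setT l.
Hypothesis mg : measurable_fun setT g.
Hypothesis g0 : forall s, (0 <= g s)%R.
Hypothesis gl : forall s, (l s <= 0)%R -> g s = 0%R.
Hypothesis Hinc : represents_increments.

Lemma represents_increments_nd y z : (0 < y)%R -> (y <= z)%R -> (H y <= H z)%R.
Proof.
move=> y0 yz; rewrite -subr_ge0 -lee_fin Hinc//.
by apply: integral_ge0 => s _; rewrite lee_fin mulr_ge0.
Qed.

(** The jump at l s is counted in H y - H p exactly when l s lies between p and
    y; half-openness of the intervals decides the two boundary cases. *)
Definition between p : set (measurableTypeR R * S) :=
  [set z | (p <= l z.2 /\ l z.2 < z.1)%R \/ (l z.2 < p /\ z.1 <= l z.2)%R].

Lemma measurable_between p : measurable (between p).
Proof.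
have m1 : measurable_fun setT (fun z : measurableTypeR R * S => l z.2).
  exact: measurableT_comp.
have m2 : measurable_fun setT (fun z : measurableTypeR R * S => z.1 : R).
  exact: measurable_fst.
have mle (f h : measurableTypeR R * S -> R) : measurable_fun setT f ->
    measurable_fun setT h -> measurable [set z | (f z <= h z)%R].
  move=> mf mh; rewrite -[X in measurable X]setTI.
  exact: (measurable_fun_ler mf mh) measurableT [set true] _.
have mlt (f h : measurableTypeR R * S -> R) : measurable_fun setT f ->
    measurable_fun setT h -> measurable [set z | (f z < h z)%R].
  move=> mf mh; rewrite -[X in measurable X]setTI.
  exact: (measurable_fun_ltr mf mh) measurableT [set true] _.
apply: measurableU; apply: measurableI.
- exact: mle.
- exact: mlt.
- exact: mlt.
- exact: mle.
Qed.

Lemma abs_increment p y : (0 < p)%R -> (0 < y)%R ->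
  (`|H y - H p|)%:E = \int[sigma]_s (g s * \1_(between p) (y, s))%:E.
Proof.
move=> p0 y0; have [py|yp] := leP p y.
  rewrite ger0_norm ?subr_ge0 ?represents_increments_nd// Hinc//.
  apply: eq_integral => s _; congr (_ * _)%:E; rewrite !indicE; congr (_%:R).
  congr nat_of_bool; apply/idP/idP; rewrite !inE/= in_itv/=.
    by move=> /andP[? ?]; left.
  case=> [[-> ->]//|[lp yl]].
  by have := le_lt_trans (le_trans py yl) lp; rewrite ltxx.
rewrite distrC ger0_norm ?subr_ge0 ?represents_increments_nd ?Hinc ?(ltW yp)//.
apply: eq_integral => s _; congr (_ * _)%:E; rewrite !indicE; congr (_%:R).
congr nat_of_bool; apply/idP/idP; rewrite !inE/= in_itv/=.
  by move=> /andP[? ?]; right.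
case=> [[pl ly]|[-> ->]//].
by have := lt_trans (le_lt_trans pl ly) yp; rewrite ltxx.
Qed.

(** The mass that q gives to the y such that t lies between p and y. *)
Definition outer_mass (q : R -> R) p t :=
  if (p <= t)%R then \int[mu]_(y in `]t, +oo[) (q y)%:E
  else \int[mu]_(y in `]0%R, t]) (q y)%:E.

(** Write the increment as an integral over s and exchange the order of
    integration. The absolute values make every integrand nonnegative, so that
    Tonelli's theorem applies without integrability conditions. *)
Lemma integral_abs_increment (q : R -> R) p : (0 < p)%R ->
  measurable_fun setT q -> (forall y, (0 < y)%R -> (0 <= q y)%R) ->
  \int[mu]_(y in `]0%R, +oo[) (`|H y - H p| * q y)%:E =
  \int[sigma]_s ((g s)%:E * outer_mass q p (l s)).
Proof.
move=> p0 mq q0.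
pose qp y : R := (q y * \1_`]0%R, +oo[ y)%R.
have qp0 y : (0 <= qp y)%R.
  rewrite /qp indicE mem_setE in_itv/= andbT.
  by have [/q0|_] := boolP (0 < y)%R; rewrite ?mulr1 ?mulr0.
have mqp : measurable_fun setT qp.
  by apply: measurable_funM => //; exact: measurable_indic.
pose f (z : measurableTypeR R * S) :=
  (qp z.1 * (g z.2 * \1_(between p) z))%:E.
have m1K : measurable_fun setT (\1_(between p) : _ -> R).
  by apply: measurable_indic; exact: measurable_between.
have f0 z : 0 <= f z by rewrite /f lee_fin mulr_ge0// mulr_ge0.
have mf : measurable_fun setT f.
  apply/measurable_EFinP; apply: measurable_funM.
    exact: (measurableT_comp mqp measurable_fst).
  apply: measurable_funM; first exact: (measurableT_comp mg measurable_snd).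
  by apply: measurable_indic; exact: measurable_between.
transitivity (\int[mu]_y \int[sigma]_s f (y, s)).
  rewrite [LHS]integral_mkcond; apply: eq_integral => y _.
  rewrite patchE mem_setE in_itv/= andbT; case: ifPn => y0.
    rewrite /f /= /qp indicE mem_setE in_itv/= y0 mulr1.
    under [RHS]eq_integral do rewrite EFinM.
    rewrite ge0_integralZl//.
    - by rewrite EFinM (abs_increment p0 y0) muleC.
    - apply/measurable_EFinP; apply: measurable_funM => //.
      exact: (measurable_fun_pair2 y m1K).
    - by move=> s _; rewrite lee_fin mulr_ge0.
    - by rewrite lee_fin q0.
  rewrite integral0_eq// => s _; rewrite /f/= /qp indicE mem_setE in_itv/=.
  by rewrite (negbTE y0) mulr0 mul0r.
rewrite (fubini_tonelli f mf f0); apply: eq_integral => s _.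
have [ls0|ls0] := leP (l s) 0%R.
  rewrite gl// mul0e integral0_eq// => y _.
  by rewrite /f/= gl// mul0r mulr0.
transitivity (\int[mu]_y ((g s)%:E * (qp y * \1_(between p) (y, s))%:E)).
  by apply: eq_integral => y _; rewrite /f/= -EFinM; congr EFin; ring.
rewrite ge0_integralZl//; last 3 first.
- apply/measurable_EFinP; apply: measurable_funM => //.
  exact: (measurable_fun_pair1 s m1K).
- by move=> y _; rewrite lee_fin mulr_ge0.
- by rewrite lee_fin.
congr (_ * _); rewrite /outer_mass; case: ifPn => pl.
  rewrite [RHS]integral_mkcond; apply: eq_integral => y _.
  rewrite patchE mem_setE in_itv/= andbT /qp !indicE mem_setE in_itv/= andbT.
  case: ifPn => ly.
    rewrite (lt_trans ls0 ly) mulr1 mem_set ?mulr1//.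
    by left.
  rewrite memNset ?mulr0// => -[[_]|[lp _]] /=; first by rewrite (negbTE ly).
  by move: pl; rewrite leNgt lp.
rewrite -ltNge in pl.
rewrite [RHS]integral_mkcond; apply: eq_integral => y _.
rewrite patchE mem_setE in_itv/= /qp !indicE mem_setE in_itv/= andbT.
have [y0|y0] := boolP (0 < y)%R; last by rewrite mulr0 mul0r.
rewrite mulr1; case: ifPn => /= yl.
  by rewrite mem_set ?mulr1//; right.
rewrite memNset ?mulr0// => -[[pl' _]|[_ yl']] /=; last by rewrite yl' in yl.
by have := lt_le_trans pl pl'; rewrite ltxx.
Qed.

End increments.

Section record_increments.
Local Open Scope ereal_scope.
Context (R : realType) d (S : measurableType d).
Variable sigma : {sigma_finite_measure set S -> \bar R}.
Variables (l g : S -> R) (H : R -> R).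
Notation mu := (@lebesgue_measure R).
Hypothesis ml : measurable_fun setT l.
Hypothesis mg : measurable_fun setT g.
Hypothesis g0 : forall s, (0 <= g s)%R.
Hypothesis gl : forall s, (l s <= 0)%R -> g s = 0%R.
Hypothesis Hinc : represents_increments sigma l g H.
Hypothesis Hint : forall n,
  mu.-integrable `]0%R, +oo[ (fun y => (H y * erlang n y)%:E).

Lemma integrable_erlang n :
  mu.-integrable `]0%R, +oo[ (fun y => (erlang n y : R)%:E).
Proof.
apply/integrableP; split.
  by apply/measurable_EFinP; exact: measurable_erlang.
under eq_integral => y.
  rewrite inE/= in_itv/= andbT => y0.
  rewrite ger0_norm ?erlang_ge0 ?(ltW y0)//.
  over.
rewrite integral_itv_obnd_cbnd; last first.
  by apply/measurable_EFinP; exact: measurable_erlang.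
by rewrite integral_erlang_itvy// erlang_tail0 ltry.
Qed.

Lemma integral_erlang n :
  \int[mu]_(y in `]0%R, +oo[) (erlang n y)%:E = 1.
Proof.
rewrite integral_itv_obnd_cbnd; last first.
  by apply/measurable_EFinP; exact: measurable_erlang.
by rewrite integral_erlang_itvy// erlang_tail0.
Qed.

(** Integration by parts against the derivative erlang n - erlang (n + 1) of
    erlang (n + 1). Subtracting the constant H (n + 1) from H changes nothing,
    as all Erlang densities have mass 1. It makes the integrand nonnegative,
    because H - H (n + 1) and erlang (n + 1) - erlang n both change sign at
    n + 1, and the exchange of integrals then needs no boundary terms. *)
Lemma record_increment n :
  \int[mu]_(y in `]0%R, +oo[) (H y * erlang n.+1 y)%:E -
  \int[mu]_(y in `]0%R, +oo[) (H y * erlang n y)%:E =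
  \int[sigma]_s (g s * erlang n.+1 (l s))%:E.
Proof.
have mD : measurable (`]0%R, +oo[%classic : set (measurableTypeR R)) by [].
pose p : R := n.+1%:R.
have p0 : (0 < p)%R by rewrite ltr0n.
have Hp m : mu.-integrable `]0%R, +oo[ (fun y => (H p * erlang m y)%:E).
  have := integrableZl mD (H p) (integrable_erlang m).
  by apply: eq_integrable => // y _; rewrite EFinM.
have ip m : \int[mu]_(y in `]0%R, +oo[) (H p * erlang m y)%:E = (H p)%:E.
  under eq_integral do rewrite EFinM.
  by rewrite integralZl//; [rewrite integral_erlang mule1|exact: integrable_erlang].
transitivity (\int[mu]_(y in `]0%R, +oo[)
    (`|H y - H p| * `|erlang n.+1 y - erlang n y|)%:E).
  have e1 : \int[mu]_(y in `]0%R, +oo[) ((H y * erlang n.+1 y)%:E -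
      (H p * erlang n.+1 y)%:E) =
      \int[mu]_(y in `]0%R, +oo[) (H y * erlang n.+1 y)%:E - (H p)%:E.
    by rewrite integralB ?ip//; exact: Hint.
  have e2 : \int[mu]_(y in `]0%R, +oo[) ((H y * erlang n y)%:E -
      (H p * erlang n y)%:E) =
      \int[mu]_(y in `]0%R, +oo[) (H y * erlang n y)%:E - (H p)%:E.
    by rewrite integralB ?ip//; exact: Hint.
  have fin m : \int[mu]_(y in `]0%R, +oo[) (H y * erlang m y)%:E \is a fin_num.
    exact: integrable_fin_num (Hint m).
  transitivity (\int[mu]_(y in `]0%R, +oo[) ((H y * erlang n.+1 y)%:E -
      (H p * erlang n.+1 y)%:E) - \int[mu]_(y in `]0%R, +oo[)
      ((H y * erlang n y)%:E - (H p * erlang n y)%:E)).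
    rewrite e1 e2 -(fineK (fin n)) -(fineK (fin n.+1)).
    by rewrite -!EFinB; congr EFin; ring.
  rewrite -integralB//; last 2 first.
  - by apply: integrableB => //; exact: Hint.
  - by apply: integrableB => //; exact: Hint.
  apply: eq_integral => y; rewrite inE/= in_itv/= andbT => y0.
  rewrite -!EFinB -normrM; congr EFin.
  have -> : (H y * erlang n.+1 y - H p * erlang n.+1 y -
    (H y * erlang n y - H p * erlang n y) =
    (H y - H p) * (erlang n.+1 y - erlang n y))%R by ring.
  rewrite ger0_norm//; have [py|yp] := leP p y.
    rewrite mulr_ge0 ?subr_ge0 ?erlangS_ge ?(ltW y0)//.
    exact: (represents_increments_nd g0 Hinc).
  rewrite mulr_le0 ?subr_le0 ?erlangS_le ?(ltW y0) ?(ltW yp)//.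
  exact: (represents_increments_nd g0 Hinc y0 (ltW yp)).
rewrite (integral_abs_increment ml mg g0 gl Hinc p0
  (q := fun y => `|erlang n.+1 y - erlang n y|%R))//; last first.
  apply: measurableT_comp => //; apply: measurable_funB; exact: measurable_erlang.
apply: eq_integral => s _.
have [ls0|ls0] := leP (l s) 0%R; first by rewrite gl// !(mul0e, mul0r).
have mq D : measurable_fun D
    (fun y => (`|erlang n.+1 y - erlang n y|%R : R)%:E).
  apply/measurable_EFinP; apply: measurable_funTS.
  apply: measurableT_comp => //; apply: measurable_funB; exact: measurable_erlang.
rewrite EFinM; congr (_ * _); rewrite /outer_mass; case: ifPn => pl.
  by rewrite integral_itv_obnd_cbnd// integral_erlangB_itvy.
rewrite -ltNge in pl.
rewrite integral_itv_obnd_cbnd// integral_erlangB_itv//.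
by rewrite (ltW ls0) ltW.
Qed.

End record_increments.
(** * Quantiles and the increments they represent *)

Section quantile_galois.
Context (R : realType) d (Om : measurableType d) (P : probability Om R).
Variable X : {RV P >-> R}.
Notation F := (df X).

Lemma cdf_df x : cdf X x = (F x)%:E.
Proof.
rewrite /df fineK// ge0_fin_numE ?cdf_ge0//.
exact: le_lt_trans (cdf_le1 _ _) (ltry _).
Qed.

Lemma df_nd x y : x <= y -> F x <= F y.
Proof. by move=> xy; rewrite -lee_fin -!cdf_df; exact: cdf_nondecreasing. Qed.

(** Right continuity of the distribution function, together with its limits at
    both ends, makes the infimum that defines the quantile attained. *)
Lemma quantile_le u x : 0 < u < 1 -> (quantile F u <= x) = (u <= F x).
Proof.
move=> /andP[u0 u1].
have F0 : F z @[z --> -oo] --> (0 : R) by exact: (fine_cvg (cvg_cdfNy0 X)).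
have F1 : F z @[z --> +oo] --> (1 : R) by exact: (fine_cvg (cvg_cdfy1 X)).
have lb : exists z, lbound [set y | u <= F y] z.
  have [z [_ Fz]] : exists z, z < 0 /\ F z < u.
    near (-oo : set_system R) => z; exists z; split.
      by near: z; exact: nbhs_ninfty_lt.
    by near: z; exact: (cvgr_lt _ F0).
  exists z => y /= uy; rewrite leNgt; apply/negP => yz.
  by have := le_lt_trans (le_trans uy (df_nd (ltW yz))) Fz; rewrite ltxx.
have ub : [set y | u <= F y] !=set0.
  near (+oo : set_system R) => z; exists z => /=; apply: ltW.
  by near: z; exact: (cvgr_gt _ F1).
have hinf : has_inf [set y | u <= F y] by split.
apply/idP/idP => [qx|ux]; last exact: ge_inf.
have Fr : F z @[z --> x^'+] --> F x.
  have := @cdf_right_continuous _ _ _ _ X x; rewrite cdf_df; exact: fine_cvg.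
apply: (cvgr_to_ge Fr).
near=> z.
have xz : x < z by near: z; exact: nbhs_right_gt.
have xz0 : 0 < z - x by rewrite subr_gt0.
have [y uy yz] := inf_adherent xz0 hinf.
apply: le_trans uy _; apply: df_nd; apply: ltW; apply: lt_le_trans yz _.
by rewrite -lerBrDr subKr.
Unshelve. all: by end_near. Qed.

End quantile_galois.

Section spread.
Local Open Scope ereal_scope.
Context (R : realType) d (Om : measurableType d) (P : probability Om R).
Variables (X : {RV P >-> R}) (H : R -> R).
Notation F := (df X).
Notation mu := (@lebesgue_measure R).
Hypothesis Hnd : forall y z, (0 < y)%R -> (y <= z)%R -> (H y <= H z)%R.
Hypothesis XH : forall u, (0 < u < 1)%R -> quantile F u = H (Lfun u).

Definition log_df (x : R) : R := Lfun (F x).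

(** The density, with respect to Lebesgue measure, of the measure on the line
    whose image under log_df is dH. *)
Definition spread (x : R) : R := if (F x == 0%R) || (F x == 1%R) then 0%R else 1%R.

Lemma measurable_df : measurable_fun setT F.
Proof.
by apply: nondecreasing_measurable => // x y xy; exact: df_nd.
Qed.

Lemma measurable_log_df : measurable_fun setT log_df.
Proof. exact: (measurableT_comp (@measurable_Lfun R) measurable_df). Qed.

Lemma spreadE x : spread x = (0 < F x < 1)%R%:R%R.
Proof.
rewrite /spread; have /andP[F0 F1] := df01 X x.
rewrite !lt_neqAle F0 F1 !andbT (eq_sym 0%R).
by case: eqP => //=; case: eqP.
Qed.

Lemma measurable_spread : measurable_fun setT spread.
Proof.
rewrite (_ : spread = \1_(F @^-1` `]0%R, 1%R[)).
  apply: measurable_indic; rewrite -[X in measurable X]setTI.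
  exact: measurable_df.
apply/funext => x; rewrite spreadE indicE; congr (nat_of_bool _)%:R%R.
by apply/idP/idP; rewrite inE/= in_itv.
Qed.

Lemma spread_ge0 x : (0 <= spread x)%R.
Proof. by rewrite /spread; case: ifP. Qed.

Lemma spread_log_df0 x : (log_df x <= 0)%R -> spread x = 0%R.
Proof.
move=> l0; rewrite spreadE; case: (boolP (0 < F x < 1)%R) => // F01.
by have := Lfun_gt0 F01; rewrite ltNge l0.
Qed.

Lemma H_le a x : (0 < a)%R -> (H a <= x)%R = (1 - expR (- a) <= F x)%R.
Proof.
move=> a0; rewrite -quantile_le ?onem_expRN_gt0// XH ?onem_expRN_gt0//.
by rewrite Lfun_onem_expRN.
Qed.

(** By the Galois connection between quantile and distribution function,
    H a <= x < H b holds exactly when a <= L (F x) < b, and the Lebesgue measure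
    of the interval from H a to H b is the increment of H. *)
Lemma spread_increments : represents_increments mu log_df spread H.
Proof.
move=> a b a0 ab; have b0 := lt_le_trans a0 ab.
transitivity (\int[mu]_s (\1_`[H a, H b[ s)%:E).
  rewrite integral_indic// setIT /= lebesgue_measure_itv/= lte_fin.
  case: ltP (Hnd a0 ab) => // Hba Hab.
  have -> : H b = H a by apply/le_anti; rewrite Hba Hab.
  by rewrite subrr.
apply: eq_integral => s _; congr EFin.
rewrite spreadE !indicE !mem_setE/= !in_itv/= -natrM mulnb; congr (nat_of_bool _)%:R%R.
rewrite H_le// ltNge H_le// /log_df -ltNge.
have [/andP[F0 F1]|nF] /= := boolP (0 < F s < 1)%R.
  have e1 z : (1 - expR (- z) < 1)%R by rewrite gtrBl expR_gt0.
  have -> : (a <= Lfun (F s))%R = (1 - expR (- a) <= F s)%R.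
    by rewrite -{1}(Lfun_onem_expRN a) Lfun_le ?e1.
  have -> : (Lfun (F s) < b)%R = (F s < 1 - expR (- b))%R.
    by rewrite -{1}(Lfun_onem_expRN b) Lfun_lt ?e1.
  by [].
apply/negP => /andP[Fa Fb]; move: nF; rewrite (lt_trans Fb) ?andbT; last first.
  by rewrite gtrBl expR_gt0.
by rewrite (lt_le_trans _ Fa)//; have /andP[] := onem_expRN_gt0 a0.
Qed.

(** With y = L (F x), the weight (1 - F x) L (F x) is y exp (- y). Hence the
    transform has law y exp (- y) dH(y), normalised. *)
Lemma phi_weightE x : phi_weight F x = (spread x * erlang 1 (log_df x))%R.
Proof.
rewrite /phi_weight /spread; case: ifPn => [_|]; first by rewrite mul0r.
rewrite negb_or => /andP[_ F1].
have F1' : (F x < 1)%R.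
  by rewrite lt_neqAle F1; have /andP[] := df01 X x.
by rewrite mul1r /erlang expRNLfun// expr1 divr1 mulrC.
Qed.

Lemma phi_weight_ge0 x : (0 <= phi_weight F x)%R.
Proof.
rewrite phi_weightE; have [l0|l0] := leP (log_df x) 0%R.
  by rewrite spread_log_df0// mul0r.
by rewrite mulr_ge0 ?spread_ge0// erlang_ge0// ltW.
Qed.

Lemma measurable_phi_weight : measurable_fun setT (phi_weight F).
Proof.
rewrite (_ : phi_weight F = fun x => spread x * erlang 1 (log_df x))%R; last first.
  exact/funext/phi_weightE.
apply: measurable_funM; first exact: measurable_spread.
apply: measurableT_comp; first exact: measurable_erlang.
exact: measurable_log_df.
Qed.

Hypothesis Hint : forall n,
  mu.-integrable `]0%R, +oo[ (fun y => (H y * erlang n y)%:E).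

Lemma integral_phi_weight :
  \int[mu]_x (phi_weight F x)%:E =
  \int[mu]_(y in `]0%R, +oo[) (H y * erlang 1 y)%:E -
  \int[mu]_(y in `]0%R, +oo[) (H y * erlang 0 y)%:E.
Proof.
rewrite (@record_increment R _ (measurableTypeR R) mu _ _ _ measurable_log_df
  measurable_spread spread_ge0 spread_log_df0 spread_increments Hint).
by apply: eq_integral => x _; rewrite phi_weightE.
Qed.

End spread.
(** * The transform of a random variable *)

Section inverse_weight.
Context (R : realType).
Implicit Types t : R.

(** The reciprocal of erlang 1 on the half-line: multiplying by it recovers dH
    from the law of the transform. *)
Definition inv_erlang1 t : R := if 0 < t then expR t / t else 0.

Lemma inv_erlang1_ge0 t : 0 <= inv_erlang1 t.
Proof.
by rewrite /inv_erlang1; case: ifPn => // t0; rewrite divr_ge0 ?expR_ge0// ltW.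
Qed.

Lemma inv_erlang1_le0 t : t <= 0 -> inv_erlang1 t = 0.
Proof. by rewrite /inv_erlang1 ltNge => ->. Qed.

Lemma inv_erlang1M n t : 0 < t ->
  inv_erlang1 t * erlang n.+1 t = t ^+ n / n.+1`!%:R.
Proof.
move=> t0; rewrite /inv_erlang1 t0 /erlang exprS expRN.
have n0 : n.+1`!%:R != 0 :> R by rewrite pnatr_eq0 -lt0n fact_gt0.
have e0 : expR t != 0 by rewrite gt_eqF// expR_gt0.
move: n0 e0; move: (n.+1`!%:R) (expR t) => a e a0 e0.
by field; rewrite a0 e0 gt_eqF.
Qed.

Lemma inv_erlang1K t : 0 < t -> inv_erlang1 t * erlang 1 t = 1.
Proof. by move=> t0; rewrite inv_erlang1M// expr0 divr1. Qed.

Lemma measurable_inv_erlang1 : measurable_fun setT inv_erlang1.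
Proof.
have -> : inv_erlang1 = (fun t => expR t * t^-1) \_ `]0, +oo[.
  apply/funext => t; rewrite /inv_erlang1 patchE mem_setE in_itv/= andbT.
  by case: ifP.
apply/(measurable_restrictT _ _).1 => //.
apply: measurable_funM; first exact: measurable_funTS.
apply: open_continuous_measurable_fun; first exact: interval_open.
move=> t; rewrite inE/= in_itv/= andbT => t0.
by apply: cvgV; [rewrite gt_eqF|exact: cvg_id].
Qed.

End inverse_weight.

Section moments.
Local Open Scope ereal_scope.
Context (R : realType) d (Om : measurableType d) (P : probability Om R).
Variables (T : {RV P >-> R}) (H : R -> R) (c : R).
Notation mu := (@lebesgue_measure R).
Hypothesis c0 : (0 <= c)%R.
Hypothesis T0 : P [set w | (0 < T w)%R] = 1.
Hypothesis Hinc :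
  represents_increments P T (fun w => c * inv_erlang1 (T w))%R H.
Hypothesis Hint : forall n,
  mu.-integrable `]0%R, +oo[ (fun y => (H y * erlang n y)%:E).

Lemma pos_ae : {ae P, forall w, (0 < T w)%R}.
Proof.
have mT : measurable [set w | (0 < T w)%R].
  rewrite -[X in measurable X]setTI.
  exact: (measurable_fun_ltr (measurable_cst _) (measurable_funPT T))
    measurableT [set true] _.
exists (~` [set w | (0 < T w)%R]); split => //; first exact: measurableC.
by rewrite probability_setC// T0 subee.
Qed.

Lemma measurable_inv_erlang1_comp :
  measurable_fun setT (fun w => inv_erlang1 (T w)).
Proof. by apply: measurableT_comp => //; exact: measurable_inv_erlang1. Qed.

(** dH is c exp (t) / t times the law of T, and the factor exp (t) / t turns
    erlang (n + 1) into t^n / (n + 1)!. *)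
Lemma record_increment_moment n :
  \int[mu]_(y in `]0%R, +oo[) (H y * erlang n.+1 y)%:E -
  \int[mu]_(y in `]0%R, +oo[) (H y * erlang n y)%:E =
  (c / n.+1`!%:R)%:E * \int[P]_w (`|T w| ^+ n)%:E.
Proof.
have mabs : measurable_fun setT (fun w => (`|T w| ^+ n)%:E).
  apply/measurable_EFinP; apply: (measurableT_comp (@exprn_measurable R setT n)).
  exact: measurableT_comp.
rewrite (record_increment _ _ _ _ Hinc Hint)//.
- rewrite -ge0_integralZl ?lee_fin ?divr_ge0//.
  apply: ae_eq_integral => //.
  + apply/measurable_EFinP; apply: measurable_funM.
      by apply: measurable_funM => //; exact: measurable_inv_erlang1_comp.
    by apply: measurableT_comp => //; exact: measurable_erlang.
  + apply: emeasurable_funM => //.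
  + apply: filterS pos_ae => w w0 _; rewrite -EFinM; congr EFin.
    by rewrite -mulrA inv_erlang1M// gtr0_norm// mulrCA mulrC -mulrA mulrC
      -mulrA mulrC -mulrA.
- by apply: measurable_funM => //; exact: measurable_inv_erlang1_comp.
- by move=> w; rewrite mulr_ge0// inv_erlang1_ge0.
- by move=> w w0; rewrite inv_erlang1_le0// mulr0.
Qed.

Lemma moment_abs n : 'E_P[fun w => (T w ^+ n)%R] = \int[P]_w (`|T w| ^+ n)%:E.
Proof.
have mX : measurable_fun setT (fun x : R => (x ^+ n)%R).
  exact: exprn_measurable.
rewrite unlock; apply: ae_eq_integral => //.
- apply/measurable_EFinP.
  exact: (measurableT_comp mX (measurable_funPT T)).
- apply/measurable_EFinP; apply: (measurableT_comp mX).
  exact: (measurableT_comp (@normr_measurable R setT) (measurable_funPT T)).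
- by apply: filterS pos_ae => w w0 _; rewrite gtr0_norm.
Qed.

End moments.

Section density_probability.
Local Open Scope ereal_scope.
Context d (S : measurableType d) (R : realType).
Variable mu : {measure set S -> \bar R}.

(** The proof that the total mass is 1 is an argument, so that the probability
    structure can be inferred from the term. *)
Definition density_probability (f : S -> R)
  (mf : measurable_fun setT f) (f0 : forall x, (0 <= f x)%R)
  (f1 : \int[mu]_x (f x)%:E = 1) : set S -> \bar R := density_measure mu mf f0.

Variables (f : S -> R) (mf : measurable_fun setT f).
Hypotheses (f0 : forall x, (0 <= f x)%R) (f1 : \int[mu]_x (f x)%:E = 1).

HB.instance Definition _ :=
  Measure.copy (density_probability mf f0 f1) (density_measure mu mf f0).

HB.instance Definition _ :=
  @Measure_isProbability.Build _ _ _ (density_probability mf f0 f1) f1.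

End density_probability.

Section phi_law.
Local Open Scope ereal_scope.
Context (R : realType) d (Om : measurableType d) (P : probability Om R).
Variables (X : {RV P >-> R}) (H : R -> R).
Notation F := (df X).
Notation mu := (@lebesgue_measure R).
Hypothesis Hnd : forall y z, (0 < y)%R -> (y <= z)%R -> (H y <= H z)%R.
Hypothesis XH : forall u, (0 < u < 1)%R -> quantile F u = H (Lfun u).

Definition phi_mass : R := (\int[mu]_y phi_weight F y)%R.

Lemma phi_mass_ge0 : (0 <= phi_mass)%R.
Proof.
apply: fine_ge0; apply: integral_ge0 => x _; rewrite lee_fin.
exact: phi_weight_ge0.
Qed.

Lemma phi_density_ge0 x : (0 <= phi_density F x)%R.
Proof. by rewrite divr_ge0 ?phi_weight_ge0// phi_mass_ge0. Qed.

Lemma measurable_phi_density : measurable_fun setT (phi_density F).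
Proof. by apply: measurable_funM => //; exact: measurable_phi_weight. Qed.

Lemma integral_phi_density :
  \int[mu]_x (phi_density F x)%:E =
  (phi_mass^-1)%:E * \int[mu]_x (phi_weight F x)%:E.
Proof.
rewrite -ge0_integralZl//.
- by apply: eq_integral => x _; rewrite -EFinM mulrC.
- by apply/measurable_EFinP; exact: measurable_phi_weight.
- by move=> x _; rewrite lee_fin phi_weight_ge0.
- by rewrite lee_fin invr_ge0 phi_mass_ge0.
Qed.

(** Take the given density on the line itself, and L o F as the variable. *)
Lemma exists_phi : \int[mu]_x (phi_weight F x)%:E = phi_mass%:E ->
  (0 < phi_mass)%R ->
  exists d' (Om' : measurableType d') (P' : probability Om' R)
    (T : {RV P' >-> R}), is_phi X T.
Proof.
move=> massE mass0.
have f1 : \int[mu]_x (phi_density F x)%:E = 1.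
  by rewrite integral_phi_density massE -EFinM mulVf// gt_eqF.
pose P1 : probability (measurableTypeR R) R :=
  @density_probability _ (measurableTypeR R) R mu (phi_density F)
    measurable_phi_density phi_density_ge0 f1.
pose idR : measurableTypeR R -> R := idfun.
have mid : measurable_fun setT idR by move=> _ B mB; rewrite setTI.
pose V : {RV P1 >-> R} := mfun_Sub (mem_set mid).
pose l : measurableTypeR R -> R := log_df X.
have ml : measurable_fun setT l by exact: measurable_log_df.
pose T : {RV P1 >-> R} := mfun_Sub (mem_set ml).
by exists _, _, P1, T, _, _, P1, V; split.
Qed.

Context d' (Om' : measurableType d') (P' : probability Om' R).
Variable T : {RV P' >-> R}.
Hypothesis hT : is_phi X T.

(** The phi density of a variable related to X by is_phi has total mass 1. This
    rules out an infinite or zero normalising integral, whose inverse would be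
    the default value 0. *)
Lemma phi_mass_gt0 :
  (0 < phi_mass)%R /\ \int[mu]_x (phi_weight F x)%:E = phi_mass%:E.
Proof.
have [d1 [Om1 [P1 [V [hdens _]]]]] := hT.
have := hdens setT measurableT.
rewrite probability_setT integral_phi_density => tot.
have mass_neq0 : phi_mass != 0%R.
  apply/eqP => m0; move: tot; rewrite m0 invr0 mul0e => /eqP.
  by rewrite eqe oner_eq0.
split; first by rewrite lt_neqAle eq_sym mass_neq0 phi_mass_ge0.
rewrite /phi_mass /Rintegral fineK//.
rewrite ge0_fin_numE; last first.
  by apply: integral_ge0 => x _; rewrite lee_fin phi_weight_ge0.
rewrite ltNge leye_eq; apply/negP => /eqP inf; move: mass_neq0.
by rewrite /phi_mass /Rintegral inf eqxx.
Qed.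

Lemma phi_integral (h : R -> \bar R) : measurable_fun setT h ->
  (forall x, 0 <= h x) ->
  \int[P']_w h (T w) = \int[mu]_x (h (log_df X x) * (phi_density F x)%:E).
Proof.
move=> mh h0.
have [d1 [Om1 [P1 [V [hdens TV]]]]] := hT.
have mlV : measurable_fun setT (fun w => log_df X (V w)).
  by apply: measurableT_comp => //; exact: measurable_log_df.
pose lV : {RV P1 >-> R} := mfun_Sub (mem_set mlV).
rewrite -(ge0_integral_distribution T mh h0).
rewrite (eq_measure_integral (distribution P1 lV)); last first.
  by move=> A mA _; exact: TV.
rewrite (ge0_integral_distribution lV mh h0).
rewrite -(ge0_integral_law_density measurable_phi_density phi_density_ge0 hdens
  (h := h \o log_df X))//.
  by apply: measurableT_comp => //; exact: measurable_log_df.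
by move=> x; exact: h0.
Qed.

Lemma phi_pos : P' [set w | (0 < T w)%R] = 1.
Proof.
have [mass0 massE] := phi_mass_gt0.
have mI : measurable (`]0%R, +oo[%classic : set R) by [].
transitivity (\int[P']_w (\1_`]0%R, +oo[ (T w))%:E).
  have -> : [set w | (0 < T w)%R] = T @^-1` `]0%R, +oo[.
    by apply/seteqP; split => w; rewrite /= in_itv/= andbT.
  rewrite -(setIT (T @^-1` _)) -integral_indic//.
  by rewrite -[X in measurable X]setTI; exact: (measurable_funPT T).
rewrite (phi_integral (h := fun t => (\1_`]0%R, +oo[ t)%:E))//.
- transitivity (\int[mu]_x (phi_density F x)%:E).
    apply: eq_integral => x _; rewrite indicE mem_setE in_itv/= andbT.
    have [l0|l0] := ltP 0%R (log_df X x); first by rewrite mul1e.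
    by rewrite mul0e /phi_density phi_weightE spread_log_df0// !mul0r.
  by rewrite integral_phi_density massE -EFinM mulVf// gt_eqF.
- by apply/measurable_EFinP; exact: measurable_indic.
Qed.

(** The transform has density spread * erlang 1 in the variable log_df, divided
    by phi_mass; the factor phi_mass * inv_erlang1 undoes both and leaves the
    representation of dH by spread. *)
Lemma phi_represents : represents_increments P' T
  (fun w => phi_mass * inv_erlang1 (T w))%R H.
Proof.
have [mass0 massE] := phi_mass_gt0.
move=> a b a0 ab; rewrite (spread_increments Hnd XH a0 ab).
rewrite (phi_integral (h := fun t =>
  (phi_mass * inv_erlang1 t * \1_`[a, b[ t)%:E)).
- apply: eq_integral => x _; rewrite -EFinM; congr EFin.
  rewrite /phi_density -/phi_mass phi_weightE.
  have [l0|l0] := leP (log_df X x) 0%R.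
    by rewrite spread_log_df0// !mul0r mulr0.
  have := inv_erlang1K l0; move: (inv_erlang1 _) (erlang _ _) => i e ie.
  rewrite -[LHS]mulr1 -ie; field.
  by rewrite gt_eqF.
- apply/measurable_EFinP; apply: measurable_funM; last exact: measurable_indic.
  by apply: measurable_funM => //; exact: measurable_inv_erlang1.
- by move=> t; rewrite lee_fin !mulr_ge0 ?phi_mass_ge0// inv_erlang1_ge0.
Qed.

End phi_law.
(** * Recovering the law of the transform from the increments *)

Section truncated.
Local Open Scope ereal_scope.
Context (R : realType) d (Om : measurableType d) (P : probability Om R).
Variables (T : {RV P >-> R}) (c : R) (H : R -> R).
Hypothesis c0 : (0 < c)%R.
Hypothesis Hinc :
  represents_increments P T (fun w => c * inv_erlang1 (T w))%R H.

Definition truncated_weight (lo hi : R) (w : Om) : R :=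
  (c * inv_erlang1 (T w) * \1_`[lo, hi[ (T w))%R.

Lemma truncated_weight_ge0 lo hi w : (0 <= truncated_weight lo hi w)%R.
Proof. by rewrite !mulr_ge0 ?inv_erlang1_ge0// ltW. Qed.

Lemma measurable_truncated_weight lo hi :
  measurable_fun setT (truncated_weight lo hi).
Proof.
apply: measurable_funM.
  by apply: measurable_funM => //; exact: measurable_inv_erlang1_comp.
by apply: measurableT_comp => //; exact: measurable_indic.
Qed.

(** The measure dH on [lo, hi[. The restriction makes it finite, since dH may
    have infinite mass near 0 and near infinity. *)
Definition truncated_law lo hi : set R -> \bar R :=
  pushforward (density_measure P (measurable_truncated_weight lo hi)
    (truncated_weight_ge0 lo hi)) T.

Let truncated_law0 lo hi : truncated_law lo hi set0 = 0.
Proof. exact: measure0. Qed.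

Let truncated_law_ge0 lo hi A : 0 <= truncated_law lo hi A.
Proof. exact: measure_ge0. Qed.

Let truncated_law_sigma lo hi : semi_sigma_additive (truncated_law lo hi).
Proof. exact: measure_semi_sigma_additive. Qed.

HB.instance Definition _ lo hi := isMeasure.Build _ _ _ (truncated_law lo hi)
  (truncated_law0 lo hi) (@truncated_law_ge0 lo hi) (@truncated_law_sigma lo hi).

Lemma truncated_lawE lo hi x : (0 < lo)%R ->
  truncated_law lo hi `[x, +oo[ =
  (if (Num.max x lo <= hi)%R then H hi - H (Num.max x lo) else 0)%:E.
Proof.
move=> lo0.
transitivity (\int[P]_w (c * inv_erlang1 (T w) * \1_`[Num.max x lo, hi[ (T w))%:E).
  rewrite /truncated_law /pushforward /density_measure integral_mkcond.
  apply: eq_integral => w _; rewrite patchE /truncated_weight.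
  have -> : (w \in T @^-1` `[x, +oo[) = (x <= T w)%R.
    by apply/idP/idP; rewrite inE/= in_itv/= andbT.
  rewrite !indicE !mem_setE !in_itv/= ge_max.
  by case: (x <= T w)%R => //=; rewrite mulr0.
case: ifPn => [le|]; first by rewrite Hinc// lt_max lo0 orbT.
rewrite -ltNge => lt; rewrite integral0_eq// => w _.
rewrite indicE mem_setE in_itv/=.
have [le1/=|_] := leP (Num.max x lo) (T w); last by rewrite mulr0.
by rewrite ltNge (ltW (lt_le_trans lt le1)) mulr0.
Qed.

Lemma truncated_law_total lo hi : (0 < lo)%R ->
  truncated_law lo hi setT < +oo.
Proof.
move=> lo0; apply: (@le_lt_trans _ _ (truncated_law lo hi `[lo, +oo[)).
  rewrite /truncated_law /pushforward /density_measure preimage_setT.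
  rewrite [leRHS]integral_mkcond; apply: ge0_le_integral => //.
  - by move=> w _; rewrite lee_fin truncated_weight_ge0.
  - by apply/measurable_EFinP; exact: measurable_truncated_weight.
  - apply/(measurable_restrictT _ _).1; first exact: measurable_funPTI.
    apply: measurable_funTS; apply/measurable_EFinP.
    exact: measurable_truncated_weight.
  - move=> w _; rewrite patchE; case: ifPn => // nw.
    have nw' : (lo <= T w)%R = false.
      apply/negbTE/negP => low; move: nw; rewrite mem_set//=.
      by rewrite in_itv/= low.
    by rewrite /truncated_weight indicE mem_setE in_itv/= nw' mulr0.
by rewrite truncated_lawE// ltry.
Qed.

(** Multiplying dH back by erlang 1 / c gives the law of T on [lo, hi[. *)
Lemma truncated_law_integral (lo hi : R) (A : set R) : (0 < lo)%R -> measurable A ->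
  P (T @^-1` (A `&` `[lo, hi[)) =
  \int[truncated_law lo hi]_t (erlang_density 1 t / c * \1_A t)%:E.
Proof.
move=> lo0 mA.
have mh : measurable_fun setT
    (fun t : R => (erlang_density 1 t / c * \1_A t)%:E).
  apply/measurable_EFinP; apply: measurable_funM; last exact: measurable_indic.
  by apply: measurable_funM => //; exact: measurable_erlang_density.
have h0 (t : R) : 0 <= (erlang_density 1 t / c * \1_A t)%:E.
  by rewrite lee_fin mulr_ge0// divr_ge0 ?erlang_density_ge0// ltW.
rewrite ge0_integral_pushforward// preimage_setT.
have mhT : measurable_fun setT
    ((fun t => (erlang_density 1 t / c * \1_A t)%:E) \o T).
  exact: measurableT_comp.
rewrite (ge0_integral_density (mu := P) (alpha := density_measure P
  (measurable_truncated_weight lo hi) (truncated_weight_ge0 lo hi))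
  (measurable_truncated_weight lo hi)
  (truncated_weight_ge0 lo hi) (fun B _ => erefl) measurableT mhT); last first.
  by move=> w _; exact: h0.
have mAI : measurable (T @^-1` (A `&` `[lo, hi[)).
  by apply: measurable_funPTI; exact: measurableI.
rewrite -(setIT (T @^-1` _)) -integral_indic//.
apply: eq_integral => w _; rewrite -EFinM /truncated_weight; congr EFin.
have -> : \1_(T @^-1` (A `&` `[lo, hi[)) w = (\1_A (T w) * \1_`[lo, hi[ (T w))%R
    :> R.
  by rewrite !indicE -natrM mulnb; congr (nat_of_bool _)%:R%R;
    apply/idP/andP; rewrite !inE/= => -[].
rewrite [in RHS]mulrA -[LHS]mulrC -[RHS]mulrC.
have [lT|lT] := boolP (T w \in `[lo, hi[%classic); last first.
  by rewrite indicE (negbTE lT) !mul0r.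
have T0 : (0 < T w)%R.
  by move: lT; rewrite inE/= in_itv/= => /andP[/(lt_le_trans lo0)].
rewrite !indicE lT !mul1r /erlang_density indicE mem_setE in_itv/= T0 mulr1.
have := inv_erlang1K T0; move: (inv_erlang1 _) (erlang _ _) (T w \in A)%:R%R.
move=> i e a ie; rewrite -[LHS]mulr1 -ie; field.
by rewrite gt_eqF.
Qed.

End truncated.

Section law_of_increments.
Local Open Scope ereal_scope.
Context (R : realType) d (Om : measurableType d) (P : probability Om R)
  d' (Om' : measurableType d') (P' : probability Om' R).
Variables (T : {RV P >-> R}) (T' : {RV P' >-> R}) (c : R) (H H' : R -> R).

(** The increments determine dH on compact parts of the half-line, hence the law
    of the transform there; these parts exhaust the half-line. *)
Lemma same_law_of_increments : (0 < c)%R ->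
  P [set w | (0 < T w)%R] = 1 -> P' [set w | (0 < T' w)%R] = 1 ->
  represents_increments P T (fun w => c * inv_erlang1 (T w))%R H ->
  represents_increments P' T' (fun w => c * inv_erlang1 (T' w))%R H' ->
  (forall a b, (0 < a)%R -> (a <= b)%R -> (H b - H a = H' b - H' a)%R) ->
  same_distribution T T'.
Proof.
move=> c0 T0 T0' Hinc Hinc' HH' A mA.
have main lo hi : (0 < lo)%R ->
    P (T @^-1` (A `&` `[lo, hi[)) = P' (T' @^-1` (A `&` `[lo, hi[)).
  move=> lo0.
  rewrite (truncated_law_integral T c0 hi lo0 mA).
  rewrite (truncated_law_integral T' c0 hi lo0 mA).
  apply: eq_measure_integral => B mB _.
  apply: measure_unique_rays => //; first exact: (truncated_law_total c0 Hinc).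
  move=> x; apply: etrans (truncated_lawE c0 Hinc hi x lo0) _.
  apply: etrans (esym (truncated_lawE c0 Hinc' hi x lo0)).
  case: ifPn => // le; congr EFin; apply: HH' => //.
  by rewrite lt_max lo0 orbT.
pose I (n : nat) : set R := `[(n.+1%:R^-1 : R)%R, (n.+1%:R : R)%R[%classic.
have ndI : nondecreasing_seq I.
  move=> m n mn; apply/subsetPset; apply: subset_itv; rewrite bnd_simp.
    by rewrite lef_pV2 ?posrE// ler_nat.
  by rewrite ler_nat.
have UI : \bigcup_n I n = `]0%R, +oo[%classic.
  apply/seteqP; split => x.
    move=> [n _]; rewrite /I/= !in_itv/= andbT => /andP[nx _].
    by apply: lt_le_trans nx; rewrite invr_gt0.
  rewrite /= in_itv/= andbT => x0.
  pose n := maxn (Num.bound x) (Num.bound x^-1).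
  have [xn1 xn2] : (x < n.+1%:R)%R /\ (x^-1 < n.+1%:R)%R.
    split; [apply: lt_le_trans (unstable.ltr_bound x) _|
            apply: lt_le_trans (unstable.ltr_bound x^-1) _];
      by rewrite ler_nat (leq_trans _ (leqnSn _))// leq_max leqnn ?orbT.
  exists n => //; rewrite /I/= in_itv/= xn1 andbT.
  by rewrite invf_ple ?posrE// ltW.
have lim d1 (Om1 : measurableType d1) (P1 : probability Om1 R)
    (T1 : {RV P1 >-> R}) : P1 [set w | (0 < T1 w)%R] = 1 ->
    P1 (T1 @^-1` (A `&` I n)) @[n --> \oo] --> distribution P1 T1 A.
  move=> T10.
  have -> : distribution P1 T1 A = P1 (\bigcup_n T1 @^-1` (A `&` I n)).
    rewrite -preimage_bigcup -setI_bigcupr UI.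
    rewrite /distribution /pushforward preimage_setI.
    have mT : measurable (T1 @^-1` `]0%R, +oo[).
      by apply: measurable_funPTI.
    have mTA : measurable (T1 @^-1` A) by exact: measurable_funPTI.
    have -> : P1 (T1 @^-1` A) = P1 (T1 @^-1` A `&` T1 @^-1` `]0%R, +oo[) +
        P1 (T1 @^-1` A `&` ~` (T1 @^-1` `]0%R, +oo[)).
      rewrite -measureU//; last 3 first.
      - exact: measurableI.
      - by apply: measurableI => //; exact: measurableC.
      - by rewrite setIACA setICr setI0.
      by rewrite -setIUr setUCr setIT.
    rewrite [X in _ + X](_ : _ = 0) ?adde0//.
    apply/eqP; rewrite eq_le measure_ge0 andbT.
    apply: (@le_trans _ _ (P1 (~` (T1 @^-1` `]0%R, +oo[)))).
      apply: le_measure; rewrite ?inE//.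
      - by apply: measurableI => //; exact: measurableC.
      - exact: measurableC.
    rewrite probability_setC//.
    have -> : T1 @^-1` `]0%R, +oo[ = [set w | (0 < T1 w)%R].
      by apply/seteqP; split => w; rewrite /= in_itv/= andbT.
    by rewrite T10 subee.
  have mI n : measurable (T1 @^-1` (A `&` I n)).
    by apply: measurable_funPTI; apply: measurableI => //; exact: measurable_itv.
  apply: nondecreasing_cvg_mu => //; first exact: bigcupT_measurable.
  move=> m n mn; apply/subsetPset; apply: preimage_subset; apply: setIS.
  exact/subsetPset/ndI.
have lim1 := lim _ _ _ _ T0.
have lim2 := lim _ _ _ _ T0'.
apply: cvg_unique lim1 _ => //.
rewrite (_ : (fun n => _) = (fun n => P' (T' @^-1` (A `&` I n))))//.
by apply/funext => n; rewrite main// invr_gt0.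
Qed.

End law_of_increments.
(** * Prescribing the transform *)

Section prescribed_increments.
Local Open Scope ereal_scope.
Context (R : realType) d (Om : measurableType d) (P : probability Om R).
Variables (T : {RV P >-> R}) (c : R).
Notation mu := (@lebesgue_measure R).
Hypothesis c0 : (0 < c)%R.
Hypothesis Tmom : forall n, \int[P]_w (`|T w| ^+ n)%:E < +oo.

(** The mass that dH has to give to [a, b[ for c^-1 y exp (- y) dH(y) to be the
    law of T. *)
Definition increment_mass (a b : R) : \bar R :=
  \int[P]_w (c * inv_erlang1 (T w) * \1_`[a, b[ (T w))%:E.

Lemma increment_weight_ge0 a b w :
  (0 <= c * inv_erlang1 (T w) * \1_`[a, b[ (T w))%R.
Proof. exact: truncated_weight_ge0. Qed.

Lemma measurable_increment_weight a b : measurable_fun setT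
  (fun w => (c * inv_erlang1 (T w) * \1_`[a, b[ (T w))%:E).
Proof. by apply/measurable_EFinP; exact: measurable_truncated_weight. Qed.

Lemma increment_mass_ge0 a b : 0 <= increment_mass a b.
Proof. by apply: integral_ge0 => w _; rewrite lee_fin increment_weight_ge0. Qed.

Lemma increment_mass_fin a b : (0 < a)%R -> increment_mass a b \is a fin_num.
Proof.
move=> a0; rewrite ge0_fin_numE ?increment_mass_ge0//.
apply: (@le_lt_trans _ _ (\int[P]_w (cst (c * (expR b / a))%:E w))); last first.
  rewrite integral_cst//; apply: lte_mul_pinfty => //.
    by rewrite lee_fin mulr_ge0 ?divr_ge0 ?expR_ge0// ltW.
  exact: le_lt_trans (probability_le1 P measurableT) (ltry _).
apply: ge0_le_integral => //.
- by move=> w _; rewrite lee_fin increment_weight_ge0.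
- exact: measurable_increment_weight.
- move=> w _; rewrite lee_fin indicE mem_setE in_itv/=.
  have [/andP[aT Tb]|_] := boolP (a <= T w < b)%R; last first.
    by rewrite mulr0 mulr_ge0 ?divr_ge0 ?expR_ge0// ltW.
  have T0' := lt_le_trans a0 aT.
  rewrite mulr1 ler_pM2l// /inv_erlang1 T0' ler_pM ?expR_ge0 ?invr_ge0 ?(ltW T0')//.
    by rewrite ler_expR ltW.
  by rewrite lef_pV2 ?posrE.
Qed.

Lemma increment_massD a b e : (a <= b)%R -> (b <= e)%R ->
  increment_mass a e = increment_mass a b + increment_mass b e.
Proof.
move=> ab be; rewrite /increment_mass -ge0_integralD//.
- apply: eq_integral => w _; rewrite -EFinD -mulrDr; congr (_ * _)%:E.
  rewrite !indicE !mem_setE !in_itv/=.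
  have [Tb/=|bT/=] := ltP (T w) b.
    by rewrite (lt_le_trans Tb be) addr0.
  by rewrite (le_trans ab bT) andbF add0r.
- by move=> w _; rewrite lee_fin increment_weight_ge0.
- exact: measurable_increment_weight.
- by move=> w _; rewrite lee_fin increment_weight_ge0.
- exact: measurable_increment_weight.
Qed.

(** Integrating from the base point 1 avoids both ends of the half-line, where
    the mass may diverge. *)
Definition prescribed (k y : R) : R :=
  (k + if 1 <= y then fine (increment_mass 1 y)
       else - fine (increment_mass y 1))%R.

Lemma prescribed_increments k : represents_increments P T
  (fun w => c * inv_erlang1 (T w))%R (prescribed k).
Proof.
move=> a b a0 ab; rewrite -[RHS]/(increment_mass a b).
have b0 := lt_le_trans a0 ab.
rewrite -(fineK (increment_mass_fin b a0)); congr EFin.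
have D x y z : (0 < x)%R -> (x <= y)%R -> (y <= z)%R ->
    fine (increment_mass x z) =
    (fine (increment_mass x y) + fine (increment_mass y z))%R.
  move=> x0 xy yz; rewrite (increment_massD xy yz) fineD//.
    exact: increment_mass_fin.
  by apply: increment_mass_fin; exact: lt_le_trans xy.
rewrite /prescribed; have [a1|a1] := leP 1%R a.
  by rewrite (le_trans a1 ab) (D _ _ _ ltr01 a1 ab); ring.
have [b1|b1] := leP 1%R b.
  by rewrite (D _ _ _ a0 (ltW a1) b1); ring.
by rewrite (D _ _ _ a0 ab (ltW b1)); ring.
Qed.

Lemma prescribed_nd k y z : (0 < y)%R -> (y <= z)%R ->
  (prescribed k y <= prescribed k z)%R.
Proof.
apply: (represents_increments_nd _ (prescribed_increments k)) => w.
by rewrite mulr_ge0 ?inv_erlang1_ge0// ltW.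
Qed.

(** The increment from z to y is the mass of [z, y[, and these intervals shrink
    to the empty set as z increases to y. *)
Lemma prescribed_left_continuous k y : (0 < y)%R ->
  (prescribed k z @[z --> y^'-] --> prescribed k y)%classic.
Proof.
move=> y0.
(* With n + 2 the left end stays positive for n = 0. *)
pose lo (n : nat) : R := (y - y / n.+2%:R)%R.
have lo0 n : (0 < lo n)%R.
  rewrite subr_gt0 ltr_pdivrMr// ltr_pMr// ltr1n//.
have loy n : (lo n < y)%R by rewrite gtrBl divr_gt0.
pose N := density_measure P (measurable_funM (measurable_cst c)
  (measurable_inv_erlang1_comp T)) (fun w => mulr_ge0 (ltW c0)
  (inv_erlang1_ge0 (T w))).
pose E n := T @^-1` `[lo n, y[.
have NE n : N (E n) = increment_mass (lo n) y.
  rewrite /N /density_measure [LHS]integral_mkcond; apply: eq_integral => w _.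
  rewrite patchE indicE.
  have -> : (w \in E n) = (T w \in `[lo n, y[%classic).
    by apply/idP/idP; rewrite !inE.
  by case: ifP; rewrite ?mulr1 ?mulr0.
have mE n : measurable (E n) by apply: measurable_funPTI; exact: measurable_itv.
have E0 : \bigcap_n E n = set0.
  apply/seteqP; split => // w Ew.
  have Twy : (T w < y)%R by have := Ew 0%N I; rewrite /E/= in_itv/= => /andP[].
  pose n := Num.bound (y / (y - T w))%R.
  have := Ew n I; rewrite /E/= in_itv/= Twy andbT /lo lerBlDr -lerBlDl.
  rewrite ler_pdivlMr// mulrC -ler_pdivlMr ?subr_gt0// leNgt.
  rewrite (lt_trans (unstable.ltr_bound _))// ltr_nat.
  by rewrite -/n ltnS leqnSn.
have lim : N (E n) @[n --> \oo] --> 0.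
  rewrite -(measure0 N) -E0; apply: nonincreasing_cvg_mu => //.
  - have := increment_mass_fin y (lo0 0%N).
    by rewrite ge0_fin_numE ?increment_mass_ge0// -NE; exact.
  - exact: bigcapT_measurable.
  - move=> m n mn; apply/subsetPset; apply: preimage_subset.
    apply: subset_itv; rewrite bnd_simp//.
    by rewrite lerB// ler_pM2l// lef_pV2 ?posrE// ler_nat.
apply/cvgrPdist_lt => e e0.
have [n Nn] : exists n, increment_mass (lo n) y < e%:E.
  have lim' : fine (N (E n)) @[n --> \oo] --> (0 : R)%R by exact: (fine_cvg lim).
  have [n _ /(_ n (leqnn n)) Nn] : \forall n \near \oo, (fine (N (E n)) < e)%R.
    exact: (cvgr_lt _ lim').
  exists n; rewrite -(fineK (increment_mass_fin y (lo0 n))) lte_fin.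
  by rewrite -NE.
near=> z.
have zy : (z < y)%R by near: z; exact: nbhs_left_lt.
have lz : (lo n < z)%R by near: z; exact: nbhs_left_gt.
have z0 := lt_trans (lo0 n) lz.
rewrite ger0_norm; last by rewrite subr_ge0 prescribed_nd// ltW.
rewrite -lte_fin (prescribed_increments k z0 (ltW zy)).
apply: le_lt_trans Nn; rewrite (increment_massD (ltW lz) (ltW zy)) leeDr//.
exact: increment_mass_ge0.
Unshelve. all: by end_near. Qed.

Lemma outer_mass_erlang n (t : R) : outer_mass (@erlang R n) 1%R t =
  (if (1 <= t)%R then erlang_tail n t
   else if (0 < t)%R then 1 - erlang_tail n t else 0)%:E.
Proof.
have me D : measurable_fun D (EFin \o @erlang R n).
  apply/measurable_EFinP; apply: measurable_funTS; exact: measurable_erlang.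
rewrite /outer_mass; case: ifPn => t1.
  by rewrite integral_itv_obnd_cbnd// integral_erlang_itvy// (le_trans ler01).
case: ltP => t0; last by rewrite set_itv_ge ?integral_set0// bnd_simp -leNgt.
by rewrite integral_itv_obnd_cbnd// integral_erlang_itv// ltW.
Qed.

Lemma measurable_outer_mass_erlang n :
  measurable_fun setT (outer_mass (@erlang R n) 1%R).
Proof.
rewrite (_ : outer_mass _ _ = EFin \o (fun t : R => if (1 <= t)%R then
  erlang_tail n t else if (0 < t)%R then 1 - erlang_tail n t else 0)%R); last first.
  by apply/funext => t; rewrite outer_mass_erlang.
have mS : measurable_fun setT (@erlang_tail R n).
  by apply: measurable_sum => k; exact: measurable_erlang.
apply/measurable_EFinP; apply: measurable_fun_ifT => //.
  exact: measurable_fun_ler.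
apply: measurable_fun_ifT => //.
  exact: measurable_fun_ltr.
exact: measurable_funB.
Qed.

(** The factor exp (t) / t is unbounded at both ends. Near 0 it is compensated
    by the integral of erlang n over [0, t], which is at most t; beyond 1 by the
    Erlang tail, which is exp (- t) times a polynomial. *)
Lemma inv_erlang1_outer_mass n (t : R) : (0 < t)%R ->
  (inv_erlang1 t)%:E * outer_mass (@erlang R n) 1%R t <=
  (expR 1 + \sum_(k < n.+1) `|t| ^+ k)%:E.
Proof.
move=> t0; have me D : measurable_fun D (EFin \o @erlang R n).
  apply/measurable_EFinP; apply: measurable_funTS; exact: measurable_erlang.
have S0 : (0 <= \sum_(k < n.+1) `|t| ^+ k)%R by apply: sumr_ge0.
rewrite /outer_mass /inv_erlang1 t0; case: ifPn => t1.
  rewrite integral_itv_obnd_cbnd// integral_erlang_itvy ?(ltW t0)// -EFinM lee_fin.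
  apply: ler_wpDl; first exact: expR_ge0.
  rewrite /erlang_tail mulr_sumr; apply: ler_sum => k _.
  rewrite /erlang gtr0_norm// expRN.
  have e0 : expR t != 0%R by rewrite gt_eqF// expR_gt0.
  have -> : (expR t / t * (t ^+ k / k`!%:R * (expR t)^-1) =
    t ^+ k * (t^-1 * k`!%:R^-1))%R.
    have k0 : (k`!%:R != 0 :> R)%R by rewrite pnatr_eq0 -lt0n fact_gt0.
    move: k0 e0; move: (k`!%:R)%R (expR t) (t ^+ k)%R => a e b a0 e0.
    by field; rewrite a0 e0 gt_eqF.
  rewrite ler_piMr ?exprn_ge0 ?(ltW t0)//.
  rewrite mulr_ile1 ?invr_ge0 ?(ltW t0)//; first by rewrite invf_le1.
  by rewrite invf_le1 ?ltr0n ?fact_gt0// ler1n fact_gt0.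
rewrite -ltNge in t1.
apply: (@le_trans _ _ ((expR t / t)%:E * t%:E)).
  rewrite lee_wpmul2l ?lee_fin ?divr_ge0 ?expR_ge0 ?(ltW t0)//.
  apply: (@le_trans _ _ (\int[mu]_(y in `]0%R, t]) (cst 1%:E y))).
    apply: ge0_le_integral => //.
    - by move=> y; rewrite /= in_itv/= => /andP[y0 _]; rewrite lee_fin erlang_ge0// ltW.
    - exact: me.
    - by move=> y; rewrite /= in_itv/= => /andP[y0 _]; rewrite lee_fin erlang_le1// ltW.
  by rewrite integral_cst//= lebesgue_measure_itv/= lte_fin t0 sube0 mul1e.
rewrite -EFinM divfK ?gt_eqF// lee_fin.
by apply: ler_wpDr => //; rewrite ler_expR ltW.
Qed.

(** The integral of |H - H 1| against erlang n is an integral of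
    inv_erlang1 * outer_mass against the law of T, which the moments of T
    bound. *)
Lemma integrable_prescribed k n :
  mu.-integrable `]0%R, +oo[ (fun y => (prescribed k y * erlang n y)%:E).
Proof.
have mD : measurable (`]0%R, +oo[%classic : set (measurableTypeR R)) by [].
have mHe (k' : R) : measurable_fun (`]0%R, +oo[%classic : set (measurableTypeR R))
    (fun y => (prescribed k' y * erlang n y)%:E).
  apply/measurable_EFinP; apply: measurable_funM; last exact: measurable_erlang.
  apply: (@eq_measurable_fun _ _ _ _ _ (zero_ext (prescribed k'))).
    by move=> y; rewrite inE/= in_itv/= andbT /zero_ext => ->.
  apply: measurable_funTS; apply: measurable_zero_ext.
  by move=> y z; exact: prescribed_nd.
have int0 : mu.-integrable `]0%R, +oo[
    (fun y => (prescribed 0 y * erlang n y)%:E).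
  apply/integrableP; split; first exact: mHe.
  have p1 : prescribed 0 1 = 0%R.
    rewrite /prescribed lexx add0r /increment_mass integral0_eq// => w _.
    by rewrite set_itvxx indic0 mulr0.
  have dp1 y : prescribed 0 y = (prescribed 0 y - prescribed 0 1)%R.
    by rewrite p1 subr0.
  under eq_integral => y.
    rewrite inE/= in_itv/= andbT => y0.
    rewrite normrM (ger0_norm (erlang_ge0 _ (ltW y0))) (dp1 y).
    over.
  have mg : measurable_fun setT (fun w => c * inv_erlang1 (T w))%R.
    by apply: measurable_funM => //; exact: measurable_inv_erlang1_comp.
  have g0 w : (0 <= c * inv_erlang1 (T w))%R.
    by rewrite mulr_ge0 ?inv_erlang1_ge0// ltW.
  have gl w : (T w <= 0)%R -> (c * inv_erlang1 (T w) = 0)%R.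
    by move=> w0; rewrite inv_erlang1_le0// mulr0.
  rewrite (integral_abs_increment (measurable_funPT T) mg g0 gl
    (prescribed_increments 0) ltr01 (q := @erlang R n)); last 2 first.
  - exact: measurable_erlang.
  - by move=> y y0; rewrite erlang_ge0// ltW.
  have mpow k' : measurable_fun setT (fun w => (`|T w| ^+ k')%R).
    apply: (measurableT_comp (@exprn_measurable R setT k')).
    exact: (measurableT_comp (@normr_measurable R setT) (measurable_funPT T)).
  have mB : measurable_fun setT
      (fun w => (expR 1 + \sum_(k < n.+1) `|T w| ^+ k)%R).
    by apply: measurable_funD => //; exact: measurable_sum.
  have B0 w : (0 <= expR 1 + \sum_(k < n.+1) `|T w| ^+ k)%R.
    by rewrite addr_ge0 ?expR_ge0// sumr_ge0.
  apply: (@le_lt_trans _ _ (\int[P]_w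
      (c%:E * (expR 1 + \sum_(k < n.+1) `|T w| ^+ k)%:E))).
    apply: ge0_le_integral => //.
    - move=> w _; rewrite mule_ge0 ?lee_fin// /outer_mass.
      by case: ifPn => t1; apply: integral_ge0 => y; rewrite /= in_itv/= => yt;
        rewrite lee_fin erlang_ge0//; move: yt;
        [rewrite andbT => /ltW; apply: le_trans; rewrite (le_trans ler01)
        |move=> /andP[/ltW]].
    - apply: emeasurable_funM; first exact/measurable_EFinP.
      apply: (measurableT_comp (measurable_outer_mass_erlang n)).
      exact: measurable_funPT.
    - by apply: emeasurable_funM => //; exact/measurable_EFinP.
    - move=> w _; have [w0|w0] := leP (T w) 0%R.
        by rewrite gl// mul0e mule_ge0 ?lee_fin// ltW.
      by rewrite EFinM -muleA lee_wpmul2l ?lee_fin ?(ltW c0)//;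
        exact: inv_erlang1_outer_mass.
  have mBE := (measurable_EFinP _ _).2 mB.
  rewrite ge0_integralZl ?lee_fin ?(ltW c0)//.
  apply: lte_mul_pinfty => //; first by rewrite lee_fin ltW.
  under eq_integral do rewrite EFinD -sumEFin.
  have mpE (i : nat) := (measurable_EFinP _ _).2 (mpow i).
  have msE : measurable_fun setT (fun w => \sum_(i < n.+1) (`|T w| ^+ i)%:E).
    by apply: emeasurable_sum => i; exact: mpE.
  have p0 (i : nat) w : 0 <= (`|T w| ^+ i)%:E by rewrite lee_fin exprn_ge0.
  have s0 w : setT w -> 0 <= \sum_(i < n.+1) (`|T w| ^+ i)%:E.
    by move=> _; apply: sume_ge0.
  have e0 w : @setT Om w -> 0 <= (expR 1 : R)%:E by move=> _; rewrite lee_fin.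
  rewrite ge0_integralD// integral_cst// ge0_integral_sum//.
  apply: lte_add_pinfty.
    apply: lte_mul_pinfty => //.
    exact: le_lt_trans (probability_le1 P measurableT) (ltry _).
  - by apply: lte_sum_pinfty => i _; exact: Tmom.
  - by move=> i; exact: mpE.
  - by move=> w _; rewrite lee_fin.
have := integrableD mD int0 (integrableZl mD k (integrable_erlang R n)).
apply: eq_integrable => // y _.
by rewrite -EFinM -EFinD /prescribed; congr EFin; ring.
Qed.

End prescribed_increments.
(** * Random variables with a given quantile function *)

Section quantile_sample.
Local Open Scope ereal_scope.
Context (R : realType) d0 (Om0 : measurableType d0) (P0 : probability Om0 R).
Variables (V : nat -> {RV P0 >-> R}) (K : R -> R).
Hypothesis hV : iid_uniform V.
Hypothesis Knd : forall y z, (0 < y)%R -> (y <= z)%R -> (K y <= K z)%R.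
Hypothesis Klc : forall y, (0 < y)%R -> (K z @[z --> y^'-] --> K y)%classic.

(** The quantile coupling: K o L evaluated at a uniform variable. *)
Definition sample_fun (w : Om0) : R := zero_ext K (Lfun (V 0%N w)).

Lemma measurable_sample_fun : measurable_fun setT sample_fun.
Proof.
apply: (measurableT_comp (measurable_zero_ext Knd)).
exact: (measurableT_comp (@measurable_Lfun R)).
Qed.

HB.instance Definition _ :=
  isMeasurableFun.Build _ _ _ _ sample_fun measurable_sample_fun.

Definition sample : {RV P0 >-> R} := sample_fun.

Let outside := V 0%N @^-1` (~` `]0%R, 1%R[).

Let outside0 : P0 outside = 0.
Proof.
rewrite /outside (obs_law hV 0%N (measurableC _))// integral0_eq// => x nx.
by rewrite /monomial01 indicE memNset// !mulr0.
Qed.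

Let moutside : measurable outside.
Proof. by apply: measurable_funPTI; exact: measurableC. Qed.

Let uniform_ray u : (0 < u < 1)%R -> P0 (V 0%N @^-1` `]-oo, u]) = u%:E.
Proof.
move=> u01; have [_ /(_ 0%N `]-oo, u]%classic)] := hV.
by rewrite uniform_prob_ray//; apply.
Qed.

Let up_to_outside A B : measurable A -> measurable B -> A `<=` B `|` outside ->
  P0 A <= P0 B.
Proof.
move=> mA mB AB; apply: (@le_trans _ _ (P0 (B `|` outside))).
  by apply: le_measure; rewrite ?inE//; exact: measurableU.
rewrite -[leRHS]adde0 -[X in _ + X]outside0.
exact: measureU2.
Qed.

(** The quantile is determined by the inequality u <= F x, which has to be
    K (L u) <= x. If x < K (L u), left continuity provides z < L u with
    x < K z, so that F x is at most 1 - exp (- z), which is less than u. The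
    other implication is monotonicity of K. *)
Lemma quantile_sample u : (0 < u < 1)%R -> quantile (df sample) u = K (Lfun u).
Proof.
move=> u01; have /andP[u0 u1] := u01.
have mX x : measurable (sample @^-1` `]-oo, x]) by exact: measurable_funPTI.
have mV x : measurable (V 0%N @^-1` `]-oo, x]) by exact: measurable_funPTI.
have key x : (u <= df sample x)%R = (K (Lfun u) <= x)%R.
  apply/idP/idP => [ux|Kx].
    rewrite leNgt; apply/negP => xK.
    have [z [z0 zu xz]] : exists z, [/\ 0 < z, z < Lfun u & x < K z]%R.
      near (Lfun u)^'- => z; exists z; split.
      - by near: z; apply: nbhs_left_gt; exact: Lfun_gt0.
      - by near: z; exact: nbhs_left_lt.
      - by near: z; apply: (cvgr_gt _ (Klc (Lfun_gt0 u01))).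
    have /andP[v0 v1] := onem_expRN_gt0 z0.
    have : (df sample x <= 1 - expR (- z))%R.
      rewrite -lee_fin -cdf_df -uniform_ray ?v0//.
      apply: up_to_outside => // w /= sx.
      have [w01|w01] := boolP (0 < V 0%N w < 1)%R; last first.
        by right; rewrite /outside/= in_itv/=; exact/negP.
      left; rewrite /= in_itv/=; have /andP[w0 w1] := w01.
      rewrite -Lfun_le// Lfun_onem_expRN leNgt; apply/negP => zw.
      move: sx; rewrite in_itv/= /sample_fun /zero_ext Lfun_gt0// leNgt => /negP.
      by apply; apply: lt_le_trans xz (Knd z0 (ltW zw)).
    move=> /(le_trans ux); rewrite -(LfunK u1) lerD2l lerN2 ler_expR lerN2 leNgt.
    by rewrite zu.
  rewrite -lee_fin -cdf_df -(uniform_ray u01).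
  apply: up_to_outside => // w /=; rewrite in_itv/= => wu.
  have [w01|w01] := boolP (0 < V 0%N w < 1)%R; last first.
    by right; rewrite /outside/= in_itv/=; exact/negP.
  left; rewrite /= in_itv/= /sample_fun /zero_ext Lfun_gt0//.
  apply: le_trans Kx; apply: Knd; first exact: Lfun_gt0.
  by rewrite Lfun_le//; have /andP[] := w01.
apply/le_anti; rewrite quantile_le// key lexx/= -key -quantile_le// lexx//.
Unshelve. all: by end_near. Qed.

End quantile_sample.

(** * The class of random variables and its transforms *)

Section characterizations.
Local Open Scope ereal_scope.
Context (R : realType).
Notation mu := (@lebesgue_measure R).

Lemma Hstar_integrable (H : R -> R) n : in_Hstar_fun H ->
  mu.-integrable `]0%R, +oo[ (fun y => (H y * erlang n y)%:E).
Proof.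
move=> [_ Hnd _ Hint].
have mH : measurable_fun (`]0%R, +oo[%classic : set (measurableTypeR R)) H.
  apply: (@eq_measurable_fun _ _ _ _ _ (zero_ext H)).
    by move=> y; rewrite inE/= in_itv/= andbT /zero_ext => ->.
  by apply: measurable_funTS; exact: measurable_zero_ext.
apply/integrableP; split.
  by apply/measurable_EFinP; apply: measurable_funM => //; exact: measurable_erlang.
have mabs : measurable_fun (`]0%R, +oo[%classic : set (measurableTypeR R))
    (fun y : R => (y ^+ n * expR (- y) * `|H y|)%:E).
  apply/measurable_EFinP; apply: measurable_funM.
    apply: measurable_funTS; apply: measurable_funM; first exact: exprn_measurable.
    by apply: measurableT_comp.
  exact: measurableT_comp.
rewrite (_ : \int[mu]_(y in _) _ = (n`!%:R^-1)%:E * \int[mu]_(y in `]0%R, +oo[)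
    (y ^+ n * expR (- y) * `|H y|)%:E).
  by apply: lte_mul_pinfty => //; rewrite lee_fin invr_ge0.
have d0 y : `]0%R, +oo[%classic y -> 0 <= (y ^+ n * expR (- y) * `|H y|)%:E.
  rewrite /= in_itv/= andbT => y0.
  by rewrite lee_fin mulr_ge0 ?mulr_ge0 ?exprn_ge0 ?expR_ge0// ltW.
rewrite -ge0_integralZl ?lee_fin ?invr_ge0//.
apply: eq_integral => y; rewrite inE/= in_itv/= andbT => y0.
rewrite -EFinM normrM (ger0_norm (erlang_ge0 _ (ltW y0))) /erlang.
by congr EFin; ring.
Qed.

(** Inequalities u <= F x for all u in ]0, 1[ determine F, as u can be chosen
    strictly between two distinct values. *)
Lemma quantile_determines_law d (Om : measurableType d) (P : probability Om R)
    (X : {RV P >-> R}) d' (Om' : measurableType d') (P' : probability Om' R)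
    (X' : {RV P' >-> R}) :
  (forall u, (0 < u < 1)%R -> quantile (df X) u = quantile (df X') u) ->
  same_distribution X X'.
Proof.
move=> qE.
have le u x : (0 < u < 1)%R -> (u <= df X x)%R = (u <= df X' x)%R.
  by move=> u01; rewrite -!quantile_le// qE.
have half (a b : R) : (0 <= a)%R -> (a < b)%R -> (b <= 1)%R ->
    exists u, [/\ 0 < u < 1, a < u & u <= b]%R.
  move=> a0 ab b1; exists ((a + b) / 2)%R; split; lra.
have dfE x : df X x = df X' x.
  have /andP[F0 F1] := df01 X x; have /andP[F0' F1'] := df01 X' x.
  apply/eqP; rewrite eq_le; apply/andP; split; rewrite leNgt; apply/negP => lt.
    have [u [u01 lu ul]] := half _ _ F0' lt F1.
    by move: ul; rewrite le// leNgt lu.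
  have [u [u01 lu ul]] := half _ _ F0 lt F1'.
  by move: ul; rewrite -le// leNgt lu.
move=> A mA; apply: measure_unique_lrays => //.
  exact: le_lt_trans (probability_le1 (distribution P X) measurableT) (ltry _).
move=> x; apply: etrans (cdf_df X x) _; rewrite dfE.
exact: esym (cdf_df X' x).
Qed.

Lemma same_distribution_df d (Om : measurableType d) (P : probability Om R)
    (X : {RV P >-> R}) d' (Om' : measurableType d') (P' : probability Om' R)
    (X' : {RV P' >-> R}) :
  same_distribution X X' -> df X = df X'.
Proof. by move=> sd; apply/funext => x; rewrite /df /cdf sd. Qed.

Section given_T.
Context d (Om : measurableType d) (P : probability Om R) (T : {RV P >-> R}).
Variables (c : R) (H : R -> R).
Hypothesis c0 : (0 < c)%R.
Hypothesis T0 : P [set w | (0 < T w)%R] = 1.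
Hypothesis Hinc :
  represents_increments P T (fun w => c * inv_erlang1 (T w))%R H.
Hypothesis Hint : forall n,
  mu.-integrable `]0%R, +oo[ (fun y => (H y * erlang n y)%:E).

(** Up to a positive factor the moment of order n is a difference of two finite
    expected records. *)
Lemma represents_in_T : in_T T.
Proof.
split=> // n; rewrite unlock.
have := record_increment_moment (ltW c0) T0 Hinc Hint n.
have r m : \int[mu]_(y in `]0%R, +oo[) (H y * erlang m y)%:E \is a fin_num.
  exact: integrable_fin_num (Hint m).
rewrite -(fineK (r n)) -(fineK (r n.+1)) -EFinB.
have I0 : 0 <= \int[P]_w (`|T w| ^+ n)%:E.
  by apply: integral_ge0 => w _; rewrite lee_fin exprn_ge0.
rewrite ltNge leye_eq => E; apply/negP => /eqP I; move: E; rewrite I.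
by rewrite gt0_muley// lte_fin divr_gt0// ltr0n fact_gt0.
Qed.

End given_T.

Lemma in_T_moments d (Om : measurableType d) (P : probability Om R)
    (T : {RV P >-> R}) n : in_T T -> \int[P]_w (`|T w| ^+ n)%:E < +oo.
Proof. by move=> [_ /(_ n)]; rewrite unlock. Qed.

(** A constant function would have a constant expected record sequence, whereas
    the first increment of that sequence is c > 0. *)
Lemma prescribed_Hstar d (Om : measurableType d) (P : probability Om R)
    (T : {RV P >-> R}) (c k : R) : (0 < c)%R -> in_T T ->
  in_Hstar_fun (prescribed T c k).
Proof.
move=> c0 hT; have [T0 _] := hT.
have Tmom n := in_T_moments n hT.
have Hint := integrable_prescribed c0 Tmom k.
have Hinc := prescribed_increments T c0 k.
split.
- apply: contrapT => const.
  have constE y : (0 < y)%R -> prescribed T c k y = prescribed T c k 1.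
    move=> y0; apply: contrapT => ne; apply: const.
    by exists y, 1%R; split.
  have e n : \int[mu]_(y in `]0%R, +oo[) (prescribed T c k y * erlang n y)%:E =
      (prescribed T c k 1)%:E.
    transitivity (\int[mu]_(y in `]0%R, +oo[)
        ((prescribed T c k 1)%:E * (erlang n y)%:E)).
      apply: eq_integral => y; rewrite inE/= in_itv/= andbT => y0.
      by rewrite constE// EFinM.
    by rewrite integralZl//; [rewrite integral_erlang mule1|exact: integrable_erlang].
  have I1 : \int[P]_w (`|T w| ^+ 0)%:E = 1.
    under eq_integral do rewrite expr0.
    by rewrite integral_cst// mul1e; exact: probability_setT.
  have := record_increment_moment (ltW c0) T0 Hinc Hint 0.
  rewrite !e subee// I1 mule1 divr1 => /eqP.
  by rewrite eqe eq_sym gt_eqF.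
- by move=> y z; exact: (prescribed_nd T c0).
- by move=> y; exact: (prescribed_left_continuous c0).
- move=> m; have /integrableP[_] := Hint m.
  move=> fin; rewrite (_ : \int[mu]_(y in _) _ = (m`!%:R)%:E *
    \int[mu]_(y in `]0%R, +oo[) `|(prescribed T c k y * erlang m y)%:E|).
    by apply: lte_mul_pinfty.
  rewrite -ge0_integralZl//; last first.
    apply: measurableT_comp => //.
    exact: (measurable_int _ (Hint m)).
  apply: eq_integral => y; rewrite inE/= in_itv/= andbT => y0.
  rewrite -EFinM normrM (ger0_norm (erlang_ge0 _ (ltW y0))) /erlang.
  congr EFin; have m0 : (m`!%:R != 0 :> R)%R by rewrite pnatr_eq0 -lt0n fact_gt0.
  by move: m0; move: (m`!%:R)%R => a a0; field.
Qed.

End characterizations.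
(** * The two characterizations *)

Section expected_records.
Local Open Scope ereal_scope.
Context (R : realType).
Notation mu := (@lebesgue_measure R).

(** The expected record sequence of a variable with quantile function H o L. *)
Definition rho (H : R -> R) n : \bar R :=
  \int[mu]_(y in `]0%R, +oo[) (H y * erlang n y)%:E.

Lemma rho_fin H n : in_Hstar_fun H -> rho H n \is a fin_num.
Proof. by move=> hH; exact: integrable_fin_num (Hstar_integrable n hH). Qed.

Lemma rho_addC H k n : in_Hstar_fun H ->
  rho (fun y => k + H y)%R n = k%:E + rho H n.
Proof.
move=> hH.
have mD : measurable (`]0%R, +oo[%classic : set (measurableTypeR R)) by [].
rewrite /rho; under eq_integral do rewrite mulrDl EFinD.
rewrite integralD//; last 2 first.
- have := integrableZl mD k (integrable_erlang R n).
  by apply: eq_integrable => // y _; rewrite EFinM.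
- exact: Hstar_integrable.
congr (_ + _); under eq_integral do rewrite EFinM.
by rewrite integralZl//; [rewrite integral_erlang mule1|exact: integrable_erlang].
Qed.

Lemma rho_ext H H' n : (forall y, (0 < y)%R -> H y = H' y) -> rho H n = rho H' n.
Proof.
by move=> HH'; apply: eq_integral => y; rewrite inE/= in_itv/= andbT => /HH' ->.
Qed.

(** In the applications I n is the moment of order n of a transform, so that the
    sequence is determined by its first term, c and the moments. *)
Lemma rho_eq (H H' : R -> R) (c : R) (I : nat -> \bar R) :
  in_Hstar_fun H -> in_Hstar_fun H' -> rho H 0 = rho H' 0 ->
  (forall n, rho H n.+1 - rho H n = (c / n.+1`!%:R)%:E * I n) ->
  (forall n, rho H' n.+1 - rho H' n = (c / n.+1`!%:R)%:E * I n) ->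
  forall n, rho H n = rho H' n.
Proof.
move=> hH hH' r0 step step'; elim=> // n IH.
have := step n; rewrite -step' IH => e.
by rewrite -(subeK (rho H n.+1) (rho_fin n hH')) e subeK// rho_fin.
Qed.

End expected_records.

Section main_directions.
Local Open Scope ereal_scope.
Context (R : realType) d0 (Om0 : measurableType d0) (P0 : probability Om0 R).
Variables (V : nat -> {RV P0 >-> R}).
Hypothesis hV : iid_uniform V.
Notation mu := (@lebesgue_measure R).

Lemma expected_record_rho d (Om : measurableType d) (P : probability Om R)
    (X : {RV P >-> R}) H n : in_Hstar_fun H ->
  (forall u, (0 < u < 1)%R -> quantile (df X) u = H (Lfun u)) ->
  expected_record V X n = rho H n.
Proof. by move=> [_ Hnd _ _] XH; exact: expected_recordE. Qed.

Lemma quantile_at (F H : R -> R) y :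
  (forall u, (0 < u < 1)%R -> quantile F u = H (Lfun u)) ->
  (0 < y)%R -> H y = quantile F (1 - expR (- y)).
Proof. by move=> FH y0; rewrite FH ?onem_expRN_gt0// Lfun_onem_expRN. Qed.

Context d (Om : measurableType d) (P : probability Om R).
Variables (X : {RV P >-> R}) (H : R -> R).
Hypothesis hH : in_Hstar_fun H.
Hypothesis XH : forall u, (0 < u < 1)%R -> quantile (df X) u = H (Lfun u).
Context d' (Om' : measurableType d') (P' : probability Om' R).
Variable T : {RV P' >-> R}.
Hypothesis hT : is_phi X T.

Let Hnd : forall y z, (0 < y)%R -> (y <= z)%R -> (H y <= H z)%R.
Proof. by case: hH. Qed.
Let Hint n : mu.-integrable `]0%R, +oo[ (fun y => (H y * erlang n y)%:E).
Proof. exact: Hstar_integrable. Qed.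
Let c := phi_mass X.
Let c0 : (0 < c)%R. Proof. by have [] := phi_mass_gt0 hT. Qed.
Let Hinc : represents_increments P' T (fun w => c * inv_erlang1 (T w))%R H.
Proof. exact: (phi_represents Hnd XH hT). Qed.
Let T0 : P' [set w | (0 < T w)%R] = 1.
Proof. exact: (phi_pos hT). Qed.

Lemma phi_in_T : in_T T.
Proof. exact: (represents_in_T c0 T0 Hinc Hint). Qed.

Lemma phi_moments n : rho H n.+1 - rho H n =
  (c / n.+1`!%:R)%:E * \int[P']_w (`|T w| ^+ n)%:E.
Proof. exact: (record_increment_moment (ltW c0) T0 Hinc Hint). Qed.

(** Given a competitor T1 with the moments of T, prescribe the function K whose
    increments have T1 as transform, shifted to make the first expected records
    agree. A variable X1 with quantile function K o L then has the expected
    records of X, hence its law, so K = H; and the increments of K give back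
    the law of T1. *)
Lemma records_imply_moments :
  characterized_by_expected_records V X -> characterized_by_moments T.
Proof.
move=> charX d1 Om1 P1 T1 hT1 eqmom.
have [T10 _] := hT1.
have hK k := prescribed_Hstar k c0 hT1.
pose k := (fine (rho H 0) - fine (rho (prescribed T1 c 0) 0))%R.
pose K := prescribed T1 c k.
have hKk : in_Hstar_fun K by exact: hK.
have KE y : K y = (k + prescribed T1 c 0 y)%R.
  by rewrite /K /prescribed add0r.
have K0 : rho K 0 = rho H 0.
  rewrite (rho_ext (H' := fun y => k + prescribed T1 c 0 y)%R)//.
  rewrite rho_addC; last exact: hK.
  rewrite -(fineK (rho_fin 0 (hK 0%R))) -[RHS](fineK (rho_fin 0 hH)).
  by rewrite -EFinD /k subrK.
have Kstep n : rho K n.+1 - rho K n =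
    (c / n.+1`!%:R)%:E * \int[P']_w (`|T w| ^+ n)%:E.
  rewrite -(moment_abs T0) -eqmom (moment_abs T10).
  apply: (record_increment_moment (ltW c0) T10 (prescribed_increments T1 c0 k)).
  by move=> m; exact: Hstar_integrable.
have rhoE := rho_eq hKk hH K0 Kstep phi_moments.
have [_ Knd Klc _] := hKk.
pose X1 := sample V Knd.
have X1K u : (0 < u < 1)%R -> quantile (df X1) u = K (Lfun u).
  exact: quantile_sample.
have X1X : same_distribution X1 X.
  apply: charX => [|n]; first by exists K.
  by rewrite (expected_record_rho n hKk X1K) (expected_record_rho n hH XH).
have dfE := same_distribution_df X1X.
apply: (same_law_of_increments c0 T10 T0 (prescribed_increments T1 c0 k) Hinc).
have KH y : (0 < y)%R -> prescribed T1 c k y = H y.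
  by move=> y0; rewrite (quantile_at XH y0) -dfE -(quantile_at X1K y0).
by move=> a b a0 ab; rewrite !KH// (lt_le_trans a0 ab).
Qed.

(** If X1 has the expected records of X, its transform T2 has the same
    normalising constant and the same moments as T, hence the same law. The two
    laws determine the increments of H1 and H, so these functions differ by a
    constant, which the first expected record shows to be 0. *)
Lemma moments_imply_records :
  characterized_by_moments T -> characterized_by_expected_records V X.
Proof.
move=> charT d1 Om1 P1 X1 [H1 hH1 X1H1] eqrec.
have rhoE n : rho H1 n = rho H n.
  by rewrite -(expected_record_rho n hH1 X1H1) eqrec (expected_record_rho n hH XH).
have [_ H1nd _ _] := hH1.
have H1int n := Hstar_integrable n hH1.
have massE : \int[mu]_x (phi_weight (df X1) x)%:E = c%:E.
  rewrite (integral_phi_weight H1nd X1H1 H1int) -!/(rho H1 _) !rhoE.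
  by rewrite -(integral_phi_weight Hnd XH Hint); have [] := phi_mass_gt0 hT.
have cE : phi_mass X1 = c by rewrite /phi_mass /Rintegral massE.
have [d2 [Om2 [P2 [T2 hT2]]]] : exists d2 (Om2 : measurableType d2)
    (P2 : probability Om2 R) (T2 : {RV P2 >-> R}), is_phi X1 T2.
  by apply: exists_phi; rewrite cE.
have T20 := phi_pos hT2.
have Hinc2 := phi_represents H1nd X1H1 hT2.
rewrite cE in Hinc2.
have hT2' : in_T T2 := represents_in_T c0 T20 Hinc2 H1int.
have T2T : same_distribution T2 T.
  apply: charT => // n; rewrite (moment_abs T20) (moment_abs T0).
  have := record_increment_moment (ltW c0) T20 Hinc2 H1int n.
  rewrite -!/(rho H1 _) !rhoE phi_moments => e.
  have cn : (0 < c / n.+1`!%:R)%R by rewrite divr_gt0// ltr0n fact_gt0.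
  have f2 : \int[P2]_w (`|T2 w| ^+ n)%:E \is a fin_num.
    rewrite ge0_fin_numE; first exact: in_T_moments.
    by apply: integral_ge0 => w _; rewrite lee_fin exprn_ge0.
  have f1 : \int[P']_w (`|T w| ^+ n)%:E \is a fin_num.
    rewrite ge0_fin_numE; first exact: (in_T_moments n phi_in_T).
    by apply: integral_ge0 => w _; rewrite lee_fin exprn_ge0.
  move: e; rewrite -(fineK f1) -(fineK f2) -!EFinM => -[].
  by move=> /(mulfI (lt0r_neq0 cn)) ->.
have HH1 a b : (0 < a)%R -> (a <= b)%R -> (H1 b - H1 a = H b - H a)%R.
  move=> a0 ab; apply: EFin_inj; rewrite Hinc2// Hinc//.
  pose h (t : R) := (c * inv_erlang1 t * \1_`[a, b[ t)%:E.
  have mh : measurable_fun setT h.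
    apply/measurable_EFinP; apply: measurable_funM; last exact: measurable_indic.
    by apply: measurable_funM => //; exact: measurable_inv_erlang1.
  have h0 t : 0 <= h t.
    by rewrite lee_fin !mulr_ge0 ?inv_erlang1_ge0// ltW.
  apply: etrans (esym (ge0_integral_distribution T2 mh h0)) _.
  apply: etrans (ge0_integral_distribution T mh h0).
  by apply: eq_measure_integral => A mA _; exact: T2T.
pose k := (H1 1 - H 1)%R.
have H1E y : (0 < y)%R -> H1 y = (k + H y)%R.
  move=> y0; rewrite /k; have [y1|y1] := leP 1%R y.
    by have := HH1 _ _ ltr01 y1; lra.
  by have := HH1 _ _ y0 (ltW y1); lra.
have k0 : k = 0%R.
  have := rhoE 0%N; rewrite (rho_ext 0 H1E) rho_addC//.
  rewrite -(fineK (rho_fin 0 hH)) -EFinD => -[] /eqP.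
  by rewrite -subr_eq0 addrK => /eqP.
apply: quantile_determines_law => u u01.
by rewrite X1H1// XH// H1E ?Lfun_gt0// k0 add0r.
Qed.

End main_directions.

Theorem theorem2p3 (R : realType)
  (d0 : measure_display) (Om0 : measurableType d0) (P0 : probability Om0 R)
  (V : nat -> {RV P0 >-> R}) (hV : iid_uniform V)
  (d : measure_display) (Om : measurableType d) (P : probability Om R)
  (X : {RV P >-> R}) (hX : in_Hstar X)
  (d' : measure_display) (Om' : measurableType d') (P' : probability Om' R)
  (T : {RV P' >-> R}) (hT : is_phi X T) :
  in_T T /\
  (characterized_by_expected_records V X <-> characterized_by_moments T).
Proof.
have [H hH XH] := hX.
split; first exact: (phi_in_T hH XH hT).
split; first exact: (records_imply_moments hV hH XH hT).
exact: (moments_imply_records hV hH XH hT).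
Qed.
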